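(* Let $\gamma>0$ be a non-integer real number, let $\Omega\subset\mathbb{R}^n$ be a smooth domain, and let $f\in H^\gamma(\mathbb{R}^n)$ be a function on $\mathbb{R}^n$ such that $$(-\Delta)^\gamma f=0\quad\text{in }\Omega .$$ If $f$ vanishes to infinite order at some point $x_0\in\Omega$, that is, for every $k\in\mathbb{N}$, $$\int_{B_r(x_0)}|f(x)|\,dx=O(r^k)\quad\text{for sufficiently small } r>0,$$ then $f$ is identically $0$ in $\Omega$.
   Context: $(-\Delta)^\gamma$ is the fractional Laplacian on $\mathbb{R}^n$, i.e. the operator with Fourier symbol $|\xi|^{2\gamma}$. $B_r(x_0)$ is the ball of radius $r$ in $\mathbb{R}^n$ centered at $x_0$. A domain is a connected open set. *)

(* Defs.v *)
From HB Require Import structures.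
From mathcomp Require Import all_boot all_order all_algebra.
From mathcomp Require Import all_classical all_reals all_analysis.
From mathcomp Require Import complex.

Set Implicit Arguments.
Unset Strict Implicit.
Unset Printing Implicit Defensive.

Import Order.TTheory GRing.Theory Num.Theory.
Import numFieldNormedType.Exports.

Local Open Scope classical_set_scope.
Local Open Scope ring_scope.

Fact rV_display : measure_display.
Proof. exact: default_measure_display. Qed.

Section measurable_rV.
Context (R : realType) (n : nat).

Definition rVcoord (i : 'I_n) (v : 'rV[R]_n) : R := v 0 i.

Let rV_set0 : g_sigma_preimage rVcoord set0.
Proof. exact: sigma_algebra0. Qed.

Let rV_setC A : g_sigma_preimage rVcoord A -> g_sigma_preimage rVcoord (~` A).
Proof. exact: sigma_algebraC. Qed.

Let rV_bigcup (F : _^nat) : (forall i, g_sigma_preimage rVcoord (F i)) ->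
  g_sigma_preimage rVcoord (\bigcup_i (F i)).
Proof. exact: sigma_algebra_bigcup. Qed.

(* The product sigma-algebra on R^n, i.e. the Borel one. *)
HB.instance Definition _ := @isMeasurable.Build
  rV_display 'rV[R]_n
  (g_sigma_preimage rVcoord) rV_set0 rV_setC rV_bigcup.


Lemma measurable_rVcoord i : measurable_fun [set: 'rV[R]_n] (rVcoord i).
Proof.
move=> _ Y mY; rewrite setTI; apply: sub_sigma_algebra => /=.
rewrite -bigcup_seq/=; exists i => /=; first by rewrite mem_index_enum.
by exists Y => //; rewrite setTI.
Qed.

Lemma measurable_fun_rVP d (T : measurableType d) (f : T -> 'rV[R]_n) :
  (forall i, measurable_fun [set: T] (fun x => f x 0 i)) ->
  measurable_fun [set: T] f.
Proof.
move=> mf _ A mA; rewrite setTI.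
suff : g_sigma_preimage rVcoord `<=` [set B | measurable (f @^-1` B)] by apply.
apply: smallest_sub => [|B]; first split => //=.
- by rewrite preimage_set0.
- by move=> B mB; rewrite setTD preimage_setC; exact: measurableC.
- by move=> F mF; rewrite preimage_bigcup; exact: bigcup_measurable.
rewrite -bigcup_seq => -[i _] [C mC <-] /=; rewrite setTI -comp_preimage.
by have := mf i measurableT C mC; rewrite setTI.
Qed.

End measurable_rV.

Section lebesgue_rV.
Context (R : realType).

Definition consrV n (p : measurableTypeR R * 'rV[R]_n) : 'rV[R]_n.+1 :=
  row_mx (const_mx p.1 : 'rV_1) p.2.

Definition splitrV n (v : 'rV[R]_n.+1) : measurableTypeR R * 'rV[R]_n :=
  (v 0 ord0, \row_j v 0 (lift ord0 j)).

Lemma consrVE n p (i : 'I_n.+1) :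
  consrV p 0 i = oapp (fun j => p.2 0 j) p.1 (unlift ord0 i).
Proof.
rewrite /consrV; case: unliftP => [j ->|->] /=.
  rewrite (_ : lift ord0 j = rshift 1 j :> 'I_(1 + n)); last exact/ord_inj.
  exact: row_mxEr.
rewrite (_ : ord0 = lshift n ord0 :> 'I_(1 + n)); last exact/ord_inj.
by apply: etrans (row_mxEl _ _ _ _) _; rewrite mxE.
Qed.

Lemma consrVK n : cancel (@consrV n) (@splitrV n).
Proof.
move=> [x v]; congr pair; first by rewrite consrVE unlift_none.
by apply/rowP => j; rewrite mxE consrVE liftK.
Qed.

Lemma measurable_consrV n : measurable_fun setT (@consrV n).
Proof.
apply: measurable_fun_rVP => i.
under eq_fun do rewrite consrVE.
case: (unlift ord0 i) => [j|] /=; last exact: measurable_fst.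
by apply: (@measurableT_comp _ _ _ _ _ _ (rVcoord j)); first exact: measurable_rVcoord.
Qed.

HB.instance Definition _ n := isMeasurableFun.Build _ _ _ _
  (@consrV n) (@measurable_consrV n).

Lemma measurable_splitrV n : measurable_fun setT (@splitrV n).
Proof.
apply/measurable_fun_pairP; split; first exact: (@measurable_rVcoord R n.+1 ord0).
apply: measurable_fun_rVP => i.
under eq_fun do rewrite /= mxE.
exact: measurable_rVcoord.
Qed.

Section cons_measure.
Context n (mu : {sigma_finite_measure set 'rV[R]_n -> \bar R}).

Definition cons_measure : set 'rV[R]_n.+1 -> \bar R :=
  pushforward (@lebesgue_measure R \x mu)%E (@consrV n).

Let cons_measure0 : cons_measure set0 = 0%E.
Proof. by rewrite /cons_measure /pushforward preimage_set0 measure0. Qed.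

Let cons_measure_ge0 A : (0 <= cons_measure A)%E.
Proof. by rewrite /cons_measure /pushforward measure_ge0. Qed.

Let cons_measure_sigma_additive : semi_sigma_additive cons_measure.
Proof.
exact: (@measure_semi_sigma_additive _ _ _
  (pushforward (@lebesgue_measure R \x mu)%E (@consrV n : _ -> _))).
Qed.

HB.instance Definition _ := isMeasure.Build _ _ _ cons_measure
  cons_measure0 cons_measure_ge0 cons_measure_sigma_additive.

Let cons_measure_sigma_finite : sigma_finite setT cons_measure.
Proof.
have /sigma_finiteP[F [FT ndF Foo]] := sigma_finiteT (@lebesgue_measure R).
have /sigma_finiteP[G [GT ndG Goo]] := sigma_finiteT mu.
exists (fun k => @splitrV n @^-1` (F k `*` G k)).
  rewrite -preimage_bigcup -[LHS](preimage_setT (@splitrV n)); congr preimage.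
  apply/esym; rewrite -subTset => -[x y] _.
  have [k _ Fx] : (\bigcup_k F k) x by rewrite -FT.
  have [l _ Gy] : (\bigcup_k G k) y by rewrite -GT.
  exists (maxn k l) => //; split => /=.
  - by move: x Fx; exact/subsetPset/ndF/leq_maxl.
  - by move: y Gy; exact/subsetPset/ndG/leq_maxr.
move=> k; have [mF Fk] := Foo k; have [mG Gk] := Goo k; split.
  rewrite -[X in measurable X]setTI; apply: measurable_splitrV => //.
  exact: measurableX.
rewrite /cons_measure /pushforward -comp_preimage.
rewrite (_ : _ \o _ = id) ?preimage_id; last by apply/funext; exact: consrVK.
by rewrite product_measure1E// lte_mul_pinfty// ge0_fin_numE.
Qed.

HB.instance Definition _ := Measure_isSigmaFinite.Build _ _ _
  cons_measure cons_measure_sigma_finite.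

End cons_measure.

Fixpoint lebesgue_rV n : {sigma_finite_measure set 'rV[R]_n -> \bar R} :=
  if n is n'.+1 then cons_measure (lebesgue_rV n') else \d_(0 : 'rV[R]_0).

End lebesgue_rV.

Lemma lebesgue_rV_box (R : realType) n (A : 'I_n -> set R) :
  (forall i, measurable (A i)) ->
  lebesgue_rV R n [set v | forall i, A i (v 0 i)] =
  (\prod_(i < n) lebesgue_measure (A i))%E.
Proof.
elim: n A => [|n IHn] A mA /=.
  rewrite big_ord0 diracE mem_set//=; by case.
rewrite big_ord_recl -IHn// /cons_measure /pushforward -product_measure1E//.
  congr (_ _); apply/seteqP; split => [[x v] /= Av|[x v] /= [Ax Av] i].
    split => [|i]; first by have := Av ord0; rewrite consrVE unlift_none.
    by have := Av (lift ord0 i); rewrite consrVE liftK.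
  by rewrite consrVE; case: unliftP => [j ->|->] //=; exact: Av.
  exact: mA.
rewrite [X in measurable X](_ : _ = \bigcap_(i in [set: 'I_n])
    (@rVcoord R n i @^-1` A (lift ord0 i))); last first.
  by apply/seteqP; split => v /= Av i => [_|]; exact: Av.
apply: fin_bigcap_measurable => // i _.
by rewrite -[X in measurable X]setTI; exact: measurable_rVcoord.
Qed.

Section fractional_laplacian.
Import ComplexField.Normc.
Context (R : realType) (n : nat).
Local Notation E := 'rV[R]_n.
Local Notation mu := (lebesgue_rV R n).
Local Notation Re := complex.Re.
Local Notation Im := complex.Im.
Local Open Scope complex_scope.

Definition dotrV (x y : E) : R := \sum_(i < n) x 0 i * y 0 i.

(* The norm [`|x|] of the library on row vectors is the sup norm. *)
Definition enorm (x : E) : R := Num.sqrt (dotrV x x).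

Definition eball (x : E) (r : R) : set E := [set y | enorm (y - x) < r].

Definition cintegral (f : E -> R[i]) : R[i] :=
  (\int[mu]_x Re (f x)) +i* (\int[mu]_x Im (f x)).

Definition memL2 (f : E -> R[i]) : Prop :=
  [/\ measurable_fun setT (fun x => Re (f x)),
      measurable_fun setT (fun x => Im (f x)) &
      (\int[mu]_x (normc (f x) ^+ 2)%:E < +oo)%E].

Definition fourier (f : E -> R[i]) (xi : E) : R[i] :=
  cintegral (fun x => (cos (dotrV x xi) -i* sin (dotrV x xi)) * f x).

Definition truncate (N : nat) (f : E -> R[i]) (x : E) : R[i] :=
  (\1_(eball 0 N%:R) x)%:C * f x.

(* Plancherel: the transform of an L^2 function is the L^2 limit of the
   transforms of its truncations to balls, which are integrable. *)
Definition is_fourierL2 (f g : E -> R[i]) : Prop :=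
  [/\ memL2 f, memL2 g &
      (fun N : nat =>
        \int[mu]_xi (normc (fourier (truncate N f) xi - g xi) ^+ 2)%:E)%E
        @ \oo --> 0%E].

Definition fourierL2 (f : E -> R[i]) : E -> R[i] :=
  xget (fun=> 0) [set g | is_fourierL2 f g].

(* [fourierL2 f] is only determined up to a null set, and the first conjunct
   ensures that it is not the default value of [xget]. *)
Definition sobolevH (s : R) (f : E -> R[i]) : Prop :=
  is_fourierL2 f (fourierL2 f) /\
  (\int[mu]_xi
     ((1 + enorm xi ^+ 2) `^ s * normc (fourierL2 f xi) ^+ 2)%:E < +oo)%E.

Definition partial (i : 'I_n) (g : E -> R) : E -> R := 'D_(delta_mx 0 i) g.

Definition smooth (g : E -> R) : Prop := forall s : seq 'I_n,
  continuous (foldr partial g s) /\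
  forall i x, derivable (foldr partial g s) x (delta_mx 0 i).

Definition test_function (Omega : set E) (phi : E -> R[i]) : Prop :=
  [/\ smooth (fun x => Re (phi x)), smooth (fun x => Im (phi x)),
      compact (closure [set x | phi x != 0]) &
      closure [set x | phi x != 0] `<=` Omega].

(* The distribution (-Delta)^gamma f, whose Fourier transform is
   |xi|^(2 gamma) times that of f, paired with phi: by Fourier inversion
   <T, phi> = (2 pi)^(-n) \int (F T)(xi) (F phi)(- xi) dxi. *)
Definition fraclap (gamma : R) (f phi : E -> R[i]) : R[i] :=
  ((2 * pi) ^- n)%:C *
  cintegral (fun xi =>
    (enorm xi `^ (2 * gamma))%:C * fourierL2 f xi * fourier phi (- xi)).

Definition fraclap_eq0_in (gamma : R) (f : E -> R[i]) (Omega : set E) : Prop :=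
  forall phi, test_function Omega phi -> fraclap gamma f phi = 0.

(* Near each boundary point, Omega is the sublevel set of a smooth function
   with nonvanishing gradient. *)
Definition smooth_boundary (Omega : set E) : Prop :=
  forall p, (closure Omega `\` Omega^°) p ->
  exists g : E -> R, [/\ smooth g, exists i, partial i g p != 0 &
    \forall x \near p, Omega x <-> g x < 0].

Definition smooth_domain (Omega : set E) : Prop :=
  [/\ open Omega, connected Omega & smooth_boundary Omega].

Definition vanishes_infinite_order (f : E -> R[i]) (x0 : E) : Prop :=
  forall k : nat,
    (fun r : R => \int[mu]_(x in eball x0 r) normc (f x)) =O_ (0^'+)
    (fun r : R => r ^+ k).

End fractional_laplacian.

(* Main.v *)
(* Let F(t, X) be the integral of exp(i X.xi - t |xi|^2) times the Fourier transform of f,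
   which is, up to a constant, the heat extension of f, and is entire in X.  Where
   (-Delta)^gamma f = 0, the heat extension of (-Delta)^gamma f stays bounded as t tends to 0
   near every real point z, even for slightly complex X, because a cut-off Gaussian is a test
   function and what is cut off is O(exp(- c / t)).  Euler's integral for Gamma(gamma)
   expresses exp(- t |xi|^2) through |xi|^(2 gamma) exp(- s |xi|^2) with s > t, which
   transfers this bound to F.  If f vanishes to infinite order at z, then F(t, X) = O(t^k) for
   |X - z| <= t and every k, so by Cauchy's estimates every Taylor coefficient of F(t, .) at z
   tends to 0 with t.  As F(t, .) is bounded in a fixed complex ball, F(t, x) tends to 0 for
   every real x in a smaller ball, so f = 0 almost everywhere there.  The radius of this ball
   depends only on the distance from z to the boundary of Omega, so the set of points near
   which f vanishes is open and relatively closed in Omega. *)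
From HB Require Import structures.
Require Import Defs.
From mathcomp Require Import all_boot all_order all_algebra.
From mathcomp Require Import all_classical all_reals all_analysis.
From mathcomp Require Import measurable_realfun complex ring lra.

Set Implicit Arguments.
Unset Strict Implicit.
Unset Printing Implicit Defensive.

Import Order.TTheory GRing.Theory Num.Theory.
Import numFieldNormedType.Exports.
Import ComplexField.Normc.

Local Open Scope classical_set_scope.
Local Open Scope ring_scope.
Local Notation Re := complex.Re.
Local Notation Im := complex.Im.

(** * Complex-valued integrals *)

(** As f is only an L^2 class, vanishing to infinite order says nothing about derivatives of f; the
    Taylor coefficients of F(t, .) at z stand in for them. Their decay alone would not make F small
    at a fixed distance from z, since only finitely many of them can be made small at once; the
    bound on a complex ball whose radius does not depend on t controls the tail of the series, and
    it is all that is drawn from the equation. This bound has to survive complex X: moving the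
    center of a Gaussian by an imaginary vector of size de in each of n coordinates multiplies its
    modulus by up to exp(n de^2 / (4 t)), and the smallness of what is cut off at distance eta has
    to beat this growth; hence the conditions [de <= eta / 10] and
    [n%:R * de ^+ 2 <= eta ^+ 2 / 10]. Kernels, cutoffs and weights are products over the
    coordinates, even where a radial choice would be usual, so that integrals, Fourier transforms
    and smoothness reduce to the line. *)

Section normc_extra.
Context {R : realType}.
Implicit Types z w : R[i].
Local Open Scope complex_scope.

Lemma normcE z : normc z = Num.sqrt (Re z ^+ 2 + Im z ^+ 2).
Proof. by case: z. Qed.

Lemma normc_ge0 z : 0 <= normc z.
Proof. by rewrite normcE sqrtr_ge0. Qed.

Lemma sqr_normcE z : normc z ^+ 2 = Re z ^+ 2 + Im z ^+ 2.
Proof. by rewrite normcE sqr_sqrtr// addr_ge0// sqr_ge0. Qed.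

Lemma normRe_le z : `|Re z| <= normc z.
Proof. by rewrite normcE -sqrtr_sqr ler_wsqrtr// lerDl sqr_ge0. Qed.

Lemma normIm_le z : `|Im z| <= normc z.
Proof. by rewrite normcE -sqrtr_sqr ler_wsqrtr// lerDr sqr_ge0. Qed.

Lemma normc_real (x : R) : normc x%:C = `|x|.
Proof. by rewrite normcE /= expr0n addr0 sqrtr_sqr. Qed.

Lemma normc_i : normc ('i : R[i]) = 1.
Proof. by rewrite normcE /= expr0n add0r expr1n sqrtr1. Qed.

Lemma normc_le_ReIm z : normc z <= `|Re z| + `|Im z|.
Proof.
rewrite -(@ler_pXn2r _ 2)// ?nnegrE ?normc_ge0 ?addr_ge0//.
rewrite sqr_normcE sqrrD !real_normK ?num_real//.
by rewrite -addrA lerD2l lerDr mulrn_wge0// mulr_ge0.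
Qed.

Lemma normcX z k : normc (z ^+ k) = normc z ^+ k.
Proof. by elim: k => [|k IH]; rewrite ?expr0 ?normc1// !exprS normcM IH. Qed.

Lemma normc_prod (I : Type) (r : seq I) (P : pred I) (F : I -> R[i]) :
  normc (\prod_(i <- r | P i) F i) = \prod_(i <- r | P i) normc (F i).
Proof. by apply: (big_morph _ (@normcM R)); exact: normc1. Qed.

Lemma le_normc_sum (I : Type) (r : seq I) (P : pred I) (F : I -> R[i]) :
  normc (\sum_(i <- r | P i) F i) <= \sum_(i <- r | P i) normc (F i).
Proof.
elim/big_rec2 : _ => [|i y x _ h]; first by rewrite normc0.
by rewrite (le_trans (le_normcD _ _))// lerD2l.
Qed.

Lemma cReM z w : Re (z * w) = Re z * Re w - Im z * Im w.
Proof. by case: z => a b; case: w => c e. Qed.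

Lemma cImM z w : Im (z * w) = Re z * Im w + Im z * Re w.
Proof. by case: z => a b; case: w => c e. Qed.

Lemma cReD z w : Re (z + w) = Re z + Re w.
Proof. by case: z => a b; case: w => c e. Qed.

Lemma cImD z w : Im (z + w) = Im z + Im w.
Proof. by case: z => a b; case: w => c e. Qed.

Lemma cReN z : Re (- z) = - Re z. Proof. by case: z. Qed.

Lemma cImN z : Im (- z) = - Im z. Proof. by case: z. Qed.

Lemma complex_eqP z w : Re z = Re w -> Im z = Im w -> z = w.
Proof. by case: z => a b; case: w => c e /= -> ->. Qed.

Lemma normc_eq0 z : (normc z == 0) = (z == 0).
Proof. by apply/eqP/eqP => [/eq0_normc//|->]; rewrite normc0. Qed.

(** Multiplication by the conjugate phase of z makes z equal to its modulus. This reduces bounds on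
    complex integrals and remainders to bounds on real ones. *)
Lemma normc_le_rotate z (b : R) :
  (forall c : R[i], normc c = 1 -> Re (c * z) <= b) -> normc z <= b.
Proof.
move=> h; have [z0|z0] := eqVneq z 0.
  by have := h 1 (@normc1 _); rewrite mul1r z0 normc0.
have nz : 0 < normc z by rewrite lt_neqAle normc_ge0 eq_sym normc_eq0 z0.
set c : R[i] := (Re z / normc z) +i* - (Im z / normc z).
have E := sqr_normcE z.
have cz : Re (c * z) = normc z.
  rewrite cReM/= mulNr opprK mulrAC [Im z / _ * _]mulrAC -mulrDl -!expr2 -E expr2.
  by rewrite mulfK// gt_eqF.
rewrite -cz; apply: h; apply/eqP; rewrite -(@eqrXn2 _ 2) ?normc_ge0//.
rewrite sqr_normcE/= expr1n sqrrN !exprMn -mulrDl -E -exprMn divff ?expr1n// gt_eqF//.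
Qed.

End normc_extra.

Definition cReImE := (@cReD, @cImD, @cReM, @cImM, @cReN, @cImN).

Section cexp.
Context {R : realType}.
Implicit Types z w : R[i].
Local Open Scope complex_scope.

Definition cexp z : R[i] := (expR (Re z) * cos (Im z)) +i* (expR (Re z) * sin (Im z)).

Lemma cexpD z w : cexp (z + w) = cexp z * cexp w.
Proof.
apply: complex_eqP; rewrite !cReImE /cexp/= !cReImE expRD ?cosD ?sinD; ring.
Qed.

Lemma cexp0 : cexp 0 = 1.
Proof. by rewrite /cexp/= expR0 cos0 sin0 mulr0 mulr1. Qed.

Lemma normc_cexp z : normc (cexp z) = expR (Re z).
Proof.
by rewrite normcE /cexp/= !exprMn -mulrDr cos2Dsin2 mulr1 sqrtr_sqr ger0_norm ?expR_ge0.
Qed.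

Lemma cexp_real (x : R) : cexp x%:C = (expR x)%:C.
Proof. by rewrite /cexp/= cos0 sin0 mulr0 mulr1. Qed.

Lemma cexp_im (x : R) : cexp (0 +i* x) = cos x +i* sin x.
Proof. by rewrite /cexp/= expR0 !mul1r. Qed.

Lemma cexp_sum (I : Type) (r : seq I) (P : pred I) (F : I -> R[i]) :
  cexp (\sum_(i <- r | P i) F i) = \prod_(i <- r | P i) cexp (F i).
Proof. by apply: (big_morph _ cexpD); exact: cexp0. Qed.

End cexp.
Arguments cexp : simpl never.

Section cmeas.
Context d (T : measurableType d) {R : realType}.
Local Open Scope complex_scope.
Implicit Types f g : T -> R[i].

Definition cmeas f := measurable_fun setT (fun x => Re (f x)) /\
  measurable_fun setT (fun x => Im (f x)).

Lemma cmeas_cst c : cmeas (fun=> c).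
Proof. by split; exact: measurable_cst. Qed.

Lemma cmeasD f g : cmeas f -> cmeas g -> cmeas (fun x => f x + g x).
Proof.
move=> [f1 f2] [g1 g2]; split; under eq_fun do rewrite !cReImE;
  exact: measurable_funD.
Qed.

Lemma cmeasN f : cmeas f -> cmeas (fun x => - f x).
Proof.
move=> [f1 f2]; split; under eq_fun do rewrite !cReImE; exact: measurable_funN.
Qed.

Lemma cmeasB f g : cmeas f -> cmeas g -> cmeas (fun x => f x - g x).
Proof. by move=> mf mg; apply: cmeasD => //; exact: cmeasN. Qed.

Lemma cmeasM f g : cmeas f -> cmeas g -> cmeas (fun x => f x * g x).
Proof.
move=> [f1 f2] [g1 g2]; split; under eq_fun do rewrite !cReImE.
  by apply: measurable_funB; exact: measurable_funM.
by apply: measurable_funD; exact: measurable_funM.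
Qed.

Lemma cmeas_real (h : T -> R) : measurable_fun setT h -> cmeas (fun x => (h x)%:C).
Proof. by move=> mh; split => //=; exact: measurable_cst. Qed.

Lemma cmeas_cexp f : cmeas f -> cmeas (fun x => cexp (f x)).
Proof.
move=> [f1 f2]; split => /=; apply: measurable_funM.
- exact: (measurableT_comp (@measurable_expR R)).
- apply: (measurableT_comp _ f2); apply: continuous_measurable_fun.
  exact: continuous_cos.
- exact: (measurableT_comp (@measurable_expR R)).
- apply: (measurableT_comp _ f2); apply: continuous_measurable_fun.
  exact: continuous_sin.
Qed.

Lemma cmeas_prod (I : Type) (r : seq I) (F : I -> T -> R[i]) :
  (forall i, cmeas (F i)) -> cmeas (fun x => \prod_(i <- r) F i x).
Proof.
move=> mF; elim: r => [|i r IH].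
  by under eq_fun do rewrite big_nil; exact: cmeas_cst.
by under eq_fun do rewrite big_cons; exact: cmeasM.
Qed.

Lemma cmeas_normc f : cmeas f -> measurable_fun setT (fun x => normc (f x)).
Proof.
move=> [f1 f2]; under eq_fun do rewrite normcE.
apply: measurableT_comp.
  by apply: continuous_measurable_fun; exact: sqrt_continuous.
by apply: measurable_funD; exact: measurable_funX.
Qed.

End cmeas.

Lemma cmeas_comp d1 d2 (T1 : measurableType d1) (T2 : measurableType d2)
    (R : realType) (f : T2 -> R[i]) (h : T1 -> T2) :
  cmeas f -> measurable_fun setT h -> cmeas (fun x => f (h x)).
Proof.
move=> [f1 f2] mh; split; first exact: (measurableT_comp f1 mh).
exact: (measurableT_comp f2 mh).
Qed.

Section rinteg.
Context d (T : measurableType d) {R : realType}.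
Variable mu : {measure set T -> \bar R}.
Implicit Types f g h : T -> R.

Definition rinteg h := mu.-integrable setT (EFin \o h).

Lemma rinteg_meas h : rinteg h -> measurable_fun setT h.
Proof. by move=> /(measurable_int mu)/measurable_EFinP. Qed.

Lemma rinteg_le h g : measurable_fun setT h -> (forall x, `|h x| <= g x) ->
  rinteg g -> rinteg h.
Proof.
move=> mh hg; apply: le_integrable => //; first exact/measurable_EFinP.
move=> x _ /=; rewrite lee_fin (le_trans (hg x))//.
by rewrite ger0_norm// (le_trans _ (hg x)).
Qed.

Lemma rintegD h g : rinteg h -> rinteg g -> rinteg (fun x => h x + g x).
Proof. by move=> ih ig; apply: (integrableD _ ih ig). Qed.

Lemma rintegB h g : rinteg h -> rinteg g -> rinteg (fun x => h x - g x).
Proof. by move=> ih ig; apply: (integrableB _ ih ig). Qed.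

Lemma rintegZ c h : rinteg h -> rinteg (fun x => c * h x).
Proof. by move=> ih; apply: (integrableZl _ c ih). Qed.

Lemma rinteg_ltyP h : measurable_fun setT h -> (forall x, 0 <= h x) ->
  (\int[mu]_x (h x)%:E < +oo)%E -> rinteg h.
Proof.
move=> mh h0 hoo; apply/integrableP; split; first exact/measurable_EFinP.
by under eq_integral do rewrite /= ger0_norm//.
Qed.

Lemma rinteg_norm h : rinteg h -> rinteg (fun x => `|h x|).
Proof. exact: integrable_norm. Qed.

Lemma rinteg_EFin h : rinteg h -> (\int[mu]_x (h x)%:E = (\int[mu]_x h x)%:E)%E.
Proof. by move=> ih; rewrite fineK//; exact: integrable_fin_num. Qed.

Lemma rintD h g : rinteg h -> rinteg g ->
  \int[mu]_x (h x + g x) = \int[mu]_x h x + \int[mu]_x g x.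
Proof. exact: RintegralD. Qed.

Lemma rintZl c h : rinteg h -> \int[mu]_x (c * h x) = c * \int[mu]_x h x.
Proof. exact: RintegralZl. Qed.

Lemma rintZr c h : rinteg h -> \int[mu]_x (h x * c) = \int[mu]_x h x * c.
Proof. exact: RintegralZr. Qed.

Lemma rint_le h g : rinteg h -> rinteg g -> (forall x, h x <= g x) ->
  \int[mu]_x h x <= \int[mu]_x g x.
Proof. by move=> ih ig hg; exact: le_Rintegral. Qed.

(** The elementary bound |h g| <= h^2 + g^2 is enough where only integrability, and no
    Cauchy-Schwarz constant, is wanted. *)
Lemma rintegM_L2 h g : measurable_fun setT h -> measurable_fun setT g ->
  rinteg (fun x => h x ^+ 2) -> rinteg (fun x => g x ^+ 2) ->
  rinteg (fun x => h x * g x).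
Proof.
move=> mh mg ih ig; apply: rinteg_le (rintegD ih ig).
  exact: measurable_funM.
move=> x; rewrite ler_norml.
have := sqr_ge0 (h x + g x); have := sqr_ge0 (h x - g x).
have := sqr_ge0 (h x); have := sqr_ge0 (g x); nra.
Qed.

End rinteg.

Section cint.
Context d (T : measurableType d) {R : realType}.
Variable mu : {measure set T -> \bar R}.
Local Open Scope complex_scope.
Implicit Types f g : T -> R[i].

Definition cinteg f := rinteg mu (fun x => Re (f x)) /\ rinteg mu (fun x => Im (f x)).

Definition cint f : R[i] :=
  (\int[mu]_x Re (f x)) +i* (\int[mu]_x Im (f x)).

Lemma cinteg_meas f : cinteg f -> cmeas f.
Proof. by move=> [/rinteg_meas ? /rinteg_meas ?]. Qed.

Lemma cinteg_le f (h : T -> R) : cmeas f -> (forall x, normc (f x) <= h x) ->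
  rinteg mu h -> cinteg f.
Proof.
move=> [f1 f2] fh ih; split; apply: rinteg_le ih => // x.
  by rewrite (le_trans (normRe_le _)).
by rewrite (le_trans (normIm_le _)).
Qed.

Lemma cinteg_normc f : cinteg f -> rinteg mu (fun x => normc (f x)).
Proof.
move=> cf; have [if1 if2] := cf.
apply: rinteg_le (rintegD (rinteg_norm if1) (rinteg_norm if2)).
  by apply: cmeas_normc; exact: cinteg_meas.
by move=> x; rewrite ger0_norm ?normc_ge0// normc_le_ReIm.
Qed.

Lemma cintegP f : cmeas f -> rinteg mu (fun x => normc (f x)) -> cinteg f.
Proof. by move=> mf; exact: cinteg_le. Qed.

Lemma cintegD f g : cinteg f -> cinteg g -> cinteg (fun x => f x + g x).
Proof.
move=> [f1 f2] [g1 g2]; split.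
  by have := rintegD f1 g1; apply: eq_integrable => // x _ /=; rewrite !cReImE.
by have := rintegD f2 g2; apply: eq_integrable => // x _ /=; rewrite !cReImE.
Qed.

Lemma cintegZ c f : cinteg f -> cinteg (fun x => c * f x).
Proof.
move=> cf; apply: (@cinteg_le _ (fun x => normc c * normc (f x))).
- by apply: cmeasM; [exact: cmeas_cst|exact: cinteg_meas].
- by move=> x; rewrite normcM.
- by apply: rintegZ; exact: cinteg_normc.
Qed.

Lemma cintegN f : cinteg f -> cinteg (fun x => - f x).
Proof.
by move=> /(cintegZ (-1)); under eq_fun do rewrite mulN1r.
Qed.

Lemma cintegB f g : cinteg f -> cinteg g -> cinteg (fun x => f x - g x).
Proof. by move=> cf cg; apply: cintegD => //; exact: cintegN. Qed.

Lemma cintD f g : cinteg f -> cinteg g ->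
  cint (fun x => f x + g x) = cint f + cint g.
Proof.
move=> [f1 f2] [g1 g2]; apply: complex_eqP; rewrite /cint/=.
  by under eq_Rintegral do rewrite !cReImE; rewrite RintegralD.
by under eq_Rintegral do rewrite !cReImE; rewrite RintegralD.
Qed.

Lemma cintZ c f : cinteg f -> cint (fun x => c * f x) = c * cint f.
Proof.
move=> [f1 f2]; apply: complex_eqP; rewrite !cReImE /cint/=.
  under eq_Rintegral do rewrite !cReImE.
  by rewrite RintegralB// ?RintegralZl//; exact: rintegZ.
under eq_Rintegral do rewrite !cReImE.
by rewrite RintegralD// ?RintegralZl//; exact: rintegZ.
Qed.

Lemma cintB f g : cinteg f -> cinteg g ->
  cint (fun x => f x - g x) = cint f - cint g.
Proof.
move=> cf cg; rewrite cintD//; last exact: cintegN.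
congr (_ + _); have := cintZ (-1) cg; rewrite mulN1r => <-.
by congr cint; apply/funext => x; rewrite mulN1r.
Qed.

Lemma cintZr c f : cinteg f -> cint (fun x => f x * c) = cint f * c.
Proof. by move=> cf; rewrite mulrC -cintZ//; congr cint; apply/funext => x; rewrite mulrC. Qed.

Lemma cint0 : cint (fun=> 0) = 0.
Proof. by apply: complex_eqP; rewrite /cint/= Rintegral_cst//= mul0r. Qed.

Lemma cint_cst1 : mu setT = 1%E -> cint (fun=> 1) = 1.
Proof.
move=> mu1; rewrite /cint/=; apply: complex_eqP => /=.
  by rewrite Rintegral_cst// mu1 mul1r.
by rewrite Rintegral_cst// mul0r.
Qed.

Lemma cint_sum (I : Type) (r : seq I) (F : I -> T -> R[i]) :
  (forall i, cinteg (F i)) ->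
  cinteg (fun x => \sum_(i <- r) F i x) /\
  cint (fun x => \sum_(i <- r) F i x) = \sum_(i <- r) cint (F i).
Proof.
move=> iF; elim: r => [|i r [IH1 IH2]].
  under eq_fun do rewrite big_nil; rewrite big_nil.
  split; last exact: cint0.
  by split; exact: integrable0.
under eq_fun do rewrite big_cons; rewrite big_cons; split.
  exact: cintegD.
by rewrite -IH2 -cintD.
Qed.

Lemma normc_cint f : cinteg f -> normc (cint f) <= \int[mu]_x normc (f x).
Proof.
move=> cf; apply: normc_le_rotate => c nc; rewrite -(cintZ c cf)/=.
apply: rint_le => [||x]; [exact: (cintegZ c cf).1|exact: cinteg_normc|].
rewrite (le_trans (ler_norm _))// (le_trans (normRe_le _))//.
by rewrite normcM nc mul1r.
Qed.

Lemma le_normc_cint f (h : T -> R) : cmeas f -> (forall x, normc (f x) <= h x) ->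
  rinteg mu h -> normc (cint f) <= \int[mu]_x h x.
Proof.
move=> mf fh ih; have cf := cinteg_le mf fh ih.
rewrite (le_trans (normc_cint cf))//; apply: le_Rintegral => //.
exact: cinteg_normc.
Qed.

End cint.

Section dominated.
Context d (T : measurableType d) {R : realType}.
Variable mu : {measure set T -> \bar R}.

Lemma Rdominated_cvg (f_ : nat -> T -> R) (f g : T -> R) :
  (forall n, measurable_fun setT (f_ n)) -> measurable_fun setT f ->
  {ae mu, forall x, f_ n x @[n --> \oo] --> f x} ->
  rinteg mu g -> (forall n x, `|f_ n x| <= g x) ->
  \int[mu]_x f_ n x @[n --> \oo] --> \int[mu]_x f x.
Proof.
move=> mf_ mf cf ig fg.
have [|||||fi _ +] := @dominated_convergence _ _ _ mu setT measurableT
  (fun n x => (f_ n x)%:E) (EFin \o f) (EFin \o g).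
- by move=> n; exact/measurable_EFinP.
- exact/measurable_EFinP.
- apply: filterS cf => x cfx _.
  by apply/fine_cvgP; split; first exact: nearW.
- exact: ig.
- by apply: aeW => x n _; rewrite /= lee_fin.
rewrite (_ : \int[mu]_x (EFin \o f) x = (\int[mu]_x f x)%:E)%E; last exact: rinteg_EFin.
by move=> /fine_cvg.
Qed.

End dominated.

Section cfubini.
Context d1 d2 (T1 : measurableType d1) (T2 : measurableType d2) {R : realType}.
Variables (m1 : {sigma_finite_measure set T1 -> \bar R}).
Variables (m2 : {sigma_finite_measure set T2 -> \bar R}).
Implicit Types f : T1 * T2 -> R[i].
Local Open Scope complex_scope.

Lemma rinteg_prod (h : T1 * T2 -> R) : measurable_fun setT h ->
  (\int[m1]_x \int[m2]_y (`|h (x, y)|)%:E < +oo)%E -> rinteg (m1 \x m2)%E h.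
Proof. by move=> mh hoo; apply/integrable12ltyP => //; exact/measurable_EFinP. Qed.

Lemma rinteg_tensor (a : T1 -> R) (b : T2 -> R) : rinteg m1 a -> rinteg m2 b ->
  rinteg (m1 \x m2)%E (fun p => a p.1 * b p.2).
Proof.
move=> ia ib; apply: rinteg_prod.
  apply: measurable_funM.
    exact: (measurableT_comp (rinteg_meas ia) measurable_fst).
  exact: (measurableT_comp (rinteg_meas ib) measurable_snd).
rewrite /=.
under eq_integral => x _.
  under eq_integral do rewrite normrM EFinM.
  rewrite ge0_integralZl_EFin//; last first.
    by apply/measurable_EFinP; exact: (rinteg_meas (rinteg_norm ib)).
  rewrite (rinteg_EFin (rinteg_norm ib)) -EFinM.
  over.
rewrite (_ : (fun _ => _) = (EFin \o fun x => `|a x| * \int[m2]_y `|b y|)); last by [].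
rewrite (rinteg_EFin (h := fun x => `|a x| * \int[m2]_y `|b y|)) ?ltry//.
have := rintegZ (\int[m2]_y `|b y|) (rinteg_norm ia).
by apply: eq_integrable => // x _ /=; rewrite mulrC.
Qed.

(** Every section, not just almost every one, is assumed integrable: the real-valued inner integrals
    then agree everywhere with the extended ones, and no null set has to be tracked. *)
Let rfubini (h : T1 * T2 -> R) : rinteg (m1 \x m2)%E h ->
  (forall x, rinteg m2 (fun y => h (x, y))) ->
  (forall y, rinteg m1 (fun x => h (x, y))) ->
  [/\ rinteg m1 (fun x => \int[m2]_y h (x, y)),
   rinteg m2 (fun y => \int[m1]_x h (x, y)) &
  \int[m1]_x \int[m2]_y h (x, y) = \int[m2]_y \int[m1]_x h (x, y)].
Proof.
move=> ih i2 i1.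
have E2 x : (\int[m2]_y h (x, y))%:E = fubini_F m2 (EFin \o h) x.
  by rewrite /fubini_F -rinteg_EFin.
have E1 y : (\int[m1]_x h (x, y))%:E = fubini_G m1 (EFin \o h) y.
  by rewrite /fubini_G -rinteg_EFin.
split.
- apply: eq_integrable (integrable_fubini_F ih) => // x _.
  by rewrite /= E2.
- have mh : measurable_fun setT (EFin \o h) by exact: (measurable_int _ ih).
  have mG := measurable_fubini_G ih.
  apply/integrableP; split.
    by apply: eq_measurable_fun mG => y _; rewrite /= E1.
  have /integrable21ltyP := ih; move=> /(_ mh); apply: le_lt_trans.
  apply: ge0_le_integral => //.
  + apply: measurableT_comp => //.
    by apply: eq_measurable_fun mG => y _; rewrite /= E1.
  + apply: (@measurable_fun_fubini_tonelli_G _ _ _ _ _ m1 (abse \o (EFin \o h))).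
      exact: measurableT_comp.
    by move=> ?; exact: abse_ge0.
  + move=> y _ /=; rewrite -[X in (X <= _)%E]/(`|(\int[m1]_x h (x, y))%:E|)%E.
    rewrite E1; apply: le_abse_integral => //.
    by apply: (measurable_int m1); exact: i1.
- rewrite {1}/Rintegral; under eq_integral do rewrite E2.
  rewrite /Rintegral; under [in RHS]eq_integral => y _ do
    rewrite -[X in X%:E]/(\int[m1]_x h (x, y)) E1.
  by congr fine; exact: Fubini.
Qed.

Let rint_prod (h : T1 * T2 -> R) : rinteg (m1 \x m2)%E h ->
  (forall x, rinteg m2 (fun y => h (x, y))) ->
  \int[(m1 \x m2)%E]_z h z = \int[m1]_x \int[m2]_y h (x, y).
Proof.
move=> ih i2; rewrite /Rintegral -integral12_prod_meas1//.
congr fine; apply: eq_integral => x _.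
by rewrite -[X in _ = X%:E]/(\int[m2]_y h (x, y)) /fubini_F -rinteg_EFin.
Qed.

Lemma cint_prod f : cinteg (m1 \x m2)%E f ->
  (forall x, cinteg m2 (fun y => f (x, y))) ->
  cint (m1 \x m2)%E f = cint m1 (fun x => cint m2 (fun y => f (x, y))).
Proof.
move=> [r i] h2; apply: complex_eqP; rewrite /cint/=.
  exact: (rint_prod r (fun x => (h2 x).1)).
exact: (rint_prod i (fun x => (h2 x).2)).
Qed.

Lemma cfubini f : cinteg (m1 \x m2)%E f ->
  (forall x, cinteg m2 (fun y => f (x, y))) ->
  (forall y, cinteg m1 (fun x => f (x, y))) ->
  [/\ cinteg m1 (fun x => cint m2 (fun y => f (x, y))),
   cinteg m2 (fun y => cint m1 (fun x => f (x, y))) &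
  cint m1 (fun x => cint m2 (fun y => f (x, y))) =
  cint m2 (fun y => cint m1 (fun x => f (x, y)))].
Proof.
move=> [r i] h2 h1.
have [a1 b1 c1] := rfubini r (fun x => (h2 x).1) (fun y => (h1 y).1).
have [a2 b2 c2] := rfubini i (fun x => (h2 x).2) (fun y => (h1 y).2).
by split => //; apply: complex_eqP.
Qed.

End cfubini.

(** * Gaussian integrals on the line *)

Section bounds.
Context {R : realType}.
Implicit Types x u : R.

Lemma exprn_le_expR k u : 0 <= u -> u ^+ k <= k`!%:R * expR u.
Proof.
case: k => [|k] u0; first by rewrite expr0 fact0 mul1r -expR0 ler_expR.
have := expR_ge1Dxn k u0; rewrite -lerBrDl => h.
rewrite -ler_pdivrMl ?ltr0n ?fact_gt0// mulrC (le_trans h)//.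
by rewrite lerBlDr lerDl.
Qed.

(** Completing the square: half of the Gaussian exponent absorbs the linear term. *)
Lemma abs_sub_sqr_le (c al x : R) : 0 < al ->
  c * `|x| - al * x ^+ 2 <= c ^+ 2 / (2 * al) - al / 2 * x ^+ 2.
Proof.
move=> al0; rewrite -(real_normK (num_real x)); set y := `|x|.
rewrite -subr_ge0.
have -> : c ^+ 2 / (2 * al) - al / 2 * y ^+ 2 - (c * y - al * y ^+ 2) =
  al / 2 * (y - c / al) ^+ 2 by field; lra.
by rewrite mulr_ge0// ?sqr_ge0//; lra.
Qed.

(** [(1 + x ^+ 2)^-1] is the standard integrable majorant on the line. With u = 1 + x^2 and be = al
    / 2, the bound is (be u)^(m+1) <= (m+1)! exp(be u). *)
Lemma poly_gauss_le (m : nat) (c al : R) : 0 < al ->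
  exists2 C : R, 0 < C & forall x,
  (1 + x ^+ 2) ^+ m * expR (c * `|x| - al * x ^+ 2) <= C * (1 + x ^+ 2)^-1.
Proof.
move=> al0; pose be := al / 2; have be0 : 0 < be by rewrite divr_gt0.
exists (m.+1`!%:R / be ^+ m.+1 * expR (c ^+ 2 / (2 * al) + be)).
  by rewrite !mulr_gt0 ?invr_gt0 ?exprn_gt0 ?expR_gt0// ltr0n fact_gt0.
move=> x; set u := 1 + x ^+ 2.
have u0 : 0 < u by rewrite /u; have := sqr_ge0 x; lra.
rewrite ler_pdivlMr// mulrAC -exprSr.
have h : c * `|x| - al * x ^+ 2 <= (c ^+ 2 / (2 * al) + be) - be * u.
  by rewrite (le_trans (abs_sub_sqr_le c x al0))// /u /be; lra.
have beu0 : 0 <= be * u by rewrite mulr_ge0// ltW.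
have := exprn_le_expR m.+1 beu0; rewrite exprMn => h2.
apply: (@le_trans _ _ (u ^+ m.+1 * (expR (c ^+ 2 / (2 * al) + be) / expR (be * u)))).
  by rewrite ler_wpM2l ?exprn_ge0 ?(ltW u0)// -expRB ler_expR.
rewrite mulrCA mulrC ler_pM2r ?expR_gt0//.
rewrite ler_pdivrMr ?expR_gt0// mulrAC.
by rewrite ler_pdivlMr ?exprn_gt0// mulrC.
Qed.

End bounds.

Section line.
Context {R : realType}.
Notation L := (@lebesgue_measure R).
Implicit Types f g h : R -> R.

Lemma rinteg_oneDsqrV : rinteg L (fun x => (1 + x ^+ 2)^-1).
Proof.
have c : continuous (fun x : R => (1 + x ^+ 2)^-1) by exact: continuous_oneDsqrV.
apply: rinteg_ltyP.
- exact: continuous_measurable_fun.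
- by move=> x; rewrite invr_ge0; have := sqr_ge0 x; lra.
- rewrite ge0_symfun_integralT//.
  + rewrite -set_itvcy integral0y_oneDsqr -EFinM ltry//.
  + by move=> x; rewrite invr_ge0; have := sqr_ge0 x; lra.
  + by move=> x /=; rewrite sqrrN.
Qed.

Lemma rinteg_decay h (C : R) : measurable_fun setT h ->
  (forall x, `|h x| <= C * (1 + x ^+ 2)^-1) -> rinteg L h.
Proof.
by move=> mh hC; apply: (@rinteg_le _ (measurableTypeR R) R L h _ mh hC); apply: rintegZ; exact: rinteg_oneDsqrV.
Qed.

Lemma rinteg_affine h (a b : R) : 0 < a -> continuous h -> (forall x, 0 <= h x) ->
  (\int[L]_x (h x)%:E = a%:E * \int[L]_x (h (a * x + b))%:E)%E.
Proof.
move=> a0 ch h0.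
have dF (x : R) : is_derive x 1 (fun y : R => a * y + b) a.
  by apply: is_derive_eq; rewrite /GRing.scale/= addr0 !mulr1.
have F' : derive1 (fun y : R => a * y + b) = fun=> a.
  by apply/funext => x; rewrite derive1E; have [_ ->] := dF x.
rewrite (@increasing_ge0_integration_by_substitutionT _ (fun y : R => a * y + b))//.
- under eq_integral do rewrite F' /= mulrC EFinM.
  rewrite ge0_integralZl_EFin//.
  + by move=> x _; rewrite lee_fin /= h0.
  + apply/measurable_EFinP; apply: continuous_measurable_fun => x.
    apply: (@continuous_comp _ _ _ (fun y : R => a * y + b) h); last exact: ch.
    by apply: differentiable_continuous; apply/derivable1_diffP; have [] := dF x.
  + exact: ltW.
- by move=> x y xy; rewrite ltrD2r ltr_pM2l.
- by rewrite F' => x; exact: cvg_cst.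
- by rewrite F'; exact: is_cvg_cst.
- by rewrite F'; exact: is_cvg_cst.
- apply/cvgrNyPle => A; near=> x.
  have : x <= (A - b) / a by near: x; exact: (nbhs_ninfty_le (num_real _)).
  by rewrite ler_pdivlMr// => ?; lra.
- apply/cvgryPge => A; near=> x.
  have : (A - b) / a <= x by near: x; exact: (nbhs_pinfty_ge (num_real _)).
  by rewrite ler_pdivrMr// => ?; lra.
Unshelve. all: by end_near. Qed.

Lemma Rintegral_affine h (a b : R) : 0 < a -> continuous h -> rinteg L h ->
  rinteg L (fun x => h (a * x + b)) /\
  \int[L]_x h x = a * \int[L]_x h (a * x + b).
Proof.
move=> a0 ch ih.
have caff : continuous (fun y : R => a * y + b).
  move=> x; apply: cvgD; last exact: cvg_cst.
  by apply: cvgM; [exact: cvg_cst|exact: cvg_id].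
have ch' : continuous (fun x => h (a * x + b)).
  by move=> x; apply: (@continuous_comp _ _ _ (fun y : R => a * y + b) h); [exact: caff|exact: ch].
have nr k : continuous k -> continuous (fun x : R => `|k x : R|).
  by move=> ck x; apply: (@continuous_comp _ _ _ k (@Num.norm _ R)); [exact: ck|exact: norm_continuous].
have ih' : rinteg L (fun x => h (a * x + b)).
  apply/integrableP; split.
    by apply/measurable_EFinP; exact: continuous_measurable_fun.
  have := rinteg_EFin (rinteg_norm ih).
  rewrite (rinteg_affine b a0 (nr _ ch))//.
  rewrite -[X in (X < _)%E]/(\int[L]_x (`|h (a * x + b)|)%:E)%E => E.
  rewrite ltey; apply/eqP => E2; move: E; rewrite E2 mulr_infty gtr0_sg//.
  by rewrite mul1e.
split=> //.
(* The substitution rule is available for nonnegative continuous functions; h is the difference of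
   the two functions [p] and [q] of this kind. *)
pose p x := `|h x| + h x; pose q x := `|h x|.
have cp : continuous p by move=> x; apply: cvgD; [exact: nr|exact: ch].
have E k : rinteg L k -> rinteg L (fun x => k (a * x + b)) -> continuous k ->
  (forall x, 0 <= k x) -> \int[L]_x k x = a * \int[L]_x k (a * x + b).
  move=> ik ik' ck k0; apply: EFin_inj; rewrite EFinM -!rinteg_EFin//.
  exact: rinteg_affine.
have := E p (rintegD (rinteg_norm ih) ih) (rintegD (rinteg_norm ih') ih') cp.
rewrite /p (RintegralD _ (rinteg_norm ih) ih)// (RintegralD _ (rinteg_norm ih') ih')//.
rewrite (E q (rinteg_norm ih) (rinteg_norm ih') (nr _ ch))//.
rewrite mulrDr => /(_ _)/addrI; apply; first move=> x.
  by have := ler_norm (- h x); rewrite normrN /p; lra.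
by rewrite /q.
Qed.

(** The sign s handles the two ends of the interval [-n, n] together. *)
Lemma cvgn_inv1Dsqr (s : R) : s = 1 \/ s = -1 ->
  (1 + (s * n%:R) ^+ 2)^-1 @[n --> \oo] --> (0 : R).
Proof.
move=> hs; apply: (@squeeze_cvgr _ _ _ _ (fun=> 0) (fun n : nat => n.+1%:R^-1 * 2)).
- near=> n.
  have n0 : 0 <= n%:R :> R by [].
  have -> : (s * n%:R) ^+ 2 = n%:R ^+ 2 :> R by case: hs => ->; ring.
  rewrite invr_ge0 addr_ge0 ?sqr_ge0//= -div1r ler_pdivrMr; last first.
    by rewrite ltr_pwDl// sqr_ge0.
  rewrite -mulrA ler_pdivlMl ?ltr0n// mulr1 -natr1.
  have := sqr_ge0 (n%:R - 1 : R); nra.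
- exact: cvg_cst.
- rewrite -[X in _ --> X](mul0r 2); apply: cvgMl.
  exact: cvg_harmonic.
Unshelve. all: by end_near. Qed.

(** Over [-n, n] the integral is h(n) - h(-n), which tends to 0 by the decay of h; dominated
    convergence removes the restriction to [-n, n]. *)
Lemma Rintegral_derive0 h h' (C : R) : (forall x : R, is_derive x 1 h (h' x)) ->
  continuous h' -> (forall x, `|h x| <= C * (1 + x ^+ 2)^-1) ->
  (forall x, `|h' x| <= C * (1 + x ^+ 2)^-1) -> \int[L]_x h' x = 0.
Proof.
move=> dh ch' hC h'C.
have ch : continuous h.
  by move=> x; apply: differentiable_continuous; apply/derivable1_diffP; have [] := dh x.
have mh' : measurable_fun setT h' by exact: continuous_measurable_fun.
have C0 : 0 <= C.
  by have := h'C 0; rewrite expr0n/= addr0 invr1 mulr1; exact: le_trans.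
pose I n := `[- n%:R, n%:R]%classic : set R.
have lim0 (x : R) : (h' \_ (I n)) x @[n --> \oo] --> h' x.
  apply: cvg_near_cst; near=> n; apply/eqP.
  rewrite patchE ifT// inE /I/= in_itv/= -ler_norml.
  by near: n; exact: nbhs_infty_ger.
have lim1 : \int[L]_x (h' \_ (I n)) x @[n --> \oo] --> \int[L]_x h' x.
  apply: (@Rdominated_cvg _ (measurableTypeR R) _ L _ _ (fun x => C * (1 + x ^+ 2)^-1)) => //.
  - move=> n; apply/(measurable_restrictT _ _).1 => //.
      exact: measurable_itv.
    exact: (@measurable_funTS _ _ (measurableTypeR R)).
  - by apply: aeW => x; exact: lim0.
  - by apply: rintegZ; exact: rinteg_oneDsqrV.
  - move=> n x; rewrite patchE; case: ifP => _ //.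
    by rewrite normr0 (le_trans _ (h'C x)).
have z s : s = 1 \/ s = -1 -> h (s * n%:R) @[n --> \oo] --> (0 : R).
  move=> hs; apply: norm_cvg0.
  apply: (@squeeze_cvgr _ _ _ _ (fun=> 0) (fun n : nat => C * (1 + (s * n%:R) ^+ 2)^-1)).
  - by apply: nearW => n; rewrite normr_ge0 hC.
  - exact: cvg_cst.
  - rewrite -[X in _ --> X](mulr0 C); apply: cvgMr.
    exact: cvgn_inv1Dsqr.
have lim3 : h n%:R - h (- n%:R) @[n --> \oo] --> (0 : R).
  rewrite -[X in _ --> X](subr0 0); apply: cvgB.
    by have := z 1 (or_introl erefl); under eq_fun do rewrite mul1r.
  by have := z (-1) (or_intror erefl); under eq_fun do rewrite mulN1r.
have lim2 : \int[L]_x (h' \_ (I n)) x @[n --> \oo] --> (0 : R).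
  apply: cvg_trans lim3.
  apply: near_eq_cvg; near=> n; rewrite -Rintegral_mkcond /Rintegral.
  have n0 : - n%:R < n%:R :> R.
    have : 0 < n%:R :> R by rewrite ltr0n; near: n; exact: nbhs_infty_gt.
    by lra.
  rewrite (continuous_FTC2 n0 (F := h))//.
  - by apply: continuous_subspaceT.
  - split; first by move=> x _; have [] := dh x.
      by apply: cvg_at_right_filter; exact: ch.
    by apply: cvg_at_left_filter; exact: ch.
  - by move=> x _; rewrite derive1E; have [_ ->] := dh x.
by have := cvg_unique _ lim1 lim2; apply.
Unshelve. all: by end_near. Qed.


Lemma is_derive_M (f g : R -> R) (x a b : R) : is_derive x 1 f a -> is_derive x 1 g b ->
  is_derive x 1 (fun y => f y * g y) (a * g x + f x * b).
Proof.
move=> df dg; have := is_deriveM df dg.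
by move=> h; apply: (@is_derive_eq _ _ _ _ _ _ _ _ h); rewrite /GRing.scale/=; ring.
Qed.

Lemma is_derive_D (f g : R -> R) (x a b : R) : is_derive x 1 f a -> is_derive x 1 g b ->
  is_derive x 1 (fun y => f y + g y) (a + b).
Proof. by move=> df dg; exact: is_deriveD. Qed.

Lemma is_derive_expR_comp (g : R -> R) (x a : R) : is_derive x 1 g a ->
  is_derive x 1 (fun y => expR (g y)) (expR (g x) * a).
Proof. by move=> dg; exact: (is_derive1_comp (is_derive_expR _) dg). Qed.

Lemma is_derive_cos_comp (g : R -> R) (x a : R) : is_derive x 1 g a ->
  is_derive x 1 (fun y => cos (g y)) (- sin (g x) * a).
Proof. by move=> dg; exact: (is_derive1_comp (is_derive_cos _) dg). Qed.

Lemma is_derive_sin_comp (g : R -> R) (x a : R) : is_derive x 1 g a ->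
  is_derive x 1 (fun y => sin (g y)) (cos (g x) * a).
Proof. by move=> dg; exact: (is_derive1_comp (is_derive_sin _) dg). Qed.

Lemma is_derive_quad (a b c x : R) :
  is_derive x 1 (fun y : R => a * y ^+ 2 + b * y + c) (2 * a * x + b).
Proof.
apply: is_derive_eq; rewrite /GRing.scale/= ; ring.
Qed.

Lemma is_derive_cst_eq (f : R -> R) (x a b : R) : is_derive x 1 f a -> a = b ->
  is_derive x 1 f b.
Proof. by move=> h <-. Qed.

Lemma is_derive_pow (f : R -> R) (x a : R) (m : nat) : is_derive x 1 f a ->
  is_derive x 1 (fun y => f y ^+ m) (m%:R * f x ^+ m.-1 * a).
Proof.
move=> df; elim: m => [|m IH].
  have -> : 0%:R * f x ^+ 0.-1 * a = 0 by rewrite !mul0r.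
  have -> : (fun y => f y ^+ 0) = cst 1 by apply/funext => y; rewrite expr0.
  exact: is_derive_cst.
under eq_fun do rewrite exprS.
apply: (is_derive_cst_eq (is_derive_M df IH)).
case: m {IH} => [|m] /=; first by rewrite expr0; ring.
by rewrite -[in RHS]natr1 exprS; ring.
Qed.

Lemma derive_continuous (f : R -> R) (f' : R -> R) :
  (forall x : R, is_derive x 1 f (f' x)) -> continuous f.
Proof.
by move=> df x; apply: differentiable_continuous; apply/derivable1_diffP; have [] := df x.
Qed.

(** As a function of b, the integral J satisfies J' = - (b / 2) J, by differentiation under the
    integral and integration by parts, and J(0) comes from the Gauss integral. The phase phi lets
    the same statement serve for real and imaginary parts, as cos(u - pi / 2) = sin u. *)
Lemma gauss_cos_integral (b phi : R) :
  \int[L]_y (expR (- y ^+ 2) * cos (b * y + phi)) =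
  Num.sqrt pi * expR (- (b ^+ 2 / 4)) * cos phi.
Proof.
pose f (b y : R) : R := expR (- y ^+ 2) * cos (b * y + phi).
have [C C0 hC] := poly_gauss_le 1 0 (@ltr01 R).
have {}hC y : (1 + y ^+ 2) * expR (- y ^+ 2) <= C * (1 + y ^+ 2)^-1.
  by have := hC y; rewrite expr1 mul0r sub0r mul1r.
have dg (y : R) : is_derive y 1 (fun z : R => expR (- z ^+ 2)) (expR (- y ^+ 2) * (- 2 * y)).
  apply: is_derive_expR_comp; apply: is_derive_eq; rewrite /GRing.scale/=; ring.
have db (c y : R) : is_derive y 1 (fun z : R => c * z + phi) c.
  by apply: is_derive_eq; rewrite /GRing.scale/=; ring.
have e0 (y : R) : 0 <= expR (- y ^+ 2) by exact: expR_ge0.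
have cle (u : R) : `|cos u| <= 1 by rewrite ler_norml cos_geN1 cos_le1.
have sle (u : R) : `|sin u| <= 1 by rewrite ler_norml sin_geN1 sin_le1.
have le1 (y : R) : expR (- y ^+ 2) <= C * (1 + y ^+ 2)^-1.
  rewrite (le_trans _ (hC y))// ler_peMl// lerDl; exact: sqr_ge0.
have ley (y : R) : `|y| * expR (- y ^+ 2) <= C * (1 + y ^+ 2)^-1.
  rewrite (le_trans _ (hC y))// ler_wpM2r// -(real_normK (num_real y)).
  by have := sqr_ge0 (`|y| - 1); have := normr_ge0 y; nra.
have df (c y : R) : is_derive y 1 (f c)
    (expR (- y ^+ 2) * (- 2 * y) * cos (c * y + phi) + expR (- y ^+ 2) * (- sin (c * y + phi) * c)).
  by exact: (is_derive_M (dg y) (is_derive_cos_comp (db c y))).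
have cf (c : R) : continuous (f c) by exact: derive_continuous (df c).
have fle (c y : R) : `|f c y| <= C * (1 + y ^+ 2)^-1.
  rewrite normrM (ger0_norm (e0 y)) (le_trans _ (le1 y))//.
  by rewrite ler_piMr.
have int_f (c : R) : rinteg L (f c).
  by apply: (@rinteg_decay _ C) => //; exact: continuous_measurable_fun.
pose k (c y : R) : R := - y * expR (- y ^+ 2) * sin (c * y + phi).
have d1f (c y : R) : is_derive c 1 (fun c : R => f c y) (k c y).
  by apply: is_derive_eq; rewrite /k /GRing.scale/=; ring.
have ck (c : R) : continuous (k c).
  have := fun y : R => is_derive_M (is_derive_M (is_deriveN (is_derive_id y 1)) (dg y))
     (is_derive_sin_comp (db c y)).
  exact: derive_continuous.
have kle (c y : R) : `|k c y| <= C * (1 + y ^+ 2)^-1.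
  rewrite !normrM normrN (ger0_norm (e0 y)) (le_trans _ (ley y))//.
  by rewrite ler_piMr// mulr_ge0.
have int_k (c : R) : rinteg L (k c).
  apply: (@rinteg_decay _ C).
    apply: continuous_measurable_fun; exact: ck.
  exact: kle.
(* The derivative of exp(- y^2) sin(c y + phi) is 2 k + c f, so the integral of this sum is 0. *)
have ibp (c : R) : \int[L]_y k c y = - (c / 2) * \int[L]_y f c y.
  have dh (y : R) : is_derive y 1 (fun y : R => expR (- y ^+ 2) * sin (c * y + phi))
      (2 * k c y + c * f c y).
    apply: (is_derive_cst_eq (is_derive_M (dg y) (is_derive_sin_comp (db c y)))).
    by rewrite /k /f; ring.
  have : \int[L]_y (2 * k c y + c * f c y) = 0.
    apply: (@Rintegral_derive0 _ _ ((2 + `|c|) * C) dh).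
    - move=> y; apply: cvgD; (apply: cvgM; first exact: cvg_cst); last exact: cf.
      exact: ck.
    - move=> y; rewrite normrM (ger0_norm (e0 y)) -mulrA.
      rewrite (@le_trans _ _ (C * (1 + y ^+ 2)^-1))//.
        by rewrite (le_trans _ (le1 y))// ler_piMr.
      have := le_trans (e0 y) (le1 y); have := normr_ge0 c; nra.
    - move=> y; rewrite (le_trans (ler_normD _ _))// (normrM 2) (normrM c).
      rewrite mulrDl mulrDl -!mulrA; apply: lerD; last by rewrite ler_wpM2l.
      by rewrite ger0_norm// ler_pM2l.
  rewrite RintegralD//; [|exact: rintegZ..].
  rewrite (rintZl _ (int_k c)) (rintZl _ (int_f c)); lra.
pose J (c : R) : R := \int[L]_y f c y.
have dJ (c : R) : is_derive c 1 J (- (c / 2) * J c).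
  have Ic : (`]c - 1, c + 1[%classic : set R) c by rewrite /= in_itv/=; apply/andP; split; lra.
  have i_f x : (`]c - 1, c + 1[%classic : set R) x -> rinteg L (f x) by [].
  have d_f x y : (`]c - 1, c + 1[%classic : set R) x ->
    [set: measurableTypeR R] y -> derivable (f ^~ y) x 1.
    by move=> _ _; have [] := d1f x y.
  have dE x y : partial1of2 f x y = k x y.
    by rewrite partial1of2E; have [_ ->] := d1f x y.
  have G0 (y : measurableTypeR R) : 0 <= C * (1 + y ^+ 2)^-1.
    exact: (le_trans (e0 y) (le1 y)).
  have iG : rinteg L (fun y => C * (1 + y ^+ 2)^-1) by apply: rintegZ; exact: rinteg_oneDsqrV.
  have G_ub x y : (`]c - 1, c + 1[%classic : set R) x ->
    [set: measurableTypeR R] y -> `|partial1of2 f x y| <= C * (1 + y ^+ 2)^-1.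
    by move=> _ _; rewrite dE; exact: kle.
  apply: DeriveDef.
    exact: (@derivable_under_integral R _ (measurableTypeR R) L f setT measurableT
      c _ _ Ic i_f d_f _ G0 iG G_ub).
  rewrite -derive1E (@differentiation_under_integral R _ (measurableTypeR R) L f setT measurableT
      c _ _ Ic i_f d_f _ G0 iG G_ub) /J -ibp.
  by apply: eq_Rintegral => y _; rewrite dE.
(* The integrating factor exp(c^2 / 4) turns the differential equation for J into the constancy of a
   function. *)
have dK (c : R) : is_derive c 1 (fun c => J c * expR (c ^+ 2 / 4)) 0.
  have dq : is_derive c 1 (fun c : R => c ^+ 2 / 4) (c / 2).
    by apply: is_derive_eq; rewrite /GRing.scale/=; field.
  apply: (is_derive_cst_eq (is_derive_M (dJ c) (is_derive_expR_comp dq))).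
  ring.
have := is_derive_0_is_cst b 0 dK.
rewrite expr0n/= mul0r expR0 mulr1 {2}/J /f.
under eq_Rintegral do rewrite mul0r add0r.
have ig : rinteg L (fun y : R => expR (- y ^+ 2)) by exact: integrableT_gauss.
rewrite (rintZr _ ig) (_ : \int[L]_x expR (- x ^+ 2) = Num.sqrt pi); last first.
  by rewrite /Rintegral integralT_gauss.
by move=> E; rewrite [RHS]mulrAC -E expRN mulfK// gt_eqF// expR_gt0.
Qed.


(** A real translation and a dilation complete the square in p; the translation only changes the
    phase, by p q / (2 al), so no contour has to be moved although the exponent is complex. *)
Lemma gauss_phase_integral (al p q phi : R) : 0 < al ->
  rinteg L (fun y : R => expR (p * y - al * y ^+ 2) * cos (q * y + phi)) /\
  \int[L]_y (expR (p * y - al * y ^+ 2) * cos (q * y + phi)) =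
  Num.sqrt (pi / al) * expR ((p ^+ 2 - q ^+ 2) / (4 * al)) * cos (p * q / (2 * al) + phi).
Proof.
move=> al0; set a := Num.sqrt al.
have a0 : 0 < a by rewrite sqrtr_gt0.
have a2 : a ^+ 2 = al by rewrite sqr_sqrtr// ltW.
pose phi' := p * q / (2 * al) + phi.
pose h (y : R) := expR (- y ^+ 2) * cos (q / a * y + phi').
pose s := - p / (2 * a).
have ch : continuous h.
  have dh (y : R) : is_derive y 1 h
     (expR (- y ^+ 2) * (- 2 * y) * cos (q / a * y + phi') +
      expR (- y ^+ 2) * (- sin (q / a * y + phi') * (q / a))).
    have d1 : is_derive y 1 (fun y : R => - y ^+ 2) (- 2 * y).
      by apply: is_derive_eq; rewrite /GRing.scale/=; ring.
    have d2 : is_derive y 1 (fun y : R => q / a * y + phi') (q / a).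
      by apply: is_derive_eq; rewrite /GRing.scale/=; ring.
    exact: (is_derive_M (is_derive_expR_comp d1) (is_derive_cos_comp d2)).
  exact: derive_continuous dh.
have [C C0 hC] := poly_gauss_le 0 0 (@ltr01 R).
have ih : rinteg L h.
  apply: (@rinteg_decay _ C); first exact: continuous_measurable_fun.
  move=> y; have := hC y; rewrite expr0 mul0r sub0r !mul1r; apply: le_trans.
  rewrite normrM ger0_norm ?expR_ge0// ler_piMr ?expR_ge0//.
  by rewrite ler_norml cos_geN1 cos_le1.
have [ih' E] := Rintegral_affine s a0 ch ih.
have hE y : expR (p * y - al * y ^+ 2) * cos (q * y + phi) =
    expR (p ^+ 2 / (4 * al)) * h (a * y + s).
  rewrite /h mulrA -expRD; congr (expR _ * cos _).
    by rewrite /s -a2; field; lra.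
  by rewrite /phi' /s -a2; field; lra.
split.
  by have := rintegZ (expR (p ^+ 2 / (4 * al))) ih'; under eq_fun do rewrite -hE.
under eq_Rintegral do rewrite hE.
rewrite (rintZl _ ih').
move: E; rewrite /h gauss_cos_integral => /esym E.
have {}E : \int[L]_x h (a * x + s) = a^-1 * (Num.sqrt pi * expR (- ((q / a) ^+ 2 / 4)) * cos phi').
  by rewrite -E mulKf// gt_eqF.
rewrite E sqrtrM ?pi_ge0// sqrtrV ?(ltW al0)// -/a -/phi'.
have -> : (p ^+ 2 - q ^+ 2) / (4 * al) = p ^+ 2 / (4 * al) + - ((q / a) ^+ 2 / 4).
  by rewrite -a2; field; lra.
by rewrite expRD; ring.
Qed.

Local Open Scope complex_scope.

Lemma cgauss_integral (al : R) (be : R[i]) : 0 < al ->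
  cinteg L (fun y : R => cexp (be * y%:C - (al * y ^+ 2)%:C)) /\
  cint L (fun y : R => cexp (be * y%:C - (al * y ^+ 2)%:C)) =
  (Num.sqrt (pi / al))%:C * cexp (be ^+ 2 / (4 * al)%:C).
Proof.
move=> al0; case: be => p q.
have rE y : Re (cexp ((p +i* q) * y%:C - (al * y ^+ 2)%:C)) =
   expR (p * y - al * y ^+ 2) * cos (q * y + 0).
  by rewrite /cexp/=; congr (expR _ * cos _); ring.
have cosS (u : R) : cos (u + - (pi / 2)) = sin u.
  by rewrite cosB cos_pihalf sin_pihalf mulr0 add0r mulr1.
have iE y : Im (cexp ((p +i* q) * y%:C - (al * y ^+ 2)%:C)) =
   expR (p * y - al * y ^+ 2) * cos (q * y + (- (pi / 2))).
  rewrite cosS /cexp/=.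
  by congr (expR _ * sin _); ring.
have [i1 e1] := gauss_phase_integral p q 0 al0.
have [i2 e2] := gauss_phase_integral p q (- (pi / 2)) al0.
split; first by split; [under eq_fun do rewrite rE|under eq_fun do rewrite iE].
have bE : (p +i* q) ^+ 2 / (4 * al)%:C = ((p ^+ 2 - q ^+ 2) / (4 * al)) +i* (p * q / (2 * al)).
  have al4 : ((4 * al)%:C : R[i]) != 0 by apply/eqP => -[]; lra.
  by apply: (mulIf al4); rewrite divfK//; apply: complex_eqP; rewrite expr2 !cReImE/=; field; lra.
rewrite bE; set lhs := cint _ _.
have -> : lhs = (\int[L]_y (expR (p * y - al * y ^+ 2) * cos (q * y + 0))) +i*
    (\int[L]_y (expR (p * y - al * y ^+ 2) * cos (q * y - pi / 2))).
  by apply: complex_eqP; apply: eq_Rintegral => y _; [exact: rE|exact: iE].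
rewrite e1 e2 cosS addr0; apply: complex_eqP; rewrite !cReImE /cexp/=; ring.
Qed.

End line.

(** * Product integrands on R^n *)

Section product_integrals.
Context {R : realType}.
Notation L := (@lebesgue_measure R).
Notation mu n := (lebesgue_rV R n).
Local Open Scope complex_scope.

Lemma cmeas_coord n (i : 'I_n) (h : R -> R[i]) :
  cmeas (T := measurableTypeR R) h -> cmeas (fun y : 'rV[R]_n => h (y 0 i)).
Proof.
by move=> mh; apply: (cmeas_comp (T2 := measurableTypeR R) mh); exact: measurable_rVcoord.
Qed.

Lemma measurable_coord n (i : 'I_n) (h : R -> R) :
  measurable_fun [set: measurableTypeR R] h ->
  measurable_fun setT (fun y : 'rV[R]_n => h (y 0 i)).
Proof.
move=> mh; apply: (@measurableT_comp _ _ _ _ (measurableTypeR R) _ h _ (rVcoord i)) => //.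
exact: measurable_rVcoord.
Qed.

Lemma measurable_prodr d (T : measurableType d) (I : Type) (r : seq I) (h : I -> T -> R) :
  (forall i, measurable_fun setT (h i)) ->
  measurable_fun setT (fun x => \prod_(i <- r) h i x).
Proof.
move=> mh; elim: r => [|i r IH].
  by under eq_fun do rewrite big_nil; exact: measurable_cst.
by under eq_fun do rewrite big_cons; exact: measurable_funM.
Qed.

(** The measure in dimension n + 1 is the image of a product measure under [consrV]; the inductions
    on the dimension that follow rest on this. *)
Lemma rinteg_rVS n (h : 'rV[R]_n.+1 -> R) : measurable_fun setT h ->
  rinteg (L \x mu n)%E (h \o @consrV R n) ->
  rinteg (mu n.+1) h /\
  \int[mu n.+1]_y h y = \int[(L \x mu n)%E]_p h (consrV p).
Proof.
move=> mh ih; have mEh : measurable_fun setT (EFin \o h) by exact/measurable_EFinP.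
split; first exact: (@integrable_pushforward _ _ _ _ _ (@consrV R n) _ (L \x mu n)%E _ _ mEh).
rewrite /Rintegral; congr fine.
by rewrite -(@integral_pushforward _ _ _ _ _ (@consrV R n) (@measurable_consrV R n) (L \x mu n)%E setT _ mEh).
Qed.

Lemma prod_consrV n (S : comPzSemiRingType) (h : 'I_n.+1 -> R -> S) (p : R * 'rV[R]_n) :
  \prod_i h i (consrV p 0 i) = h ord0 p.1 * \prod_j h (lift ord0 j) (p.2 0 j).
Proof.
rewrite big_ord_recl; congr (_ * _); first by rewrite consrVE unlift_none.
by apply: eq_bigr => j _; rewrite consrVE liftK.
Qed.

Lemma rinteg_prodrV n (h : 'I_n -> R -> R) : (forall i, rinteg L (h i)) ->
  rinteg (mu n) (fun y => \prod_i h i (y 0 i)).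
Proof.
elim: n h => [|n IH] h ih.
  apply: rinteg_ltyP.
  - by under eq_fun do rewrite big_ord0; exact: measurable_cst.
  - by move=> x; rewrite big_ord0.
  - under eq_integral do rewrite big_ord0.
    by rewrite integral_cst//= diracT mule1 ltry.
have mh : measurable_fun setT (fun y : 'rV[R]_n.+1 => \prod_i h i (y 0 i)).
  apply: measurable_prodr => i; apply: measurable_coord.
  exact: (rinteg_meas (ih i)).
apply: (rinteg_rVS mh _).1.
have := rinteg_tensor (ih ord0) (IH _ (fun j => ih (lift ord0 j))).
by apply: eq_integrable => // p _ /=; rewrite prod_consrV.
Qed.

Lemma cint_prodrV n (h : 'I_n -> R -> R[i]) : (forall i, cinteg L (h i)) ->
  cinteg (mu n) (fun y => \prod_i h i (y 0 i)) /\
  cint (mu n) (fun y => \prod_i h i (y 0 i)) = \prod_i cint L (h i).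
Proof.
move=> ih.
have cI m (k : 'I_m -> R -> R[i]) : (forall i, cinteg L (k i)) ->
    cinteg (mu m) (fun y => \prod_i k i (y 0 i)).
  move=> ik; apply: cintegP.
    apply: cmeas_prod => i; apply: cmeas_coord.
    exact: (cinteg_meas (ik i)).
  have := rinteg_prodrV (fun i => cinteg_normc (ik i)).
  by apply: eq_integrable => // y _ /=; rewrite normc_prod.
split; first exact: cI.
elim: n h ih => [|n IH] h ih.
  rewrite big_ord0; under [X in cint _ X]eq_fun do rewrite big_ord0.
  by apply: cint_cst1; exact: diracT.
have ci := cI _ _ ih.
have ci' : cinteg (L \x mu n)%E (fun p => h ord0 p.1 * \prod_j h (lift ord0 j) (p.2 0 j)).
  apply: cintegP.
    apply: cmeasM.
      by apply: (cmeas_comp (cinteg_meas (ih ord0))); exact: measurable_fst.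
    apply: (cmeas_comp (T2 := 'rV[R]_n) (f := fun y => \prod_j h (lift ord0 j) (y 0 j))).
      exact: (cinteg_meas (cI _ _ (fun j => ih (lift ord0 j)))).
    exact: measurable_snd.
  have := rinteg_tensor (cinteg_normc (ih ord0)) (cinteg_normc (cI _ _ (fun j => ih (lift ord0 j)))).
  by apply: eq_integrable => // p _ /=; rewrite normcM.
have -> : cint (mu n.+1) (fun y => \prod_i h i (y 0 i)) =
    cint (L \x mu n)%E (fun p => h ord0 p.1 * \prod_j h (lift ord0 j) (p.2 0 j)).
  have [m1 m2] := cinteg_meas ci.
  apply: complex_eqP; rewrite /cint/=.
    rewrite (rinteg_rVS m1 _).2; last first.
      by have := ci'.1; apply: eq_integrable => // p _ /=; rewrite prod_consrV.
    by apply: eq_Rintegral => p _; rewrite prod_consrV.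
  rewrite (rinteg_rVS m2 _).2; last first.
    by have := ci'.2; apply: eq_integrable => // p _ /=; rewrite prod_consrV.
  by apply: eq_Rintegral => p _; rewrite prod_consrV.
have cn : cinteg (mu n) (fun y : 'rV[R]_n => \prod_j h (lift ord0 j) (y 0 j)).
  exact: (cI _ _ (fun j => ih (lift ord0 j))).
rewrite cint_prod//; last first.
  move=> x /=.
  have := cintegZ (h ord0 x) cn.
  exact.
under [X in cint _ X]eq_fun do rewrite /= (cintZ _ cn).
by rewrite big_ord_recl -(IH _ (fun j => ih (lift ord0 j))) (cintZr _ (ih ord0)).
Qed.

End product_integrals.

(** * Heat extension and Parseval's identity *)

Section parseval.
Context {R : realType} {n : nat}.
Notation L := (@lebesgue_measure R).
Notation E := 'rV[R]_n.
Notation mu := (lebesgue_rV R n).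
Local Open Scope complex_scope.
Implicit Types (f g h : E -> R[i]) (x y xi : E).

Lemma dotrVC x y : dotrV x y = dotrV y x.
Proof. by apply: eq_bigr => i _; rewrite mulrC. Qed.

Lemma dotrV_ge0 x : 0 <= dotrV x x.
Proof. by apply: sumr_ge0 => i _; rewrite -expr2 sqr_ge0. Qed.

Lemma sqr_enorm x : enorm x ^+ 2 = dotrV x x.
Proof. by rewrite sqr_sqrtr// dotrV_ge0. Qed.

Lemma enorm_ge0 x : 0 <= enorm x.
Proof. exact: sqrtr_ge0. Qed.

Lemma coord_le_enorm x i : `|x 0 i| <= enorm x.
Proof.
rewrite -sqrtr_sqr ler_wsqrtr// /dotrV (bigD1 i)//= expr2 lerDl.
by apply: sumr_ge0 => j _; rewrite -expr2 sqr_ge0.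
Qed.

Lemma measurable_id_coord (i : 'I_n) : measurable_fun setT (fun x : E => x 0 i).
Proof. by apply: (@measurable_coord R n i id); exact: measurable_id. Qed.

Lemma measurable_dotrV d (T : measurableType d) (u v : T -> E) :
  measurable_fun setT u -> measurable_fun setT v ->
  measurable_fun setT (fun z : T => dotrV (u z) (v z)).
Proof.
move=> mu_ mv; rewrite /dotrV.
have aux (s : seq 'I_n) : measurable_fun setT (fun z : T => \sum_(i <- s) u z 0 i * v z 0 i).
  elim: s => [|i s IH].
    by under eq_fun do rewrite big_nil; exact: measurable_cst.
  under eq_fun do rewrite big_cons; apply: measurable_funD => //.
  by apply: measurable_funM;
    apply: (@measurableT_comp _ _ _ _ _ _ (@rVcoord R n i)) => //; exact: measurable_rVcoord.
exact: aux.
Qed.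

Lemma measurable_enorm : measurable_fun setT (@enorm R n).
Proof.
apply: measurableT_comp; first by apply: continuous_measurable_fun; exact: sqrt_continuous.
by apply: measurable_dotrV; exact: measurable_id.
Qed.

Lemma measurable_eball (z : E) (r : R) : measurable (eball z r).
Proof.
have -> : eball z r = setT `&` (fun x => enorm (x - z) < r) @^-1` [set true].
  by rewrite setTI; apply/seteqP; split => x /=.
apply: measurable_fun_ltr => //; apply: (measurableT_comp measurable_enorm).
apply: measurable_fun_rVP => i; under eq_fun do rewrite !mxE.
by apply: measurable_funB; [exact: measurable_id_coord|exact: measurable_cst].
Qed.

Lemma fourier_kernelE (x xi : E) :
  (cos (dotrV x xi) -i* sin (dotrV x xi)) = cexp (0 -i* dotrV x xi) :> R[i].
Proof. by rewrite cexp_im cosN sinN. Qed.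

Lemma cmeas_kernel : cmeas (T := (E * E)%type) (fun p => cexp (0 -i* dotrV p.1 p.2)).
Proof.
apply: cmeas_cexp; split => /=; first exact: measurable_cst.
by apply: measurable_funN; apply: measurable_dotrV; [exact: measurable_fst|exact: measurable_snd].
Qed.

Lemma normc_kernel x xi : normc (cexp (0 -i* dotrV x xi)) = 1.
Proof. by rewrite normc_cexp/= expR0. Qed.

(** The multiplication formula: the kernel has modulus 1 and is symmetric in x and xi, so Fubini's
    theorem applies to the tensor product of f and h. *)
Lemma fourier_fubini f h : cinteg mu f -> cinteg mu h ->
  cinteg mu (fun xi => fourier f xi * h xi) /\
  cint mu (fun xi => fourier f xi * h xi) = cint mu (fun x => f x * fourier h x).
Proof.
move=> cf ch; pose K (p : E * E) := cexp (0 -i* dotrV p.1 p.2) * (f p.1 * h p.2).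
have mf := cinteg_meas cf; have mh := cinteg_meas ch.
have mK : cmeas K.
  apply: cmeasM; first exact: cmeas_kernel.
  by apply: cmeasM; [exact: (cmeas_comp mf measurable_fst)|exact: (cmeas_comp mh measurable_snd)].
have iK : cinteg (mu \x mu)%E K.
  apply: cintegP => //.
  have := rinteg_tensor (cinteg_normc cf) (cinteg_normc ch).
  by apply: eq_integrable => // p _ /=; rewrite !normcM normc_kernel mul1r.
have sect1 x : cinteg mu (fun xi => cexp (0 -i* dotrV x xi) * h xi).
  apply: (cinteg_le _ _ (cinteg_normc ch)); last by move=> xi; rewrite normcM normc_kernel mul1r.
  apply: cmeasM => //.
  exact: (cmeas_comp cmeas_kernel (measurable_pair1 x)).
have sect2 xi : cinteg mu (fun x => cexp (0 -i* dotrV x xi) * f x).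
  apply: (cinteg_le _ _ (cinteg_normc cf)); last by move=> x; rewrite normcM normc_kernel mul1r.
  apply: cmeasM => //.
  exact: (cmeas_comp cmeas_kernel (measurable_pair2 xi)).
have FE xi : fourier f xi = cint mu (fun x => cexp (0 -i* dotrV x xi) * f x).
  by congr cint; apply/funext => x; rewrite fourier_kernelE.
have HE x : fourier h x = cint mu (fun xi => cexp (0 -i* dotrV x xi) * h xi).
  by congr cint; apply/funext => xi; rewrite fourier_kernelE dotrVC.
have [||_ i2 e] := cfubini iK.
- move=> x; have := cintegZ (f x) (sect1 x).
  by congr cinteg; apply/funext => xi; rewrite /K /=; ring.
- move=> xi; have := cintegZ (h xi) (sect2 xi).
  by congr cinteg; apply/funext => x; rewrite /K /=; ring.
have E2 xi : cint mu (fun x => K (x, xi)) = fourier f xi * h xi.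
  by rewrite FE -(cintZr _ (sect2 xi)); congr cint; apply/funext => x; rewrite /K /=; ring.
have E1 x : cint mu (fun xi => K (x, xi)) = f x * fourier h x.
  by rewrite HE -(cintZ _ (sect1 x)); congr cint; apply/funext => xi; rewrite /K /=; ring.
split.
  by move: i2; congr cinteg; apply/funext => xi; rewrite E2.
transitivity (cint mu (fun y => cint mu (fun x => K (x, y)))).
  by congr cint; apply/funext => xi; rewrite E2.
by rewrite -e; congr cint; apply/funext => x; rewrite E1.
Qed.

(* The function exp(i X.xi - t |xi|^2) of xi at a complex point X, in the product form
   that reduces its integrals to dimension one. *)
Definition gauss_kernel (X : 'I_n -> R[i]) (t : R) (xi : E) : R[i] :=
  \prod_i cexp ('i * X i * (xi 0 i)%:C - (t * xi 0 i ^+ 2)%:C).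

(** The heat kernel without its factor (4 pi t)^(-n/2), continued to complex X: the exponent has the
    square of X_i - y_i and not of its modulus. *)
Definition heat_kernel (X : 'I_n -> R[i]) (t : R) (y : E) : R[i] :=
  \prod_i cexp (- (X i - (y 0 i)%:C) ^+ 2 / (4 * t)%:C).

Lemma cinteg_gauss_kernel X t : 0 < t -> cinteg mu (gauss_kernel X t).
Proof.
move=> t0.
apply: (cint_prodrV (h := fun i z => cexp ('i * X i * z%:C - (t * z ^+ 2)%:C)) _).1 => i.
exact: (cgauss_integral _ t0).1.
Qed.

(** Makes square integrability of these kernels an instance of their integrability. *)
Lemma sqr_gauss_kernel X t xi :
  gauss_kernel X t xi ^+ 2 = gauss_kernel (fun i => 2 * X i) (2 * t) xi.
Proof.
rewrite /gauss_kernel -prodrXl; apply: eq_bigr => i _.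
rewrite expr2 -cexpD; congr cexp; rewrite !rmorphM/=; ring.
Qed.

Lemma gauss_kernel_L2 X t : 0 < t -> rinteg mu (fun xi => normc (gauss_kernel X t xi) ^+ 2).
Proof.
move=> t0; have t20 : 0 < 2 * t by lra.
have := cinteg_normc (cinteg_gauss_kernel (fun i => 2 * X i) t20).
by apply: eq_integrable => // xi _ /=; rewrite -sqr_gauss_kernel normcX.
Qed.

Lemma fourier_gauss_kernel X t y : 0 < t ->
  fourier (gauss_kernel X t) y = (Num.sqrt (pi / t) ^+ n)%:C * heat_kernel X t y.
Proof.
move=> t0.
transitivity (cint mu (fun xi : E => \prod_i
    cexp ('i * (X i - (y 0 i)%:C) * (xi 0 i)%:C - (t * xi 0 i ^+ 2)%:C))).
  congr cint; apply/funext => xi; rewrite fourier_kernelE.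
  have -> : 0 -i* dotrV xi y = \sum_i (- 'i * (y 0 i)%:C * (xi 0 i)%:C) :> R[i].
    transitivity (- 'i * (dotrV xi y)%:C : R[i]).
      by apply: complex_eqP; rewrite !cReImE/=; ring.
    rewrite /dotrV rmorph_sum mulr_sumr; apply: eq_bigr => i _.
    rewrite rmorphM/=; ring.
  rewrite cexp_sum -big_split; apply: eq_bigr => i _ /=.
  rewrite -cexpD; congr cexp; ring.
rewrite (cint_prodrV (h := fun i z => cexp ('i * (X i - (y 0 i)%:C) * z%:C - (t * z ^+ 2)%:C)) _).2; last first.
  by move=> i; exact: (cgauss_integral _ t0).1.
under eq_bigr do rewrite (cgauss_integral _ t0).2.
rewrite big_split/= prodr_const card_ord -rmorphXn; congr (_ * _).
apply: eq_bigr => i _; congr cexp; congr (_ / _).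
by rewrite exprMn sqr_i mulN1r.
Qed.

(** The product of [fourier f] with a Gaussian is integrable by [fourier_fubini], hence measurable,
    and [k] is the inverse of that Gaussian. *)
Lemma cmeas_fourier f : cinteg mu f -> cmeas (fourier f).
Proof.
move=> cf; pose h := gauss_kernel (fun=> 0) 1.
have ch : cinteg mu h by exact: cinteg_gauss_kernel.
have [ifh _] := fourier_fubini cf ch.
pose k (xi : E) : R := \prod_i expR (xi 0 i ^+ 2).
have hk xi : h xi * (k xi)%:C = 1.
  rewrite /h /gauss_kernel /k rmorph_prod -big_split/=; apply: big1 => i _.
  rewrite -cexp_real -cexpD mul1r mulr0 mul0r sub0r addNr; exact: cexp0.
have -> : fourier f = fun xi => (fourier f xi * h xi) * (k xi)%:C.
  by apply/funext => xi; rewrite -mulrA hk mulr1.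
apply: cmeasM; first exact: cinteg_meas ifh.
apply: cmeas_real; apply: measurable_prodr => i.
apply: measurableT_comp; first exact: measurable_expR.
by apply: measurable_funX; exact: measurable_id_coord.
Qed.

Lemma rinteg_eball (z : E) (r : R) : rinteg mu (\1_(eball z r)).
Proof.
have ib : rinteg mu (fun y : E => \prod_i \1_(`[z 0 i - r, z 0 i + r]%classic) (y 0 i)).
  apply: (@rinteg_prodrV R n (fun i => \1_(`[z 0 i - r, z 0 i + r]%classic))) => i.
  exact: integrable_indic_itv.
apply: rinteg_le ib.
  by apply: measurable_indic; exact: measurable_eball.
move=> y; have [yr|yr] := pselect (eball z r y); rewrite [\1_(eball _ _) y]indicE.
  rewrite mem_set// normr1 big1// => i _.
  rewrite indicE mem_set//= in_itv/=; have := coord_le_enorm (y - z) i.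
  move: yr; rewrite /eball/= => yr; rewrite !mxE => h.
  by have := le_lt_trans h yr; rewrite ltr_norml => /andP[? ?]; apply/andP; split; lra.
by rewrite memNset// normr0; apply: prodr_ge0.
Qed.

Lemma memL2P f : memL2 f -> cmeas f /\ rinteg mu (fun x => normc (f x) ^+ 2).
Proof.
move=> [m1 m2 foo]; have mf : cmeas f by [].
split=> //; apply: rinteg_ltyP => //; last by move=> x; exact: sqr_ge0.
by apply: measurable_funX; exact: cmeas_normc.
Qed.

Lemma cintegM_L2 f h : cmeas f -> cmeas h ->
  rinteg mu (fun x => normc (f x) ^+ 2) -> rinteg mu (fun x => normc (h x) ^+ 2) ->
  cinteg mu (fun x => f x * h x).
Proof.
move=> mf mh if2 ih2; apply: cintegP; first exact: cmeasM.
have := rintegM_L2 (cmeas_normc mf) (cmeas_normc mh) if2 ih2.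
by apply: eq_integrable => // x _ /=; rewrite normcM.
Qed.

Lemma cmeas_truncate N f : cmeas f -> cmeas (truncate N f).
Proof.
move=> mf; apply: cmeasM => //; apply: cmeas_real.
by apply: measurable_indic; exact: measurable_eball.
Qed.

Lemma normc_truncate N f x : normc (truncate N f x) = \1_(eball 0 N%:R) x * normc (f x).
Proof. by rewrite normcM normc_real ger0_norm. Qed.

Lemma cinteg_truncate N f : cmeas f -> rinteg mu (fun x => normc (f x) ^+ 2) ->
  cinteg mu (truncate N f).
Proof.
move=> mf if2; apply: cintegP; first exact: cmeas_truncate.
have mI : measurable_fun setT (\1_(eball (0 : E) N%:R) : E -> R).
  by apply: measurable_indic; exact: measurable_eball.
have i2 : rinteg mu (fun x => (\1_(eball (0 : E) N%:R) x : R) ^+ 2).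
  have := rinteg_eball 0 N%:R; apply: eq_integrable => // x _ /=.
  by rewrite indicE; case: (_ \in _); rewrite ?expr0n// expr1n.
have := rintegM_L2 mI (cmeas_normc mf) i2 if2.
by apply: eq_integrable => // x _ /=; rewrite normc_truncate.
Qed.

Lemma cvg_truncate f h : cmeas f -> cmeas h ->
  rinteg mu (fun x => normc (f x) ^+ 2) -> rinteg mu (fun x => normc (h x) ^+ 2) ->
  normc (cint mu (fun x => f x * h x) - cint mu (fun x => truncate N f x * h x))
    @[N --> \oo] --> (0 : R).
Proof.
move=> mf mh if2 ih2; have ifh := cintegM_L2 mf mh if2 ih2.
pose G x := normc (f x) * normc (h x).
have iG : rinteg mu G by exact: rintegM_L2 (cmeas_normc mf) (cmeas_normc mh) if2 ih2.
have T1 N x : (\1_(eball 0 N%:R) x : R) <= 1 by rewrite indicE; case: (_ \in _).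
pose H N x := normc (f x * h x - truncate N f x * h x).
have GH N x : H N x = (1 - \1_(eball 0 N%:R) x) * G x.
  rewrite /H /truncate -!mulrA -[X in normc (X - _)]mul1r -mulrBl normcM normcM.
  rewrite -[1]/(1%:C : R[i]) -rmorphB normc_real ger0_norm ?subr_ge0// T1.
have G0 x : 0 <= G x by rewrite mulr_ge0// normc_ge0.
have HG N x : H N x <= G x.
  by rewrite GH ler_piMl// lerBlDr lerDl.
have itr N : cinteg mu (fun x => truncate N f x * h x).
  apply: (cinteg_le _ _ iG).
    by apply: cmeasM => //; exact: cmeas_truncate.
  by move=> x; rewrite normcM normc_truncate -mulrA; apply: ler_piMl; [exact: G0|exact: T1].
have mH N : measurable_fun setT (H N).
  apply: cmeas_normc; apply: cmeasB; first exact: cinteg_meas ifh.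
  exact: cinteg_meas (itr N).
have lim : \int[mu]_x H N x @[N --> \oo] --> \int[mu]_x (0 : R).
  apply: (Rdominated_cvg _ _ _ iG) => //.
    apply: aeW => x; apply: cvg_near_cst; near=> N; apply/eqP; rewrite GH indicE mem_set.
      by rewrite subrr mul0r.
    rewrite /eball/= subr0 (le_lt_trans (ler_norm _))//.
    by near: N; exact: nbhs_infty_gtr.
  by move=> N x; rewrite ger0_norm ?normc_ge0.
rewrite Rintegral_cst// mul0r in lim.
apply: (@squeeze_cvgr _ _ _ _ (fun=> 0) (fun N => \int[mu]_x H N x)) => //.
  apply: nearW => N; rewrite normc_ge0/=.
  have := normc_cint (cintegB ifh (itr N)).
  by rewrite (cintB ifh (itr N)).
exact: cvg_cst.
Unshelve. all: by end_near. Qed.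

(** As [g] is only the L^2 limit of the transforms of truncations of f, the multiplication formula
    is applied to the truncations and both of its sides pass to the limit. No conjugate appears,
    which keeps the identity holomorphic in a parameter of h. *)
Lemma parseval f g h : is_fourierL2 f g -> cinteg mu h ->
  rinteg mu (fun x => normc (h x) ^+ 2) ->
  rinteg mu (fun x => normc (fourier h x) ^+ 2) ->
  cint mu (fun xi => g xi * h xi) = cint mu (fun x => f x * fourier h x).
Proof.
move=> [/memL2P[mf if2] /memL2P[mg ig2] lim] ch ih2 iFh2.
have mh := cinteg_meas ch; have mFh := cmeas_fourier ch.
have igh := cintegM_L2 mg mh ig2 ih2.
have itr N := cinteg_truncate N mf if2.
have fub N := fourier_fubini (itr N) ch.
apply/eqP; rewrite -subr_eq0 -normc_eq0; apply/eqP.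
apply/eqP; rewrite eq_le normc_ge0 andbT; apply/ler_addgt0Pl => e e0; rewrite addr0.
pose A := \int[mu]_x normc (h x) ^+ 2.
have A0 : 0 <= A by apply: Rintegral_ge0 => x _; exact: sqr_ge0.
(* The error on the side of g is at most the integral of |u|^2 / d + d |h|^2, with u the L^2 error
   of the transform. This [d] makes the second part at most e / 4; the first follows once the
   integral of |u|^2 is below [e / 4 * d]. *)
pose d := e / (4 * (A + 1)); have d0 : 0 < d by rewrite divr_gt0//; lra.
have dA : d * A <= e / 4.
  rewrite /d mulrAC ler_pdivrMr; last by lra.
  nra.
have e4 : 0 < e / 4 * d by rewrite mulr_gt0//; lra.
have lim2 := cvg_truncate mf mFh if2 iFh2.
near \oo => N.
have b1 : normc (cint mu (fun x => f x * fourier h x) -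
                cint mu (fun x => truncate N f x * fourier h x)) < e / 4.
  near: N; have : 0 < e / 4 by lra.
  move=> /(cvgr_lt _ lim2); exact.
have b2 : (\int[mu]_xi (normc (fourier (truncate N f) xi - g xi) ^+ 2)%:E < (e / 4 * d)%:E)%E.
  near: N; apply: (lim [set z | (z < (e / 4 * d)%:E)%E]).
  apply: open_nbhs_nbhs; split; first exact: open_ereal_lt_ereal.
  by rewrite /= lte_fin.
pose u xi := fourier (truncate N f) xi - g xi.
have mu_ : cmeas u by apply: cmeasB => //; exact: cmeas_fourier (itr N).
have iu2 : rinteg mu (fun xi => normc (u xi) ^+ 2).
  apply: rinteg_ltyP.
  - by apply: measurable_funX; exact: cmeas_normc.
  - by move=> xi; exact: sqr_ge0.
  - by rewrite (lt_trans b2)// ltry.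
rewrite (rinteg_EFin iu2) lte_fin in b2.
have b3 : normc (cint mu (fun xi => fourier (truncate N f) xi * h xi) -
                 cint mu (fun xi => g xi * h xi)) <= e / 2.
  rewrite -(cintB (fub N).1 igh).
  have bound : rinteg mu (fun xi => d^-1 * normc (u xi) ^+ 2 + d * normc (h xi) ^+ 2).
    by apply: rintegD; exact: rintegZ.
  apply: (le_trans (le_normc_cint _ _ bound)).
  - by apply: cmeasB; [exact: cinteg_meas (fub N).1|exact: cinteg_meas igh].
  - move=> xi; rewrite -mulrBl normcM -/(u xi).
    set p := normc (u xi); set q := normc (h xi).
    have -> : d^-1 * p ^+ 2 + d * q ^+ 2 = p * q + d^-1 * ((p - d * q / 2) ^+ 2 + (3 / 4) * (d * q) ^+ 2).
      by field; lra.
    rewrite lerDl mulr_ge0 ?invr_ge0 ?(ltW d0)//.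
    by rewrite addr_ge0 ?sqr_ge0// mulr_ge0 ?sqr_ge0//.
  - rewrite rintD ?rintZl//; [|exact: rintegZ..].
    have : d^-1 * \int[mu]_x normc (u x) ^+ 2 <= e / 4.
      by rewrite mulrC ler_pdivrMr// ltW.
    rewrite -/A; lra.
rewrite (fub N).2 in b3.
have -> : cint mu (fun xi => g xi * h xi) - cint mu (fun x => f x * fourier h x) =
   - (cint mu (fun x => truncate N f x * fourier h x) - cint mu (fun xi => g xi * h xi))
   - (cint mu (fun x => f x * fourier h x) - cint mu (fun x => truncate N f x * fourier h x)).
  by ring.
rewrite (le_trans (le_normcD _ _))// !normcN; lra.
Unshelve. all: by end_near. Qed.

Lemma normc_heat_kernel (X : 'I_n -> R[i]) t y : 0 < t ->
  normc (heat_kernel X t y) =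
  \prod_i expR (- ((Re (X i) - y 0 i) ^+ 2 - Im (X i) ^+ 2) / (4 * t)).
Proof.
move=> t0; rewrite normc_prod; apply: eq_bigr => i _; rewrite normc_cexp; congr expR.
have -> : ((4 * t)%:C)^-1 = (((4 * t)^-1)%:C : R[i]) by rewrite -fmorphV.
by case: (X i) => a b; rewrite [(_ - _) ^+ 2]expr2 !cReImE/=; ring.
Qed.

Lemma cmeas_gauss_kernel X t : cmeas (gauss_kernel X t).
Proof.
apply: cmeas_prod => i; apply: cmeas_cexp; apply: cmeasB.
  apply: cmeasM; first exact: cmeas_cst.
  by apply: cmeas_real; exact: measurable_id_coord.
apply: cmeas_real; apply: measurable_funM; first exact: measurable_cst.
by apply: measurable_funX; exact: measurable_id_coord.
Qed.

Lemma sqrt_pit_gt0 t : 0 < t -> 0 < Num.sqrt (pi / t) ^+ n :> R.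
Proof. by move=> t0; rewrite exprn_gt0// sqrtr_gt0 divr_gt0// pi_gt0. Qed.

Lemma fourier_gauss_L2 X t : 0 < t ->
  rinteg mu (fun y => normc (fourier (gauss_kernel X t) y) ^+ 2).
Proof.
move=> t0; set c := Num.sqrt (pi / t) ^+ n.
pose h i (y : R) := normc (cexp (- (X i - y%:C) ^+ 2 / (4 * t)%:C)) ^+ 2.
have hE i (y : R) : h i y = normc (cexp ((X i / t%:C) * y%:C - ((2 * t)^-1 * y ^+ 2)%:C)) *
    normc (cexp (- X i ^+ 2 / (2 * t)%:C)).
  rewrite -normcM -cexpD /h -normcX expr2 -cexpD; congr (normc (cexp _)).
  have t1 : (t%:C : R[i]) != 0 by apply/eqP => -[]; lra.
  rewrite !(rmorphM, fmorphV, rmorphXn)/=.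
  have -> : (2%:C : R[i]) = 2 by apply: complex_eqP => /=; ring.
  have -> : (4%:C : R[i]) = 4 by apply: complex_eqP => /=; ring.
  by field.
have ih i : rinteg L (h i).
  have t2 : 0 < (2 * t)^-1 by rewrite invr_gt0; lra.
  have := cinteg_normc (cgauss_integral (X i / t%:C) t2).1.
  move/(rintegZ (normc (cexp (- X i ^+ 2 / (2 * t)%:C)))).
  by apply: eq_integrable => // y _ /=; rewrite hE mulrC.
have := rintegZ (c ^+ 2) (rinteg_prodrV ih).
apply: eq_integrable => // y _.
rewrite -[RHS]/((normc (fourier (gauss_kernel X t) y) ^+ 2)%:E).
rewrite -[LHS]/((c ^+ 2 * \prod_i h i (y 0 i))%:E); congr EFin.
rewrite fourier_gauss_kernel// normcM exprMn normc_real.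
by rewrite real_normK ?num_real// -normcX /heat_kernel -prodrXl normc_prod; under [in RHS]eq_bigr do rewrite normcX.
Qed.

(** The equation bounds the left-hand side, where the symbol of the operator is a factor; flatness
    of f bounds the right-hand side. *)
Lemma heat_extension f g X t : is_fourierL2 f g -> 0 < t ->
  cint mu (fun xi => g xi * gauss_kernel X t xi) =
  (Num.sqrt (pi / t) ^+ n)%:C * cint mu (fun y => f y * heat_kernel X t y).
Proof.
move=> fg t0; rewrite (parseval fg (cinteg_gauss_kernel X t0)); last 2 first.
  exact: gauss_kernel_L2.
  exact: fourier_gauss_L2.
have [/memL2P[mf if2] _ _] := fg.
have c0 := sqrt_pit_gt0 t0.
have hkE y : heat_kernel X t y = ((Num.sqrt (pi / t) ^+ n)^-1)%:C * fourier (gauss_kernel X t) y.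
  rewrite fourier_gauss_kernel// mulrA -rmorphM mulVf ?mul1r// gt_eqF//.
have iFh : cinteg mu (fun x => f x * fourier (gauss_kernel X t) x).
  apply: cintegM_L2 => //; last exact: fourier_gauss_L2.
  by apply: cmeas_fourier; exact: cinteg_gauss_kernel.
rewrite -cintZ; last first.
  have := cintegZ ((Num.sqrt (pi / t) ^+ n)^-1)%:C iFh.
  by congr cinteg; apply/funext => y; rewrite hkE; ring.
by congr cint; apply/funext => y; rewrite fourier_gauss_kernel//; ring.
Qed.

End parseval.

(** * Integration by parts for truncated Gaussians *)

Section complex_derivative.
Context {R : realType}.
Notation L := (@lebesgue_measure R).
Local Open Scope complex_scope.
Implicit Types f g : R -> R[i].

Definition cderive f (x : R) (a : R[i]) :=
  is_derive x 1 (fun y : R => Re (f y)) (Re a) /\ is_derive x 1 (fun y : R => Im (f y)) (Im a).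

Definition ccont f := continuous (fun y : R => Re (f y)) /\ continuous (fun y : R => Im (f y)).

Lemma cderive_eq f x a b : cderive f x a -> a = b -> cderive f x b.
Proof. by move=> h <-. Qed.

Lemma cderiveM f g x a b : cderive f x a -> cderive g x b ->
  cderive (fun y => f y * g y) x (a * g x + f x * b).
Proof.
move=> [f1 f2] [g1 g2]; split.
  under eq_fun do rewrite cReM.
  apply: (is_derive_cst_eq (is_derive_D (is_derive_M f1 g1) (is_deriveN (is_derive_M f2 g2)))).
  by rewrite !cReImE; ring.
under eq_fun do rewrite cImM.
apply: (is_derive_cst_eq (is_derive_D (is_derive_M f1 g2) (is_derive_M f2 g1))).
by rewrite !cReImE; ring.
Qed.

Lemma cderive_real (h : R -> R) (x a : R) : is_derive x 1 h a ->
  cderive (fun y => (h y)%:C) x a%:C.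
Proof. by move=> dh; split => //=; exact: is_derive_cst. Qed.

Lemma cderive_cexp f x a : cderive f x a -> cderive (fun y => cexp (f y)) x (a * cexp (f x)).
Proof.
move=> [f1 f2]; split.
  apply: (is_derive_cst_eq (is_derive_M (is_derive_expR_comp f1) (is_derive_cos_comp f2))).
  by rewrite cReM /cexp/=; ring.
apply: (is_derive_cst_eq (is_derive_M (is_derive_expR_comp f1) (is_derive_sin_comp f2))).
by rewrite cImM /cexp/=; ring.
Qed.

Lemma cderive_ccont f f' : (forall x, cderive f x (f' x)) -> ccont f.
Proof.
move=> df; split.
  exact: (derive_continuous (f' := fun x => Re (f' x)) (fun x => (df x).1)).
exact: (derive_continuous (f' := fun x => Im (f' x)) (fun x => (df x).2)).
Qed.

Lemma ccontD f g : ccont f -> ccont g -> ccont (fun y => f y + g y).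
Proof.
move=> [f1 f2] [g1 g2]; split => y; under eq_fun do rewrite cReImE; apply: cvgD;
  by [exact: f1|exact: f2|exact: g1|exact: g2].
Qed.

Lemma ccontZ c f : ccont f -> ccont (fun y => c * f y).
Proof.
move=> [f1 f2]; split => y; under eq_fun do rewrite cReImE.
  by apply: cvgB; apply: cvgMr; [exact: f1|exact: f2].
by apply: cvgD; apply: cvgMr; [exact: f2|exact: f1].
Qed.

Lemma ccont_cmeas f : ccont f -> cmeas (T := measurableTypeR R) f.
Proof. by move=> [c1 c2]; split; exact: continuous_measurable_fun. Qed.

Lemma cint_derive0 f f' (C : R) : (forall x, cderive f x (f' x)) -> ccont f' ->
  (forall x, normc (f x) <= C * (1 + x ^+ 2)^-1) ->
  (forall x, normc (f' x) <= C * (1 + x ^+ 2)^-1) -> cint L f' = 0.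
Proof.
move=> df [c1 c2] fC f'C; apply: complex_eqP => /=.
  apply: (@Rintegral_derive0 _ (fun x => Re (f x)) _ C (fun x => (df x).1) c1) => x.
    exact: (le_trans (normRe_le _)).
  exact: (le_trans (normRe_le _)).
apply: (@Rintegral_derive0 _ (fun x => Im (f x)) _ C (fun x => (df x).2) c2) => x.
  exact: (le_trans (normIm_le _)).
exact: (le_trans (normIm_le _)).
Qed.

End complex_derivative.

(** The arithmetic of one integration by parts, with s = 1 / t. Since 1 <= 2 s, the terms that carry
    no factor s can be charged to it as well. *)
Lemma decay_step {R : realFieldType} (de C1 C2 C3 C4 m x s T e k1 k2 k3 k4 : R) :
  0 <= de -> 0 <= C1 -> 0 <= C2 -> 0 <= C3 -> 0 <= C4 -> 0 <= m ->
  2^-1 <= s -> 0 <= T -> 0 <= e ->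
  x * k1 <= C1 * T * e -> x * k2 <= C2 * T * e -> x * k3 <= C3 * T * e ->
  x * k4 <= C4 * T * e ->
  x * (s / 2 * (k1 + de * k2) + m * k3 + k4) <=
  (C1 + de * C2 + 2 * (m * C3) + 2 * C4) * (s * T) * e.
Proof.
move=> de0 C10 C20 C30 C40 m0 s0 T0 e0 h1 h2 h3 h4.
have -> : x * (s / 2 * (k1 + de * k2) + m * k3 + k4) =
  s / 2 * (x * k1 + de * (x * k2)) + m * (x * k3) + x * k4 by ring.
have Te : 0 <= T * e by rewrite mulr_ge0.
have {}h1 : x * k1 <= C1 * (T * e) by rewrite mulrA.
have {}h2 : de * (x * k2) <= de * (C2 * (T * e)) by rewrite ler_wpM2l// mulrA.
have {}h3 : m * (x * k3) <= m * (C3 * (T * e)) by rewrite ler_wpM2l// mulrA.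
have {}h4 : x * k4 <= C4 * (T * e) by rewrite mulrA.
have H1 : 0 <= C1 * (T * e) by rewrite mulr_ge0.
have H2 : 0 <= de * (C2 * (T * e)) by rewrite !mulr_ge0.
have H3 : 0 <= m * (C3 * (T * e)) by rewrite !mulr_ge0.
have H4 : 0 <= C4 * (T * e) by rewrite mulr_ge0.
have -> : (C1 + de * C2 + 2 * (m * C3) + 2 * C4) * (s * T) * e =
  s * (C1 * (T * e) + de * (C2 * (T * e))) + (s * 2) * (m * (C3 * (T * e)) + C4 * (T * e)) by ring.
move: h1 h2 h3 h4 H1 H2 H3 H4.
move: (x * k1) (de * (x * k2)) (m * (x * k3)) (x * k4) => a1 a2 a3 a4.
move: (C1 * _) (de * _) (m * _) (C4 * _) => b1 b2 b3 b4 h1 h2 h3 h4 H1 H2 H3 H4.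
have s1 : 1 <= s * 2 by lra.
have q : s / 2 * (a1 + a2) <= s * (b1 + b2) by nra.
have q2 : a3 + a4 <= s * 2 * (b3 + b4) by nra.
lra.
Qed.

Section truncated_gaussian.
Context {R : realType}.
Notation L := (@lebesgue_measure R).
Local Open Scope complex_scope.
(** [Psi j] is the [j]-th derivative of 1 minus a cutoff around z. The whole sequence is carried
    along because each integration by parts may differentiate it once more. *)
Variables (Psi : nat -> R -> R) (z eta de : R).
Hypotheses (eta0 : 0 < eta) (de0 : 0 <= de) (de_eta : de <= eta / 10).
Hypothesis dPsi : forall j (y : R), is_derive y 1 (Psi j) (Psi j.+1 y).
Hypothesis Psi_eq0 : forall j y, `|y - z| < eta -> Psi j y = 0.
Hypothesis Psi_bounded : forall j, exists B : R, forall y, `|Psi j y| <= B.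

Let G (t : R) (ze : R[i]) (xi y : R) : R[i] :=
  cexp ('i * xi%:C * y%:C - (y%:C - ze) ^+ 2 / (4 * t)%:C).

(** The power of y - z makes the family closed under differentiation in y: the Gaussian contributes
    y - ze = (y - z) - (ze - z), whose second part is a constant of modulus at most [de]. *)
Let K m j (t : R) (ze : R[i]) (xi y : R) : R[i] :=
  ((y - z) ^+ m * Psi j y)%:C * G t ze xi y.

Let normc_G t ze xi y : 0 < t ->
  normc (G t ze xi y) = expR (- ((y - Re ze) ^+ 2 - Im ze ^+ 2) / (4 * t)).
Proof.
move=> t0; rewrite normc_cexp; congr expR.
have -> : ((4 * t)%:C)^-1 = (((4 * t)^-1)%:C : R[i]) by rewrite -fmorphV.
by case: ze => a b; rewrite expr2 !cReImE/=; ring.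
Qed.

(** For |y - z| >= eta the real distance to ze is at least 9/10 of |y - z| and the imaginary part at
    most 1/10 of it, and 81/100 - 1/100 = 4/5 bounds the exponent by - |y - z|^2 / (5 t). One half
    of this gives eta^2 / (10 t); the other half, as t <= 2, gives a decay in y that does not depend
    on t. *)
Let G_far t ze xi y : 0 < t -> t <= 2 -> normc (ze - z%:C) <= de -> eta <= `|y - z| ->
  normc (G t ze xi y) <= expR (- (eta ^+ 2 / (10 * t))) * expR (- (1 / 20 * (y - z) ^+ 2)).
Proof.
move=> t0 t2 hz hy; rewrite normc_G// -expRD ler_expR.
set a := Re (ze - z%:C); set b := Im (ze - z%:C).
have ha : `|a| <= de by rewrite (le_trans (normRe_le _)).
have hb : `|b| <= de by rewrite (le_trans (normIm_le _)).
have e1 : (y - Re ze) ^+ 2 >= (9 / 10 * `|y - z|) ^+ 2.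
  have -> : y - Re ze = (y - z) - a by rewrite /a; case: (ze) => ? ? /=; ring.
  rewrite -[leRHS]real_normK ?num_real// ler_pXn2r ?nnegrE// ?mulr_ge0//.
  have h : `|y - z| - `|a| <= `|y - z - a| := lerB_dist (y - z) a.
  have aux (p q r d0 n0 : R) : n0 <= p -> q <= d0 -> d0 <= n0 / 10 -> p - q <= r -> 9 / 10 * p <= r.
    by move=> *; lra.
  exact: (aux _ _ _ _ _ hy ha de_eta h).
have e2 : Im ze ^+ 2 <= (1 / 10 * `|y - z|) ^+ 2.
  have -> : Im ze = b by rewrite /b; case: (ze) => ? ? /=; ring.
  rewrite -[leLHS]real_normK ?num_real// ler_pXn2r ?nnegrE// ?mulr_ge0//.
  have aux (p q d0 n0 : R) : n0 <= p -> q <= d0 -> d0 <= n0 / 10 -> q <= 1 / 10 * p.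
    by move=> *; lra.
  exact: (aux _ _ _ _ hy hb de_eta).
have u2 : `|y - z| ^+ 2 = (y - z) ^+ 2 by rewrite real_normK// num_real.
have e3 : eta ^+ 2 <= (y - z) ^+ 2.
  by rewrite -u2 ler_pXn2r ?nnegrE ?normr_ge0 ?(ltW eta0).
rewrite !exprMn u2 in e1 e2.
move: e1 e2 e3; have := sqr_ge0 (y - z).
move: ((y - z) ^+ 2) ((y - Re ze) ^+ 2) (Im ze ^+ 2) (eta ^+ 2) => u a2 b2 n2 u0 e1 e2 e3.
rewrite mulNr -opprD lerN2 ler_pdivlMr; last by lra.
have -> : (n2 / (10 * t) + 1 / 20 * u) * (4 * t) = 4 / 10 * n2 + 1 / 5 * (u * t).
  by field; lra.
nra.
Qed.

Let K_le m j : exists2 C, 0 <= C & forall t ze xi y, 0 < t -> t <= 2 ->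
  normc (ze - z%:C) <= de ->
  normc (K m j t ze xi y) <= C * expR (- (eta ^+ 2 / (10 * t))) * (1 + y ^+ 2)^-1.
Proof.
have [B hB] := Psi_bounded j.
have B0 : 0 <= B by exact: le_trans (hB 0).
have h20 : 0 < 1 / 20 :> R by [].
have [C C0 hC] := poly_gauss_le m 0 h20.
exists (B * (C * (2 + 2 * z ^+ 2))).
  by rewrite !mulr_ge0// ?(ltW C0)//; have := sqr_ge0 z; lra.
move=> t ze xi y t0 t2 hz.
have E0 : 0 <= expR (- (eta ^+ 2 / (10 * t))) by exact: expR_ge0.
have y0 : 0 < 1 + y ^+ 2 by have := sqr_ge0 y; lra.
have RHS0 : 0 <= (2 + 2 * z ^+ 2) * (1 + y ^+ 2)^-1.
  by rewrite mulr_ge0 ?invr_ge0 ?(ltW y0)//; have := sqr_ge0 z; lra.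
have [hy|hy] := ltP `|y - z| eta.
  rewrite /K Psi_eq0// mulr0 mul0r normc0.
  by rewrite !mulr_ge0 ?invr_ge0 ?(ltW C0) ?(ltW y0)//; have := sqr_ge0 z; lra.
rewrite /K normcM normc_real normrM.
set u := y - z.
have u0 : 0 < 1 + u ^+ 2 by have := sqr_ge0 u; lra.
have um : `|u ^+ m| <= (1 + u ^+ 2) ^+ m.
  rewrite normrX lerXn2r ?nnegrE ?normr_ge0 ?(ltW u0)//.
  rewrite -(real_normK (num_real u)).
  by have := sqr_ge0 (`|u| - 1); have := normr_ge0 u; nra.
have := hC u; rewrite mul0r sub0r => hCu.
have uy : (1 + u ^+ 2)^-1 <= (2 + 2 * z ^+ 2) * (1 + y ^+ 2)^-1.
  rewrite ler_pdivlMr// mulrC ler_pdivrMr//.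
  have -> : y = u + z by rewrite /u; ring.
  have := sqr_ge0 (u - z); have := sqr_ge0 u; have := sqr_ge0 z.
  have := mulr_ge0 (sqr_ge0 u) (sqr_ge0 z); nra.
apply: (@le_trans _ _ ((1 + u ^+ 2) ^+ m * B *
    (expR (- (eta ^+ 2 / (10 * t))) * expR (- (1 / 20 * u ^+ 2))))).
  apply: ler_pM; rewrite ?mulr_ge0 ?normc_ge0//.
    by apply: ler_pM.
  exact: G_far.
rewrite [leLHS](_ : _ = B * expR (- (eta ^+ 2 / (10 * t))) *
    ((1 + u ^+ 2) ^+ m * expR (- (1 / 20 * u ^+ 2)))); last by ring.
rewrite [leRHS](_ : _ = B * expR (- (eta ^+ 2 / (10 * t))) *
    (C * ((2 + 2 * z ^+ 2) * (1 + y ^+ 2)^-1))); last by ring.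
rewrite ler_wpM2l ?mulr_ge0// (le_trans hCu)// ler_wpM2l// ltW//.
Qed.

Let cderive_G t ze xi y : 0 < t ->
  cderive (G t ze xi) y (('i * xi%:C - (y%:C - ze) / (2 * t)%:C) * G t ze xi y).
Proof.
move=> t0; apply: cderive_cexp.
have E4 : ((4 * t)%:C)^-1 = (((4 * t)^-1)%:C : R[i]) by rewrite -fmorphV.
have E2 : ((2 * t)%:C)^-1 = (((2 * t)^-1)%:C : R[i]) by rewrite -fmorphV.
rewrite E4 E2.
case: ze => a b; split.
  have -> : (fun y : R => Re ('i * xi%:C * y%:C - (y%:C - (a +i* b)) ^+ 2 * ((4 * t)^-1)%:C)) =
      (fun y : R => (- (4 * t)^-1) * y ^+ 2 + (2 * a * (4 * t)^-1) * y + (b ^+ 2 - a ^+ 2) * (4 * t)^-1).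
    by apply/funext => w; rewrite expr2 !cReImE/=; ring.
  apply: (is_derive_cst_eq (is_derive_quad _ _ _ y)).
  by rewrite !cReImE/=; field; lra.
have -> : (fun y : R => Im ('i * xi%:C * y%:C - (y%:C - (a +i* b)) ^+ 2 * ((4 * t)^-1)%:C)) =
    (fun y : R => 0 * y ^+ 2 + (xi + 2 * b * (4 * t)^-1) * y + (- 2 * a * b * (4 * t)^-1)).
  by apply/funext => w; rewrite expr2 !cReImE/=; ring.
apply: (is_derive_cst_eq (is_derive_quad _ _ _ y)).
by rewrite !cReImE/=; field; lra.
Qed.

Let cderive_K m j t ze xi y : 0 < t ->
  cderive (K m j t ze xi) y
   (m%:R * K m.-1 j t ze xi y + K m j.+1 t ze xi y + 'i * xi%:C * K m j t ze xi y
    - ((2 * t)^-1)%:C * (K m.+1 j t ze xi y - (ze - z%:C) * K m j t ze xi y)).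
Proof.
move=> t0.
have d1 : is_derive y 1 (fun y : R => (y - z) ^+ m) (m%:R * (y - z) ^+ m.-1).
  have h : is_derive y 1 (fun y : R => y - z) 1.
    by apply: is_derive_eq; rewrite subr0.
  by apply: (is_derive_cst_eq (is_derive_pow m h)); rewrite mulr1.
have d2 := cderive_real (is_derive_M d1 (dPsi j y)).
apply: (cderive_eq (cderiveM d2 (cderive_G ze xi y t0))).
rewrite /K.
have -> : m%:R = (m%:R : R)%:C :> R[i] by rewrite rmorph_nat.
have -> : ((2 * t)%:C)^-1 = (((2 * t)^-1)%:C : R[i]) by rewrite -fmorphV.
rewrite !(rmorphM, rmorphD, rmorphXn, exprS, rmorphB)/=; ring.
Qed.

Let ccont_K m j t ze xi : 0 < t -> ccont (K m j t ze xi).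
Proof. by move=> t0; apply: cderive_ccont => y; exact: cderive_K. Qed.

Lemma truncated_gaussian_cinteg m j t ze xi : 0 < t -> t <= 2 -> normc (ze - z%:C) <= de ->
  cinteg L (K m j t ze xi).
Proof.
move=> t0 t2 hz; have [C C0 hC] := K_le m j.
apply: (@cinteg_le _ (measurableTypeR R) R L _ (fun y : R => C * expR (- (eta ^+ 2 / (10 * t))) * (1 + y ^+ 2)^-1)).
- by apply: ccont_cmeas; exact: ccont_K.
- by move=> y; exact: hC.
- by apply: rintegZ; exact: rinteg_oneDsqrV.
Qed.

Let K_ibp m j t ze xi : 0 < t -> t <= 2 -> normc (ze - z%:C) <= de ->
  'i * xi%:C * cint L (K m j t ze xi) =
   ((2 * t)^-1)%:C * (cint L (K m.+1 j t ze xi) - (ze - z%:C) * cint L (K m j t ze xi))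
   - m%:R * cint L (K m.-1 j t ze xi) - cint L (K m j.+1 t ze xi).
Proof.
move=> t0 t2 hz.
have iK m' j' := @truncated_gaussian_cinteg m' j' t ze xi t0 t2 hz.
pose c1 := 'i * xi%:C + ((2 * t)^-1)%:C * (ze - z%:C).
pose c2 := - ((2 * t)^-1)%:C : R[i].
pose f' y := m%:R * K m.-1 j t ze xi y + (K m j.+1 t ze xi y +
  (c1 * K m j t ze xi y + c2 * K m.+1 j t ze xi y)).
have df y : cderive (K m j t ze xi) y (f' y).
  by apply: (cderive_eq (cderive_K m j ze xi y t0)); rewrite /f' /c1 /c2; ring.
suff : cint L f' = 0.
  rewrite /f' cintD ?cintD ?cintZ//; try (by repeat (first [exact: iK|apply: cintegZ|apply: cintegD])).
  rewrite /c1 /c2 => h.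
  apply/eqP; rewrite -subr_eq0 -{}h; apply/eqP; ring.
have [C1 C10 h1] := K_le m.-1 j; have [C2 C20 h2] := K_le m j.+1.
have [C3 C30 h3] := K_le m j; have [C4 C40 h4] := K_le m.+1 j.
set e := expR (- (eta ^+ 2 / (10 * t))).
have e0 : 0 <= e by exact: expR_ge0.
have cc1 := normc_ge0 c1; have cc2 := normc_ge0 c2.
apply: (@cint_derive0 _ _ _ ((m%:R * C1 + C2 + (normc c1 + 1) * C3 + normc c2 * C4) * e) df).
- by apply: ccontD; [|apply: ccontD; [|apply: ccontD]]; try apply: ccontZ; exact: ccont_K.
- move=> y; rewrite (le_trans (h3 _ _ xi y t0 t2 hz))// -/e.
  rewrite ler_wpM2r ?invr_ge0 ?addr_ge0 ?sqr_ge0// ler_wpM2r//.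
  have := ler0n R m; nra.
- move=> y; have w0 : 0 <= (1 + y ^+ 2)^-1 by rewrite invr_ge0 addr_ge0// sqr_ge0.
  have {}h1 := h1 t ze xi y t0 t2 hz; have {}h2 := h2 t ze xi y t0 t2 hz.
  have {}h3 := h3 t ze xi y t0 t2 hz; have {}h4 := h4 t ze xi y t0 t2 hz.
  rewrite /f' (le_trans (le_normcD _ _))// (le_trans (lerD (lexx _) (le_normcD _ _)))//.
  rewrite (le_trans (lerD (lexx _) (lerD (lexx _) (le_normcD _ _))))//.
  have -> : m%:R = (m%:R : R)%:C :> R[i] by rewrite rmorph_nat.
  rewrite (normcM (m%:R : R)%:C) (normcM c1) (normcM c2) normc_real ger0_norm//.
  have H1 := ler_wpM2l (ler0n R m) h1.
  have H3 := ler_wpM2l cc1 h3; have H4 := ler_wpM2l cc2 h4.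
  apply: (le_trans (lerD H1 (lerD h2 (lerD H3 H4)))).
  rewrite -/e; have : 0 <= C3 * e * (1 + y ^+ 2)^-1 by rewrite !mulr_ge0.
  lra.
Qed.

(* Each integration by parts gains a factor 1/xi and costs a power of 1/t, which is
   absorbed by exp(- c / t) since Psi vanishes near z. *)
Lemma truncated_gaussian_decay k m j : exists2 C, 0 <= C & forall t ze xi,
  0 < t -> t <= 2 -> normc (ze - z%:C) <= de ->
  `|xi| ^+ k * normc (cint L (K m j t ze xi)) <=
    C * t^-1 ^+ k * expR (- (eta ^+ 2 / (10 * t))).
Proof.
elim: k m j => [|k IH] m j.
  have [C C0 hC] := K_le m j.
  exists (C * \int[L]_y (1 + y ^+ 2)^-1).
    rewrite mulr_ge0//; apply: Rintegral_ge0 => y _; rewrite invr_ge0; have := sqr_ge0 y; lra.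
  move=> t ze xi t0 t2 hz; rewrite expr0 mul1r expr0 mulr1 mulrAC.
  rewrite -(rintZl _ (rinteg_oneDsqrV)).
  apply: le_normc_cint.
  - by apply: ccont_cmeas; exact: ccont_K.
  - by move=> y; exact: hC.
  - by apply: rintegZ; exact: rinteg_oneDsqrV.
have [C1 C10 h1] := IH m.+1 j; have [C2 C20 h2] := IH m j.
have [C3 C30 h3] := IH m.-1 j; have [C4 C40 h4] := IH m j.+1.
exists (C1 + de * C2 + 2 * (m%:R * C3) + 2 * C4).
  by rewrite !addr_ge0// !mulr_ge0.
move=> t ze xi t0 t2 hz.
have {}h1 := h1 t ze xi t0 t2 hz; have {}h2 := h2 t ze xi t0 t2 hz.
have {}h3 := h3 t ze xi t0 t2 hz; have {}h4 := h4 t ze xi t0 t2 hz.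
set e := expR _ in h1 h2 h3 h4 *; have e0 : 0 <= e by exact: expR_ge0.
have -> : `|xi| ^+ k.+1 * normc (cint L (K m j t ze xi)) =
  `|xi| ^+ k * normc ('i * xi%:C * cint L (K m j t ze xi)).
  by rewrite !normcM normc_i mul1r normc_real exprSr mulrA.
rewrite K_ibp//.
set k1 := cint L (K m.+1 j t ze xi) in h1 *; set k2 := cint L (K m j t ze xi) in h2 *.
set k3 := cint L (K m.-1 j t ze xi) in h3 *; set k4 := cint L (K m j.+1 t ze xi) in h4 *.
have nb : normc (((2 * t)^-1)%:C * (k1 - (ze - z%:C) * k2) - m%:R * k3 - k4) <=
    (2 * t)^-1 * (normc k1 + de * normc k2) + m%:R * normc k3 + normc k4.
  rewrite (le_trans (le_normcD _ _))// normcN lerD2r.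
  rewrite (le_trans (le_normcD _ _))// normcN.
  have -> : m%:R * k3 = (m%:R : R)%:C * k3 by rewrite rmorph_nat.
  rewrite !normcM !normc_real (ger0_norm (ler0n _ _)) lerD2r.
  rewrite ger0_norm ?invr_ge0 ?mulr_ge0 ?(ltW t0)// ler_wpM2l ?invr_ge0 ?mulr_ge0 ?(ltW t0)//.
  rewrite (le_trans (le_normcD _ _))// normcN normcM lerD2l.
  by rewrite ler_wpM2r ?normc_ge0.
set x := `|xi| ^+ k in h1 h2 h3 h4 *; have x0 : 0 <= x by rewrite exprn_ge0.
apply: (le_trans (ler_wpM2l x0 nb)).
set T := t^-1 ^+ k in h1 h2 h3 h4 *; have T0 : 0 <= T by rewrite exprn_ge0// invr_ge0 ltW.
rewrite exprS -/T.
have s0 : 2^-1 <= t^-1 by rewrite ler_pV2// ?inE ?unitfE ?gt_eqF//=.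
set s := t^-1 in s0 *.
have -> : (2 * t)^-1 = s / 2 by rewrite invfM mulrC.
exact: decay_step.
Qed.

End truncated_gaussian.

(** * Smooth cutoffs *)

Section differentiability_class.
Context {R : realType}.
Implicit Types (f g h : R -> R) (k : nat).

(** [k] times differentiable, without continuity of the last derivative; imposed for all [k] at
    once, this is smoothness. The derivative is quantified existentially, so that a closure property
    is proved by exhibiting a formula. *)
Fixpoint Cn k h : Prop := if k is k'.+1 then
  exists2 h' : R -> R, (forall x : R, is_derive x 1 h (h' x)) & Cn k' h' else True.

Definition Coo h := forall k, Cn k h.

Lemma CnW k h : Cn k.+1 h -> Cn k h.
Proof. by elim: k h => // k IH h [h' dh Ch']; exists h' => //; exact: IH. Qed.

Lemma CnD k f g : Cn k f -> Cn k g -> Cn k (fun x => f x + g x).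
Proof.
elim: k f g => // k IH f g [f' df Cf] [g' dg Cg].
exists (fun x => f' x + g' x); last exact: IH.
by move=> x; exact: is_derive_D.
Qed.

Lemma CnM k f g : Cn k f -> Cn k g -> Cn k (fun x => f x * g x).
Proof.
elim: k f g => // k IH f g Cf Cg.
have [f' df Cf'] := Cf; have [g' dg Cg'] := Cg.
exists (fun x => f' x * g x + f x * g' x).
  by move=> x; exact: (is_derive_M (df x) (dg x)).
by apply: CnD; apply: IH => //; exact: CnW.
Qed.

Lemma Cn_cst k (c : R) : Cn k (fun=> c).
Proof.
by elim: k c => // k IH c; exists (fun=> 0) => // x; exact: is_derive_cst.
Qed.

Lemma Cn_affine k h a b : Cn k h -> Cn k (fun x => h (a * x + b)).
Proof.
elim: k h => // k IH h [h' dh Ch'].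
exists (fun x => h' (a * x + b) * a); last first.
  by apply: CnM; [exact: IH|exact: Cn_cst].
move=> x; have da : is_derive x 1 (fun x : R => a * x + b) a.
  by apply: is_derive_eq; rewrite /GRing.scale/=; ring.
exact: (is_derive1_comp (dh _) da).
Qed.

Lemma Cn_id k : Cn k id.
Proof. by case: k => // k; exists (fun=> 1); [move=> x; exact: is_derive_id|exact: Cn_cst]. Qed.

Lemma Cn_inv k h : (forall x, h x != 0) -> Cn k h -> Cn k (fun x => (h x)^-1).
Proof.
move=> h0; elim: k => // k IH Ch; have [h' dh Ch'] := Ch.
exists (fun x => (- 1) * ((h x)^-1 * ((h x)^-1 * h' x))); last first.
  by do 3 (apply: CnM; [by [exact: Cn_cst|apply: IH; exact: CnW]|]).
move=> x; apply: (is_derive_cst_eq (is_deriveV (h0 x) (dh x))).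
by rewrite /GRing.scale/=; field.
Qed.

Lemma Cn_expR k h : Cn k h -> Cn k (fun x => expR (h x)).
Proof.
elim: k h => // k IH h Ch; have [h' dh Ch'] := Ch.
exists (fun x => expR (h x) * h' x); last by apply: CnM => //; apply: IH; exact: CnW.
by move=> x; exact: is_derive_expR_comp.
Qed.

Lemma Cn_cos_sin k h : Cn k h ->
  Cn k (fun x => cos (h x)) /\ Cn k (fun x => sin (h x)).
Proof.
elim: k h => // k IH h Ch; have [h' dh Ch'] := Ch.
have [c s] := IH _ (CnW Ch); split.
  exists (fun x => (-1) * sin (h x) * h' x).
    by move=> x; apply: (is_derive_cst_eq (is_derive_cos_comp (dh x))); rewrite mulN1r.
  by apply: CnM => //; apply: CnM => //; exact: Cn_cst.
exists (fun x => cos (h x) * h' x); last exact: CnM.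
by move=> x; exact: is_derive_sin_comp.
Qed.

Lemma Coo_derive h : Coo h ->
  (forall x : R, is_derive x 1 h (derive1 h x)) /\ Coo (derive1 h).
Proof.
move=> Ch.
have E k : Cn k.+1 h -> (forall x : R, is_derive x 1 h (derive1 h x)) /\ Cn k (derive1 h).
  move=> [h' dh Ch'].
  have -> : derive1 h = h'.
    by apply/funext => x; rewrite derive1E; exact: (@derive_val _ _ _ _ _ _ _ (dh x)).
  by [].
split; first exact: (E 0%N (Ch 1%N)).1.
by move=> k; exact: (E k (Ch k.+1)).2.
Qed.

(** Presents smoothness as one sequence of successive derivatives, the form that repeated
    integration by parts consumes. *)
Lemma Coo_seq h : Coo h -> exists H : nat -> R -> R, H 0%N = h /\
  forall j (y : R), is_derive y 1 (H j) (H j.+1 y).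
Proof.
move=> Ch; exists (fun j => iter j (@derive1 R R) h); split => // j y.
have : Coo (iter j (@derive1 R R) h) by elim: j => //= j IH; exact: (Coo_derive IH).2.
by move=> /Coo_derive[].
Qed.

End differentiability_class.

Section cutoff.
Context {R : realType}.

(* This class of functions is closed under differentiation and contains exp(- 1 / x). *)
Definition theta (P : {poly R}) (x : R) : R :=
  if 0 < x then P.[x^-1] * expR (- x^-1) else 0.

Let poly_le_expR (P : {poly R}) m : exists2 C : R, 0 <= C & forall y, 0 < y ->
  `|P.[y]| * y ^+ m <= C * expR y.
Proof.
elim/poly_ind: P m => [|P c IH] m.
  by exists 0 => // y _; rewrite horner0 normr0 !mul0r.
have [C C0 hC] := IH m.+1; exists (C + `|c| * m`!%:R).
  by rewrite addr_ge0// mulr_ge0.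
move=> y y0; rewrite hornerMXaddC mulrDl.
rewrite (le_trans (ler_wpM2r _ (ler_normD _ _))) ?exprn_ge0 ?(ltW y0)//.
rewrite mulrDl; apply: lerD.
  by have := hC y y0; rewrite normrM (gtr0_norm y0) exprS mulrA.
rewrite -mulrA ler_wpM2l//; apply: exprn_le_expR; exact: ltW.
Qed.

Let theta_le P : exists2 C : R, 0 <= C & forall x, `|theta P x| <= C * `|x|.
Proof.
have [C C0 hC] := poly_le_expR P 1; exists C => // x.
rewrite /theta; case: ltP => x0; last by rewrite normr0 mulr_ge0.
have xV0 : 0 < x^-1 by rewrite invr_gt0.
have := hC _ xV0; rewrite expr1 -ler_pdivlMr// invrK => h.
rewrite normrM (gtr0_norm x0) (ger0_norm (expR_ge0 _)).
rewrite (le_trans (ler_wpM2r (expR_ge0 _) h))// mulrAC -(mulrA C) -expRD subrr expR0 mulr1//.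
Qed.

(** For x > 0 the chain rule applied to P(1/x) exp(- 1/x) gives the factor (P - P')(1/x) / x^2; only
    the point 0 needs an argument. *)
Lemma is_derive_theta (P : {poly R}) (x : R) :
  is_derive x 1 (theta P) (theta ('X ^+ 2 * (P - P^`())) x).
Proof.
have [x0|x0|->] := ltgtP x 0.
- rewrite [X in is_derive _ _ _ X]/theta ltNge (ltW x0)/=.
  apply: (@near_eq_is_derive _ _ _ (cst 0) _ _ _ _ _ (is_derive_cst (0 : R) x 1)).
  near=> y; rewrite /theta ltNge ifF//; apply/negbTE; rewrite negbK.
  by apply: ltW; near: y; exact: lt_nbhsl.
- have xn : x != 0 by rewrite gt_eqF.
  have dinv : is_derive x 1 (fun y : R => y^-1) (- x ^- 2).
    apply: (is_derive_cst_eq (is_deriveV (f := id) xn (is_derive_id x 1))).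
    by rewrite /GRing.scale/= mulr1.
  have dP : is_derive (x^-1) 1 (horner P) (P^`()).[x^-1].
    apply: DeriveDef; first exact: derivable_horner.
    by rewrite -derive1E derivE.
  have d1 := is_derive1_comp dP dinv.
  have d2 := is_derive_expR_comp (is_deriveN dinv).
  apply: (near_eq_is_derive (f := fun y : R => P.[y^-1] * expR (- y^-1))).
    near=> y; rewrite /theta ifT//.
    by near: y; exact: lt_nbhsr.
  apply: (is_derive_cst_eq (is_derive_M d1 d2)).
  rewrite /theta x0 hornerM hornerXn hornerD hornerN exprVn !fctE/=; ring.
(* The difference quotient at 0 is thus [theta ('X * P)], which is O(|h|) by [theta_le]. *)
- have tx y : theta P y = y * theta ('X * P) y.
    rewrite /theta; case: ltP => y0; last by rewrite mulr0.
    by rewrite hornerM hornerX !mulrA divff ?mul1r// gt_eqF.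
  have [C C0 hC] := theta_le ('X * P).
  have lim : h^-1 *: (theta P (h *: (1 : R) + 0) - theta P 0) @[h --> 0^'] --> (0 : R).
    apply: norm_cvg0; apply: (@squeeze_cvgr _ _ _ _ (fun=> 0) (fun h : R => C * `|h|)).
    + near=> h; rewrite normr_ge0/=.
      have h0 : h != 0 by near: h; exact: nbhs_dnbhs_neq.
      rewrite addr0 [h *: 1]mulr1 [theta P 0]/theta ltxx subr0 tx.
      by rewrite /GRing.scale/= mulKf.
    + exact: cvg_cst.
    + rewrite -[X in _ --> X](mulr0 C); apply: cvgMr.
      have : (`|h|) @[h --> (0 : R)] --> `|0 : R| by exact: norm_continuous.
      by rewrite normr0; exact: cvg_within_filter.
  rewrite [X in is_derive _ _ _ X]/theta ltxx; apply: DeriveDef.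
    by apply/cvg_ex; exists 0.
  exact: (cvg_lim _ lim).
Unshelve. all: by end_near. Qed.

Lemma Coo_theta P : Coo (theta P).
Proof.
move=> k; elim: k P => // k IH P.
by exists (theta ('X ^+ 2 * (P - P^`()))) => // x; exact: is_derive_theta.
Qed.

Let den (x : R) := theta 1 x + theta 1 (1 - x).

Let theta1_ge0 x : 0 <= theta 1 x.
Proof. by rewrite /theta; case: ifP => // _; rewrite hornerC mul1r expR_ge0. Qed.

Let theta1_gt0 x : 0 < x -> 0 < theta 1 x.
Proof. by move=> x0; rewrite /theta x0 hornerC mul1r expR_gt0. Qed.

Let den_gt0 x : 0 < den x.
Proof.
rewrite /den; have [x0|x0] := ltP 0 x.
  by rewrite ltr_wpDr// theta1_gt0.
by rewrite ltr_wpDl// theta1_gt0//; lra.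
Qed.

Definition smooth_step (x : R) : R := theta 1 x * (theta 1 x + theta 1 (1 - x))^-1.

Lemma smooth_step_le0 x : x <= 0 -> smooth_step x = 0.
Proof. by move=> x0; rewrite /smooth_step {1}/theta ltNge x0 mul0r. Qed.

Lemma smooth_step_ge1 x : 1 <= x -> smooth_step x = 1.
Proof.
move=> x1; rewrite /smooth_step {3}/theta ifF; last by apply/negbTE; rewrite -leNgt; lra.
by rewrite addr0 divff// gt_eqF// theta1_gt0//; lra.
Qed.

Lemma Coo_smooth_step : Coo smooth_step.
Proof.
move=> k; apply: CnM; first exact: Coo_theta.
apply: Cn_inv; first by move=> x; rewrite gt_eqF//; exact: den_gt0.
apply: CnD; first exact: Coo_theta.
have := Cn_affine (-1) 1 (@Coo_theta 1 k).
by congr Cn; apply/funext => x; congr theta; ring.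
Qed.

(** The arguments are 2 + (y - z) / eta and 2 - (y - z) / eta, written in the affine form of
    [Cn_affine]: both are at least 1 for |y - z| < eta, and one of them is at most 0 for |y - z| >=
    2 eta. *)
Definition cutoff (z eta y : R) : R :=
  smooth_step (eta^-1 * y + (2 - z / eta)) * smooth_step (- eta^-1 * y + (2 + z / eta)).

Lemma Coo_cutoff z eta : Coo (cutoff z eta).
Proof. by move=> k; apply: CnM; apply: Cn_affine; exact: Coo_smooth_step. Qed.

Lemma cutoff_eq1 z eta y : 0 < eta -> `|y - z| < eta -> cutoff z eta y = 1.
Proof.
move=> eta0; rewrite ltr_norml => /andP[h1 h2].
have e : eta * eta^-1 = 1 by rewrite divff// gt_eqF.
have i0 : 0 < eta^-1 by rewrite invr_gt0.
rewrite /cutoff !smooth_step_ge1 ?mulr1//; nra.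
Qed.

Lemma cutoff_eq0 z eta y : 0 < eta -> 2 * eta <= `|y - z| -> cutoff z eta y = 0.
Proof.
move=> eta0; rewrite ler_normr => hy.
have e : eta * eta^-1 = 1 by rewrite divff// gt_eqF.
have i0 : 0 < eta^-1 by rewrite invr_gt0.
have [yz|yz] := leP z y.
  have {}hy : 2 * eta <= y - z by move: hy => /orP[]; lra.
  by rewrite /cutoff (smooth_step_le0 (x := - _ * _ + _)) ?mulr0//; nra.
have {}hy : y - z <= - (2 * eta) by move: hy => /orP[]; lra.
by rewrite /cutoff smooth_step_le0 ?mul0r//; nra.
Qed.

End cutoff.

Section cutoff_derivatives.
Context {R : realType}.

Lemma is_derive_locally_cst (f : R -> R) (x a c : R) (U : set R) : open U -> U x ->
  (forall y, U y -> f y = c) -> is_derive x 1 f a -> a = 0.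
Proof.
move=> oU Ux fU df.
have h : is_derive x 1 f 0.
  apply: (@near_eq_is_derive _ _ _ (cst c) _ _ _ _ _ (is_derive_cst c x 1)).
  by apply: (filterS _ (open_nbhs_nbhs (conj oU Ux))) => y /fU ->.
by rewrite -(@derive_val _ _ _ _ _ _ _ df) (@derive_val _ _ _ _ _ _ _ h).
Qed.

(** The function is constant for |y - z| < eta and for |y - z| > 2 eta, so its derivatives vanish on
    these open sets; each derivative is then bounded by its maximum on a compact interval. *)
Lemma cutoff_seq (z eta : R) : 0 < eta -> exists Psi : nat -> R -> R,
  [/\ Psi 0%N = (fun y => 1 - cutoff z eta y),
      forall j (y : R), is_derive y 1 (Psi j) (Psi j.+1 y),
      forall j y, `|y - z| < eta -> Psi j y = 0 &
      forall j, exists B : R, forall y, `|Psi j y| <= B].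
Proof.
move=> eta0.
have C0 : Coo (fun y => 1 - cutoff z eta y).
  move=> k; have := CnD (Cn_cst k 1) (CnM (Cn_cst k (-1)) (Coo_cutoff z eta k)).
  by congr Cn; apply/funext => y; rewrite mulN1r.
have [Psi [P0 dP]] := Coo_seq C0; exists Psi.
have cabs : continuous (fun y : R => `|y - z|).
  move=> y; apply: (@continuous_comp _ _ _ (fun y => y - z) (@Num.norm _ R)).
    by apply: cvgB; [exact: cvg_id|exact: cvg_cst].
  exact: norm_continuous.
have oin : open [set y : R | `|y - z| < eta].
  by have := open_comp (fun y _ => cabs y) (@open_lt R eta).
have oout : open [set y : R | 2 * eta < `|y - z|].
  by have := open_comp (fun y _ => cabs y) (@open_gt R (2 * eta)).
have van j y : `|y - z| < eta -> Psi j y = 0.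
  elim: j y => [|j IH] y hy; first by rewrite P0 cutoff_eq1// subrr.
  by apply: (is_derive_locally_cst oin hy _ (dP j y)) => w hw; exact: IH.
have far j y : 2 * eta < `|y - z| -> Psi j y = (j == 0%N)%:R.
  elim: j y => [|j IH] y hy; first by rewrite P0 cutoff_eq0 ?subr0// ltW.
  exact: (is_derive_locally_cst oout hy IH (dP j y)).
split => // j.
have cPj : {within `[z - 2 * eta, z + 2 * eta], continuous (fun y => `|Psi j y|)}.
  apply: continuous_subspaceT => y.
  apply: (@continuous_comp _ _ _ (Psi j) (@Num.norm _ R)); last exact: norm_continuous.
  exact: (derive_continuous (dP j)).
have zz : z - 2 * eta <= z + 2 * eta by lra.
have [c _ hc] := EVT_max zz cPj.
(* The summand 1 covers the value 1 of [Psi 0] far from z. *)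
exists (`|Psi j c| + 1) => y; have [hy|hy] := leP `|y - z| (2 * eta).
  rewrite (le_trans (hc y _)) ?lerDl// in_itv/=.
  by move: hy; rewrite ler_norml => /andP[? ?]; apply/andP; split; lra.
by rewrite far// normr_nat; case: (j == _); rewrite ?lerDr// addr_ge0.
Qed.

End cutoff_derivatives.

Section smooth_functions.
Context {R : realType} {n : nat}.
Notation E := 'rV[R]_n.
Local Open Scope complex_scope.
Implicit Types (g : E -> R) (k : nat).

(** Continuity is required at each level because in several variables it does not follow from the
    existence of partial derivatives. *)
Fixpoint nCn k g : Prop := continuous g /\
  if k is k'.+1 then (forall i x, derivable g x (delta_mx 0 i)) /\
    forall i, nCn k' (partial i g) else True.

Lemma nCn_smooth g : (forall k, nCn k g) -> smooth g.
Proof.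
move=> Cg s.
have H k : nCn k (foldr (@partial R n) g s).
  elim: s k => [|i s IH] k //=.
  by have [_ [_]] := IH k.+1; apply.
by have [c [d _]] := H 1%N; split.
Qed.

Lemma nCnW k g : nCn k.+1 g -> nCn k g.
Proof.
elim: k g => [|k IH] g [cg [dg pg]]; split => //; split => // i.
exact: IH.
Qed.

Lemma nCnD k g1 g2 : nCn k g1 -> nCn k g2 -> nCn k (fun x => g1 x + g2 x).
Proof.
elim: k g1 g2 => [|k IH] g1 g2.
  by move=> [c1 _] [c2 _]; split => // x; exact: (continuousD (c1 x) (c2 x)).
move=> [c1 [d1 p1]] [c2 [d2 p2]]; split.
  by move=> x; exact: (continuousD (c1 x) (c2 x)).
split=> [i x|i]; first exact: derivableD.
suff -> : partial i (fun x => g1 x + g2 x) = fun x => partial i g1 x + partial i g2 x.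
  exact: (IH _ _ (p1 i) (p2 i)).
by apply/funext => x; exact: deriveD.
Qed.

Lemma nCnM k g1 g2 : nCn k g1 -> nCn k g2 -> nCn k (fun x => g1 x * g2 x).
Proof.
elim: k g1 g2 => [|k IH] g1 g2.
  by move=> [c1 _] [c2 _]; split => // x; exact: (continuousM (c1 x) (c2 x)).
move=> C1 C2; have [c1 [d1 p1]] := C1; have [c2 [d2 p2]] := C2; split.
  by move=> x; exact: (continuousM (c1 x) (c2 x)).
split=> [i x|i]; first exact: derivableM.
suff -> : partial i (fun x => g1 x * g2 x) =
    fun x => partial i g1 x * g2 x + g1 x * partial i g2 x.
  exact: (nCnD (IH _ _ (p1 i) (nCnW C2)) (IH _ _ (nCnW C1) (p2 i))).
apply/funext => x; rewrite /partial.
by rewrite (_ : (fun x => g1 x * g2 x) = g1 \* g2)// deriveM// addrC /GRing.scale/= mulrC.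
Qed.

Lemma nCn_cst k (c : R) : nCn k (fun=> c).
Proof.
elim: k c => [|k IH] c; first by split => //; exact: cst_continuous.
split; first exact: cst_continuous.
split=> [i x|i]; first exact: derivable_cst.
suff -> : partial i (fun=> c) = fun=> 0 by exact: IH.
by apply/funext => x; exact: derive_cst.
Qed.

Lemma is_derive_coord (h h' : R -> R) (i j : 'I_n) (x : E) :
  (forall y : R, is_derive y 1 h (h' y)) ->
  is_derive x (delta_mx 0 j) (fun y : E => h (y 0 i)) (if i == j then h' (x 0 i) else 0).
Proof.
move=> dh; case: eqVneq => [->|ij].
  have E1 : (fun t : R => t^-1 *: (h ((t *: delta_mx 0 j + x : E) 0 j) - h (x 0 j))) =
            (fun t : R => t^-1 *: (h (t *: (1 : R) + x 0 j) - h (x 0 j))).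
    by apply/funext => t; rewrite !mxE !eqxx.
  have [d1 d2] := dh (x 0 j).
  apply: DeriveDef; first by move: d1; rewrite /derivable E1.
  by move: d2; rewrite /derive E1.
have E1 : (fun t : R => t^-1 *: (h ((t *: delta_mx 0 j + x : E) 0 i) - h (x 0 i))) = cst (0 : R).
  by apply/funext => t; rewrite !mxE eqxx (negbTE ij)/= mulr0 add0r subrr scaler0.
apply: DeriveDef; first by rewrite /derivable E1; exact: is_cvg_cst.
by rewrite /derive E1; exact: lim_cst.
Qed.

Lemma nCn_coord k (h : R -> R) (i : 'I_n) : Coo h -> nCn k (fun y : E => h (y 0 i)).
Proof.
elim: k h => [|k IH] h Ch; have [dh Ch'] := Coo_derive Ch.
  split => // x; apply: (@continuous_comp _ _ _ (fun y : E => y 0 i) h).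
    exact: coord_continuous.
  exact: (derive_continuous dh).
have dc j x := is_derive_coord i j x dh.
split.
  move=> x; apply: (@continuous_comp _ _ _ (fun y : E => y 0 i) h).
    exact: coord_continuous.
  exact: (derive_continuous dh).
split=> [j x|j]; first by have [] := dc j x.
have -> : partial j (fun y : E => h (y 0 i)) =
    fun y : E => if i == j then derive1 h (y 0 i) else 0.
  by apply/funext => x; have [_ <-] := dc j x.
by case: eqP => _; [exact: IH|exact: nCn_cst].
Qed.

Definition ncCn k (phi : E -> R[i]) :=
  nCn k (fun x => Re (phi x)) /\ nCn k (fun x => Im (phi x)).

Lemma ncCnM k (f g : E -> R[i]) : ncCn k f -> ncCn k g -> ncCn k (fun x => f x * g x).
Proof.
move=> [f1 f2] [g1 g2]; split.
  have := nCnD (nCnM f1 g1) (nCnM (nCn_cst k (-1)) (nCnM f2 g2)).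
  by congr nCn; apply/funext => x; rewrite cReImE mulN1r.
have := nCnD (nCnM f1 g2) (nCnM f2 g1).
by congr nCn; apply/funext => x; rewrite cReImE.
Qed.

Lemma ncCn_prod k (c : 'I_n -> R -> R[i]) :
  (forall i, Coo (fun y => Re (c i y)) /\ Coo (fun y => Im (c i y))) ->
  ncCn k (fun x : E => \prod_i c i (x 0 i)).
Proof.
move=> Cc.
have H (s : seq 'I_n) : ncCn k (fun x : E => \prod_(i <- s) c i (x 0 i)).
  elim: s => [|i s IH].
    under eq_fun do rewrite big_nil.
    by split; exact: nCn_cst.
  under eq_fun do rewrite big_cons.
  apply: ncCnM => //; split.
    exact: (@nCn_coord k (fun y => Re (c i y)) i (Cc i).1).
  exact: (@nCn_coord k (fun y => Im (c i y)) i (Cc i).2).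
exact: H.
Qed.

Lemma test_function_prod (c : 'I_n -> R -> R[i]) (a b : 'I_n -> R) (Omega : set E) :
  (forall i, Coo (fun y => Re (c i y)) /\ Coo (fun y => Im (c i y))) ->
  (forall i y, ~ (a i <= y <= b i) -> c i y = 0) ->
  [set x : E | forall i, a i <= x 0 i <= b i] `<=` Omega ->
  test_function Omega (fun x => \prod_i c i (x 0 i)).
Proof.
move=> Cc c0 QO; set Q := [set x : E | forall i, a i <= x 0 i <= b i] in QO.
have cQ : compact Q.
  have := @rV_compact R n (fun i => `[a i, b i]%classic) (fun i => @segment_compact R _ _).
  by congr compact; apply/seteqP; split => x /= h i; have := h i; rewrite in_itv.
have clQ : closed Q by apply: compact_closed => //; exact: norm_hausdorff.
have sub : closure [set x : E | \prod_i c i (x 0 i) != 0] `<=` Q.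
  move=> x cx; apply: clQ; move: x cx; apply: closure_subset => x /= xne i.
  apply: contrapT => /c0 ci0; move/negP: xne; apply.
  by rewrite (bigD1 i)//= ci0 mul0r.
split.
- by apply: nCn_smooth => k; exact: (ncCn_prod k Cc).1.
- by apply: nCn_smooth => k; exact: (ncCn_prod k Cc).2.
- apply: (subclosed_compact _ cQ sub); exact: closed_closure.
- exact: subset_trans QO.
Qed.

End smooth_functions.

(** * Bound for the heat extension of the fractional Laplacian *)

Section real_bounds.
Context {R : realType}.

Lemma inv_pow_exp_le (m : nat) (c t : R) : 0 < c -> 0 < t ->
  t^-1 ^+ m * expR (- (c / t)) <= m`!%:R * c^-1 ^+ m.
Proof.
move=> c0 t0; rewrite expRN ler_pdivrMr ?expR_gt0//.
have ct : 0 <= c / t by rewrite divr_ge0// ltW.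
have := exprn_le_expR m ct; rewrite exprMn => h.
by rewrite mulrAC (exprVn c) ler_pdivlMr ?exprn_gt0// mulrC.
Qed.

(** The factors are exchanged one at a time, n times in all. Assuming 1 <= A allows the cruder power
    A^n in place of A^(n-1). *)
Lemma prodc_sub_le n (a b : 'I_n -> R[i]) (w : 'I_n -> R) (A ep : R) :
  1 <= A -> 0 <= ep -> (forall i, 0 <= w i) ->
  (forall i, normc (a i) <= A * w i) -> (forall i, normc (b i) <= A * w i) ->
  (forall i, normc (a i - b i) <= ep * w i) ->
  normc (\prod_i a i - \prod_i b i) <= n%:R * A ^+ n * ep * \prod_i w i.
Proof.
move=> A1 ep0; have A0 : 0 <= A by lra.
elim: n a b w => [|n IH] a b w w0 ha hb hab.
  by rewrite !big_ord0 subrr normc0 !mul0r.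
rewrite !big_ord_recl.
set a' := \prod_(i < n) a _; set b' := \prod_(i < n) b _; set w' := \prod_(i < n) w _.
have hb' : normc b' <= A ^+ n * w'.
  rewrite normc_prod.
  have -> : A ^+ n * w' = \prod_(i < n) (A * w (lift ord0 i)).
    by rewrite big_split/= prodr_const card_ord.
  by apply: ler_prod => i _; rewrite normc_ge0 hb.
have h := IH _ _ _ (fun i => w0 (lift ord0 i)) (fun i => ha (lift ord0 i))
   (fun i => hb (lift ord0 i)) (fun i => hab (lift ord0 i)).
rewrite -/a' -/b' -/w' in h.
have w'0 : 0 <= w' by apply: prodr_ge0.
have -> : a ord0 * a' - b ord0 * b' = a ord0 * (a' - b') + (a ord0 - b ord0) * b' by ring.
rewrite (le_trans (le_normcD _ _))// !normcM.
have h1 : normc (a ord0) * normc (a' - b') <= (A * w ord0) * (n%:R * A ^+ n * ep * w').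
  by apply: ler_pM; rewrite ?normc_ge0.
have h2 : normc (a ord0 - b ord0) * normc b' <= (ep * w ord0) * (A ^+ n * w').
  by apply: ler_pM; rewrite ?normc_ge0.
rewrite (le_trans (lerD h1 h2))// -natr1 exprS.
have An : 0 <= A ^+ n by rewrite exprn_ge0.
have W : 0 <= (ep * w ord0) * (A ^+ n * w') by rewrite !mulr_ge0.
rewrite -subr_ge0.
have -> : (n%:R + 1) * (A * A ^+ n) * ep * (w ord0 * w') -
  (A * w ord0 * (n%:R * A ^+ n * ep * w') + ep * w ord0 * (A ^+ n * w')) =
  (A - 1) * (ep * w ord0 * (A ^+ n * w')) by ring.
by rewrite mulr_ge0// subr_ge0.
Qed.

Lemma one_sqr_pow_le (N : nat) (x : R) :
  (1 + x ^+ 2) ^+ N <= 2 ^+ N * (1 + `|x| ^+ (2 * N)).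
Proof.
rewrite exprM real_normK ?num_real//.
have y0 := sqr_ge0 x; move: (x ^+ 2) y0 => y y0.
have [y1|y1] := leP y 1.
  apply: (@le_trans _ _ (2 ^+ N)); first by rewrite lerXn2r ?nnegrE//; lra.
  by rewrite ler_peMr ?exprn_ge0// lerDl exprn_ge0.
apply: (@le_trans _ _ (2 ^+ N * y ^+ N)).
  by rewrite -exprMn lerXn2r ?nnegrE//; lra.
by rewrite ler_wpM2l ?exprn_ge0// lerDr.
Qed.

(** After [abs_sub_sqr_le] the exponent is at most d^2 / (2 t) + t / 2 - u with u = t (1 + x^2) / 2;
    one takes u^N <= N! exp(u), and [expR 1] bounds exp(t / 2) as t <= 2. *)
Lemma one_sqr_gauss_le (N : nat) (d b t x : R) : 0 < t -> t <= 2 -> `|b| <= d ->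
  (1 + x ^+ 2) ^+ N * expR (- b * x - t * x ^+ 2) <=
  N`!%:R * 2 ^+ N * expR 1 * (t^-1 ^+ N * expR (d ^+ 2 / 2 / t)).
Proof.
move=> t0 t2 hb.
have h1 : - b * x - t * x ^+ 2 <= d ^+ 2 / 2 / t + (t / 2) - t / 2 * (1 + x ^+ 2).
  have : - b * x <= d * `|x|.
    rewrite (le_trans (ler_norm _))// normrM normrN ler_wpM2r//.
  have := abs_sub_sqr_le d x t0.
  have -> : d ^+ 2 / (2 * t) = d ^+ 2 / 2 / t by field; lra.
  lra.
set u := t / 2 * (1 + x ^+ 2).
have x0 := sqr_ge0 x.
have u0 : 0 <= u by rewrite mulr_ge0 ?divr_ge0 ?(ltW t0)//; lra.
have hu := exprn_le_expR N u0.
have -> : (1 + x ^+ 2) ^+ N = 2 ^+ N * t^-1 ^+ N * u ^+ N.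
  rewrite -!exprMn; congr (_ ^+ _); rewrite /u; field; lra.
have q0 : 0 <= 2 ^+ N * t^-1 ^+ N :> R by rewrite mulr_ge0 ?exprn_ge0// invr_ge0 ltW.
apply: (@le_trans _ _ (2 ^+ N * t^-1 ^+ N * (N`!%:R * expR u) *
    (expR (d ^+ 2 / 2 / t) * expR 1 * expR (- u)))).
  apply: ler_pM; rewrite ?expR_ge0//.
  - by rewrite mulr_ge0// exprn_ge0.
  - by rewrite ler_wpM2l.
  - rewrite -!expRD ler_expR (le_trans h1)// -/u; lra.
rewrite le_eqVlt; apply/orP; left; apply/eqP.
rewrite expRN; field; by rewrite gt_eqF ?expR_gt0.
Qed.

End real_bounds.

Section gaussian_cut.
Context {R : realType}.
Notation L := (@lebesgue_measure R).
Local Open Scope complex_scope.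
Variables (z eta de : R).
Hypotheses (eta0 : 0 < eta) (de0 : 0 <= de) (de_eta : de <= eta / 10).

(** One coordinate of a Gaussian with complex center ze, with the phase at frequency xi: its
    integral over y is one factor of [gauss_kernel], up to a constant. *)
Definition shifted_gauss (t : R) (ze : R[i]) (xi y : R) : R[i] :=
  cexp ('i * xi%:C * y%:C - (y%:C - ze) ^+ 2 / (4 * t)%:C).

Lemma shifted_gauss_integral t ze xi : 0 < t ->
  cinteg L (shifted_gauss t ze xi) /\
  cint L (shifted_gauss t ze xi) =
  (Num.sqrt (4 * pi * t))%:C * cexp ('i * ze * xi%:C - (t * xi ^+ 2)%:C).
Proof.
move=> t0; have t4 : 0 < (4 * t)^-1 by rewrite invr_gt0; lra.
have [i1 e1] := cgauss_integral ('i * xi%:C + ze / (2 * t)%:C) t4.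
have tn : (t%:C : R[i]) != 0 by apply/eqP => -[]; lra.
have c2 : (2%:C : R[i]) = 2 by apply: complex_eqP => /=; ring.
have c4 : (4%:C : R[i]) = 4 by apply: complex_eqP => /=; ring.
have E y : shifted_gauss t ze xi y = cexp (- ze ^+ 2 / (4 * t)%:C) *
    cexp (('i * xi%:C + ze / (2 * t)%:C) * y%:C - ((4 * t)^-1 * y ^+ 2)%:C).
  rewrite -cexpD; congr cexp.
  rewrite !(rmorphM, fmorphV, rmorphXn)/= c2 c4; field; exact: tn.
split.
  by have := cintegZ (cexp (- ze ^+ 2 / (4 * t)%:C)) i1; congr cinteg; apply/funext => y; rewrite E.
transitivity (cexp (- ze ^+ 2 / (4 * t)%:C) * cint L (fun y : R =>
    cexp (('i * xi%:C + ze / (2 * t)%:C) * y%:C - ((4 * t)^-1 * y ^+ 2)%:C))).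
  by rewrite -(cintZ _ i1); congr cint; apply/funext => y; rewrite E.
rewrite e1 mulrCA -cexpD; congr (_ * cexp _).
  by congr (Num.sqrt _)%:C; rewrite invrK; ring.
have i2 : 'i ^+ 2 = -1 :> R[i] by exact: sqr_i.
rewrite !(rmorphM, fmorphV, rmorphXn)/= c2 c4.
have -> : ('i * xi%:C + ze / (2 * t%:C)) ^+ 2 =
   'i ^+ 2 * xi%:C ^+ 2 + 2 * ('i * xi%:C) * (ze / (2 * t%:C)) + (ze / (2 * t%:C)) ^+ 2 by ring.
by rewrite i2; field.
Qed.

Lemma cut_gauss_integral t ze xi : 0 < t -> t <= 2 -> normc (ze - z%:C) <= de ->
  cinteg L (fun y => (cutoff z eta y)%:C * shifted_gauss t ze xi y).
Proof.
move=> t0 t2 hz; have [Psi [P0 dP van bd]] := cutoff_seq z eta0.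
have iK := truncated_gaussian_cinteg eta0 de_eta dP van bd 0 0 xi t0 t2 hz.
have := cintegB (shifted_gauss_integral ze xi t0).1 iK.
congr cinteg; apply/funext => y; rewrite P0 /shifted_gauss expr0 mul1r rmorphB/=; ring.
Qed.

(** [a] and [b] are the one-dimensional transforms of the full and of the cut Gaussian. The first is
    explicit, [a - b] decays by 2 N integrations by parts, and the bound for [b] follows from these
    two. The powers of [(1 + xi ^+ 2)^-1] are there to absorb the symbol of the operator. *)
Lemma gauss_cut_bound (N : nat) : exists2 C : R, 1 <= C &
  forall t ze xi, 0 < t -> t <= 2 -> normc (ze - z%:C) <= de ->
  let a := cint L (shifted_gauss t ze xi) in
  let b := cint L (fun y => (cutoff z eta y)%:C * shifted_gauss t ze xi y) in
  let A := C * t^-1 ^+ (2 * N) * expR (de ^+ 2 / 2 / t) in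
  [/\ normc a <= A * (1 + xi ^+ 2)^-1 ^+ N, normc b <= A * (1 + xi ^+ 2)^-1 ^+ N &
   normc (a - b) <= C * t^-1 ^+ (2 * N) * expR (- (eta ^+ 2 / (10 * t))) * (1 + xi ^+ 2)^-1 ^+ N].
Proof.
have [Psi [P0 dP van bd]] := cutoff_seq z eta0.
have [C1 C10 h1] := truncated_gaussian_decay eta0 de0 de_eta dP van bd 0 0 0.
have [C2 C20 h2] := truncated_gaussian_decay eta0 de0 de_eta dP van bd (2 * N) 0 0.
(* [C3] serves for [a] and [C4] for [a - b]. Their spare powers of 2 raise lower powers of 1 / t to
   the exponent 2 N, as 2 / t >= 1. *)
pose C3 : R := Num.sqrt (4 * pi * 2) * (N`!%:R * 2 ^+ N * expR 1 * 2 ^+ N).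
pose C4 : R := 2 ^+ N * (4 ^+ N * C1 + C2).
have C30 : 0 <= C3 by rewrite !mulr_ge0 ?sqrtr_ge0 ?expR_ge0 ?exprn_ge0.
have C40 : 0 <= C4 by rewrite mulr_ge0 ?exprn_ge0// addr_ge0// mulr_ge0 ?exprn_ge0.
exists (1 + C3 + C4); first by rewrite -addrA lerDl addr_ge0.
move=> t ze xi t0 t2 hz a b A.
have x0 : 0 < 1 + xi ^+ 2 by have := sqr_ge0 xi; lra.
have xN : 0 < (1 + xi ^+ 2) ^+ N by rewrite exprn_gt0.
have s0 : 2^-1 <= t^-1 by rewrite ler_pV2// ?inE ?unitfE ?gt_eqF//=.
have s1 : 1 <= 2 * t^-1 by lra.
have sN : 1 <= 2 ^+ N * t^-1 ^+ N :> R by rewrite -exprMn exprn_ege1.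
have sV : 0 <= t^-1 by rewrite invr_ge0 ltW.
have sVN : 0 <= t^-1 ^+ N by rewrite exprn_ge0.
have abE : a - b = cint L (fun y => ((y - z) ^+ 0 * Psi 0%N y)%:C * shifted_gauss t ze xi y).
  rewrite /a /b -(cintB (shifted_gauss_integral ze xi t0).1 (cut_gauss_integral xi t0 t2 hz)).
  congr cint; apply/funext => y; rewrite P0 expr0 mul1r rmorphB/=; ring.
have T2 : t^-1 ^+ (2 * N) = t^-1 ^+ N * t^-1 ^+ N by rewrite mul2n -addnn exprD.
have hab : normc (a - b) <= C4 * t^-1 ^+ (2 * N) * expR (- (eta ^+ 2 / (10 * t))) * (1 + xi ^+ 2)^-1 ^+ N.
  rewrite (exprVn (1 + xi ^+ 2)) ler_pdivlMr// mulrC abE.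
  have := h1 t ze xi t0 t2 hz; have := h2 t ze xi t0 t2 hz.
  rewrite -/(shifted_gauss _ _ _ _) expr0 mul1r expr0 mulr1.
  set k := normc _; set e := expR _ => H2 H1.
  have k0 : 0 <= k by exact: normc_ge0.
  have e0 : 0 <= e by exact: expR_ge0.
  apply: (le_trans (ler_wpM2r k0 (one_sqr_pow_le N xi))).
  set x := `|xi| ^+ (2 * N) in H2 *.
  have -> : 2 ^+ N * (1 + x) * k = 2 ^+ N * (k + x * k) by ring.
  have -> : C4 * t^-1 ^+ (2 * N) * e =
    2 ^+ N * (4 ^+ N * C1 * (t^-1 ^+ (2 * N) * e) + C2 * t^-1 ^+ (2 * N) * e).
    by rewrite /C4; ring.
  rewrite ler_wpM2l ?exprn_ge0//; apply: lerD => //.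
  apply: (le_trans H1); rewrite T2.
  have -> : 4 ^+ N * C1 * (t^-1 ^+ N * t^-1 ^+ N * e) =
    C1 * e * ((2 ^+ N * t^-1 ^+ N) * (2 ^+ N * t^-1 ^+ N)).
    by rewrite (_ : 4 ^+ N = 2 ^+ N * 2 ^+ N); [ring|rewrite -exprMn; congr (_ ^+ _); ring].
  rewrite ler_peMr//; first by rewrite mulr_ge0.
  by rewrite mulr_ege1.
have ha : normc a <= C3 * t^-1 ^+ (2 * N) * expR (de ^+ 2 / 2 / t) * (1 + xi ^+ 2)^-1 ^+ N.
  rewrite (exprVn (1 + xi ^+ 2)) ler_pdivlMr// mulrC /a (shifted_gauss_integral ze xi t0).2.
  rewrite normcM normc_real ger0_norm ?sqrtr_ge0// normc_cexp.
  have -> : Re ('i * ze * xi%:C - (t * xi ^+ 2)%:C) = - Im (ze - z%:C) * xi - t * xi ^+ 2.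
    by case: (ze) => p q; rewrite !cReImE/=; ring.
  have hb : `|Im (ze - z%:C)| <= de by rewrite (le_trans (normIm_le _)).
  have := one_sqr_gauss_le N xi t0 t2 hb; set e := expR (_ / t) => h.
  have e0 : 0 <= e by exact: expR_ge0.
  have sq : Num.sqrt (4 * pi * t) <= Num.sqrt (4 * pi * 2).
    by rewrite ler_wsqrtr// ler_wpM2l// mulr_ge0// pi_ge0.
  rewrite mulrCA (le_trans (ler_wpM2l (sqrtr_ge0 _) h))//.
  have F0 : 0 <= N`!%:R * 2 ^+ N * expR 1 * (t^-1 ^+ N * e) :> R.
    by rewrite !mulr_ge0 ?exprn_ge0 ?expR_ge0.
  apply: (le_trans (ler_wpM2r F0 sq)); rewrite /C3 T2.
  have -> : Num.sqrt (4 * pi * 2) * (N`!%:R * 2 ^+ N * expR 1 * 2 ^+ N) *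
      (t^-1 ^+ N * t^-1 ^+ N) * e =
    Num.sqrt (4 * pi * 2) * (N`!%:R * 2 ^+ N * expR 1 * (t^-1 ^+ N * e)) * (2 ^+ N * t^-1 ^+ N) by ring.
  by rewrite ler_peMr// mulr_ge0 ?sqrtr_ge0.
have w0 : 0 <= (1 + xi ^+ 2)^-1 ^+ N by rewrite exprn_ge0// invr_ge0 ltW.
have t20 : 0 <= t^-1 ^+ (2 * N) by rewrite exprn_ge0.
have E1 : 0 <= expR (- (eta ^+ 2 / (10 * t))) by exact: expR_ge0.
have E2 : expR (- (eta ^+ 2 / (10 * t))) <= expR (de ^+ 2 / 2 / t).
  rewrite ler_expR (@le_trans _ _ 0)//.
    by rewrite oppr_le0 divr_ge0 ?sqr_ge0//; lra.
  by rewrite !divr_ge0 ?sqr_ge0// ltW.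
split.
- apply: (le_trans ha); rewrite /A !ler_wpM2r ?expR_ge0//; lra.
- have -> : b = a - (a - b) by ring.
  rewrite (le_trans (le_normcD _ _))// normcN (le_trans (lerD ha hab))//.
  rewrite -mulrDl ler_wpM2r// /A.
  set U := t^-1 ^+ (2 * N) in t20 *; move: E2 E1; set e1 := expR _; set e2 := expR _ => E2 E1.
  have b4 : C4 * (U * e1) <= C4 * (U * e2) by rewrite !ler_wpM2l.
  have : 0 <= U * e2 by rewrite mulr_ge0 ?expR_ge0.
  move: b4; clear; lra.
- apply: (le_trans hab); rewrite !ler_wpM2r//; lra.
Qed.

End gaussian_cut.

Section weights.
Context {R : realType} {n : nat}.
Notation L := (@lebesgue_measure R).
Notation E := 'rV[R]_n.
Notation mu := (lebesgue_rV R n).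
Implicit Types xi : E.

(** Exchanges the radial symbol for a product weight, whose integral factors over the coordinates.
    The induction needs the additional 1 in front of the sum. *)
Lemma dotrV_le_prod xi : dotrV xi xi <= \prod_i (1 + xi 0 i ^+ 2).
Proof.
have H (s : seq 'I_n) : 1 + \sum_(i <- s) xi 0 i * xi 0 i <= \prod_(i <- s) (1 + xi 0 i ^+ 2).
  elim: s => [|i s IH]; first by rewrite !big_nil addr0.
  rewrite !big_cons; have i0 := sqr_ge0 (xi 0 i).
  have s0 : 0 <= \sum_(j <- s) xi 0 j * xi 0 j.
    by apply: sumr_ge0 => j _; rewrite -expr2 sqr_ge0.
  have : (1 + xi 0 i ^+ 2) * (1 + \sum_(j <- s) xi 0 j * xi 0 j) <=
         (1 + xi 0 i ^+ 2) * \prod_(j <- s) (1 + xi 0 j ^+ 2).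
    by rewrite ler_wpM2l//; lra.
  apply: le_trans; rewrite -expr2; nra.
by have := H (index_enum 'I_n); rewrite -/(dotrV xi xi); lra.
Qed.

Lemma enorm_powR_le (ga : R) (N : nat) xi : 0 <= ga -> ga <= N%:R ->
  enorm xi `^ (2 * ga) <= \prod_i (1 + xi 0 i ^+ 2) ^+ N.
Proof.
move=> ga0 gaN; rewrite powRrM (powR_mulrn 2 (enorm_ge0 xi)) sqr_enorm.
set P := \prod_i (1 + xi 0 i ^+ 2).
have P1 : 1 <= P.
  rewrite /P; elim/big_ind : _ => // [x y x1 y1|i _]; first by rewrite mulr_ege1.
  by rewrite lerDl sqr_ge0.
apply: (@le_trans _ _ (P `^ ga)).
  by apply: ge0_ler_powR; rewrite ?nnegrE ?dotrV_ge0 ?dotrV_le_prod//; lra.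
apply: (@le_trans _ _ (P `^ N%:R)); first exact: ler_powR.
by rewrite powR_mulrn ?prodrXl//; lra.
Qed.

Lemma measurable_enorm_powR (ga : R) : measurable_fun setT (fun xi : E => enorm xi `^ ga).
Proof. exact: (measurableT_comp (measurable_powR ga) measurable_enorm). Qed.

Lemma rinteg_prod_weight : rinteg mu (fun xi => \prod_i (1 + xi 0 i ^+ 2)^-1).
Proof.
by apply: (@rinteg_prodrV R n (fun=> fun x => (1 + x ^+ 2)^-1)) => i; exact: rinteg_oneDsqrV.
Qed.

Lemma weightV_gt0 (x : R) : 0 < (1 + x ^+ 2)^-1.
Proof. by rewrite invr_gt0; have := sqr_ge0 x; lra. Qed.

Lemma measurable_prod_weight : measurable_fun setT (fun xi => \prod_i (1 + xi 0 i ^+ 2)^-1).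
Proof. exact: rinteg_meas rinteg_prod_weight. Qed.

Lemma rinteg_L2_weight (g : E -> R[i]) : cmeas g -> rinteg mu (fun x => normc (g x) ^+ 2) ->
  rinteg mu (fun xi => normc (g xi) * \prod_i (1 + xi 0 i ^+ 2)^-1).
Proof.
move=> mg ig; apply: rintegM_L2 => //.
- exact: cmeas_normc.
- exact: measurable_prod_weight.
- apply: rinteg_le rinteg_prod_weight.
    by apply: measurable_funX; exact: measurable_prod_weight.
  move=> xi; have W0 : 0 <= \prod_i (1 + xi 0 i ^+ 2)^-1.
    by apply: prodr_ge0 => i _; rewrite ltW// weightV_gt0.
  rewrite ger0_norm ?sqr_ge0// expr2 ler_piMr//.
  apply: prodr_ile1 => i _; rewrite ltW ?weightV_gt0//= invf_le1 ?lerDl ?sqr_ge0//.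
  by have := sqr_ge0 (xi 0 i); lra.
Qed.

(** N of the weights absorb the symbol, and the last one is square integrable, which pairs it with
    the L^2 function g. *)
Lemma rinteg_fraclap_weight (ga : R) (N : nat) (g : E -> R[i]) : 0 <= ga -> ga <= N%:R ->
  cmeas g -> rinteg mu (fun x => normc (g x) ^+ 2) ->
  rinteg mu (fun xi => enorm xi `^ (2 * ga) * normc (g xi) *
    \prod_i (1 + xi 0 i ^+ 2)^-1 ^+ N.+1).
Proof.
move=> ga0 gaN mg ig; apply: rinteg_le (rinteg_L2_weight mg ig).
  apply: measurable_funM.
    by apply: measurable_funM; [exact: measurable_enorm_powR|exact: cmeas_normc].
  under eq_fun do rewrite prodrXl.
  by apply: measurable_funX; exact: measurable_prod_weight.
move=> xi.
have W0 : 0 <= \prod_i (1 + xi 0 i ^+ 2)^-1 ^+ N.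
  by apply: prodr_ge0 => i _; rewrite exprn_ge0// ltW// weightV_gt0.
have W1 : 0 <= \prod_i (1 + xi 0 i ^+ 2)^-1.
  by apply: prodr_ge0 => i _; rewrite ltW// weightV_gt0.
have -> : \prod_i (1 + xi 0 i ^+ 2)^-1 ^+ N.+1 =
   (\prod_i (1 + xi 0 i ^+ 2)^-1 ^+ N) * \prod_i (1 + xi 0 i ^+ 2)^-1.
  by rewrite -big_split; apply: eq_bigr => i _; rewrite exprSr.
rewrite ger0_norm; last by rewrite !mulr_ge0 ?powR_ge0 ?normc_ge0.
rewrite [leLHS](_ : _ = (enorm xi `^ (2 * ga) * \prod_i (1 + xi 0 i ^+ 2)^-1 ^+ N) *
  (normc (g xi) * \prod_i (1 + xi 0 i ^+ 2)^-1)); last by ring.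
rewrite ler_piMl ?mulr_ge0 ?normc_ge0//.
apply: (le_trans (ler_wpM2r W0 (enorm_powR_le xi ga0 gaN))).
rewrite -big_split/= big1// => i _.
rewrite exprVn divff// gt_eqF// exprn_gt0//; have := sqr_ge0 (xi 0 i); lra.
Qed.

End weights.

Section heat_bound.
Context {R : realType} {n : nat}.
Notation L := (@lebesgue_measure R).
Notation E := 'rV[R]_n.
Notation mu := (lebesgue_rV R n).
Local Open Scope complex_scope.

Lemma test_cut_gauss (Omega : set E) (z : E) (eta t : R) (X : 'I_n -> R[i]) :
  0 < eta -> 0 < t ->
  [set x : E | forall i, z 0 i - 2 * eta <= x 0 i <= z 0 i + 2 * eta] `<=` Omega ->
  test_function Omega (fun x : E =>
    \prod_i ((cutoff (z 0 i) eta (x 0 i))%:C * cexp (- ((x 0 i)%:C - X i) ^+ 2 / (4 * t)%:C))).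
Proof.
move=> eta0 t0 QO.
apply: (@test_function_prod R n (fun i y => (cutoff (z 0 i) eta y)%:C *
   cexp (- (y%:C - X i) ^+ 2 / (4 * t)%:C)) _ _ _ _ _ QO) => i; last first.
  move=> y hy; rewrite cutoff_eq0 ?mul0r//.
  rewrite leNgt; apply/negP; rewrite ltr_norml => /andP[h1 h2]; apply: hy; apply/andP; split; lra.
have E4 : ((4 * t)%:C)^-1 = (((4 * t)^-1)%:C : R[i]) by rewrite -fmorphV.
set a := Re (X i); set b := Im (X i); set s := (4 * t)^-1.
have CP (p q r : R) : Coo (fun y : R => p * (y * y) + (q * y + r)).
  move=> k; apply: CnD.
    by apply: CnM; [exact: Cn_cst|apply: CnM; exact: Cn_id].
  by apply: CnD; [apply: CnM; [exact: Cn_cst|exact: Cn_id]|exact: Cn_cst].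
have reE y : Re (- (y%:C - X i) ^+ 2 / (4 * t)%:C) = - s * (y * y) + ((2 * a * s) * y + (b ^+ 2 - a ^+ 2) * s).
  by rewrite E4 /a /b; case: (X i) => p q; rewrite [(y%:C - _) ^+ 2]expr2 !cReImE/= -/s; ring.
have imE y : Im (- (y%:C - X i) ^+ 2 / (4 * t)%:C) = 0 * (y * y) + ((2 * b * s) * y + - (2 * a * b * s)).
  by rewrite E4 /a /b; case: (X i) => p q; rewrite expr2 !cReImE/= -/s; ring.
split.
  have -> : (fun y : R => Re ((cutoff (z 0 i) eta y)%:C * cexp (- (y%:C - X i) ^+ 2 / (4 * t)%:C))) =
    fun y => cutoff (z 0 i) eta y * (expR (- s * (y * y) + ((2 * a * s) * y + (b ^+ 2 - a ^+ 2) * s)) *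
      cos (0 * (y * y) + ((2 * b * s) * y + - (2 * a * b * s)))).
    by apply/funext => y; rewrite cReM /= mul0r subr0 reE imE.
  move=> k; apply: CnM; first exact: Coo_cutoff.
  by apply: CnM; [apply: Cn_expR; exact: CP|exact: (Cn_cos_sin (CP _ _ _ k)).1].
have -> : (fun y : R => Im ((cutoff (z 0 i) eta y)%:C * cexp (- (y%:C - X i) ^+ 2 / (4 * t)%:C))) =
  fun y => cutoff (z 0 i) eta y * (expR (- s * (y * y) + ((2 * a * s) * y + (b ^+ 2 - a ^+ 2) * s)) *
    sin (0 * (y * y) + ((2 * b * s) * y + - (2 * a * b * s)))).
  by apply/funext => y; rewrite cImM /= mul0r addr0 reE imE.
move=> k; apply: CnM; first exact: Coo_cutoff.
by apply: CnM; [apply: Cn_expR; exact: CP|exact: (Cn_cos_sin (CP _ _ _ k)).2].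
Qed.

(* The Gaussian times a cutoff is a test function, hence pairs to 0 with (-Delta)^ga f.
   The rest of the Gaussian contributes t^(-m) exp(- c / t). *)
Lemma fraclap_heat_bound (ga : R) (Omega : set E) (f : E -> R[i]) (z : E) (eta de : R) :
  0 < ga -> 0 < eta -> 0 <= de -> de <= eta / 10 -> n%:R * de ^+ 2 <= eta ^+ 2 / 10 ->
  [set x : E | forall i, z 0 i - 2 * eta <= x 0 i <= z 0 i + 2 * eta] `<=` Omega ->
  memL2 (fourierL2 f) -> fraclap_eq0_in ga f Omega ->
  exists2 C : R, 0 <= C & forall t X, 0 < t -> t <= 2 ->
    (forall i, normc (X i - (z 0 i)%:C) <= de) ->
    normc (cint mu (fun xi => (enorm xi `^ (2 * ga))%:C * fourierL2 f xi *
      gauss_kernel X t xi)) <= C.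
Proof.
move=> ga0 eta0 de0 de_eta nde QO /memL2P[mg ig] hf.
set g := fourierL2 f in mg ig *.
have [N gaN] : exists N : nat, ga <= N%:R.
  by exists (Num.bound ga); rewrite ltW// archi_boundP// ltW.
have H (i : 'I_n) : exists C : R, 1 <= C /\ forall t ze xi, 0 < t -> t <= 2 ->
  normc (ze - (z 0 i)%:C) <= de ->
  let a := cint L (shifted_gauss t ze xi) in
  let b := cint L (fun y => (cutoff (z 0 i) eta y)%:C * shifted_gauss t ze xi y) in
  let A := C * t^-1 ^+ (2 * N.+1) * expR (de ^+ 2 / 2 / t) in
  [/\ normc a <= A * (1 + xi ^+ 2)^-1 ^+ N.+1, normc b <= A * (1 + xi ^+ 2)^-1 ^+ N.+1 &
   normc (a - b) <= C * t^-1 ^+ (2 * N.+1) * expR (- (eta ^+ 2 / (10 * t))) * (1 + xi ^+ 2)^-1 ^+ N.+1].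
  by have [C C1 hC] := gauss_cut_bound (z 0 i) eta0 de0 de_eta N.+1; exists C.
have [Cf hCf] := choice H.
set M := (2 * N.+1)%N in hCf.
pose C1 : R := 1 + \sum_i Cf i.
have Cf0 i : 0 <= Cf i by have [? _] := hCf i; lra.
have C11 : 1 <= C1 by rewrite lerDl sumr_ge0.
have CfC i : Cf i <= C1.
  have h : 0 <= \sum_(j < n | j != i) Cf j by rewrite sumr_ge0.
  rewrite /C1 (bigD1 i)//=; move: h; move: (\sum_(_ < n | _) _) => q h; lra.
(* The factor 2^M ensures 1 <= [A], as [prodc_sub_le] requires: (2 / t)^M >= 1 because t <= 2. *)
pose C2 : R := 2 ^+ M * C1.
have M1 : 1 <= 2 ^+ M :> R by rewrite exprn_ege1//; lra.
have CfC2 i : Cf i <= C2.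
  by rewrite (le_trans (CfC i))// /C2 ler_peMl//; lra.
have C20 : 0 <= C2 by rewrite /C2 mulr_ge0//; lra.
(* The total power of 1 / t: M for each of the n + 1 factors of [A ^+ n * ep], and n for the
   division by [kap ^+ n]. As for the rate [c], the growth [A ^+ n] costs at most n de^2 / 2 <=
   eta^2 / 20 out of the available eta^2 / 10. *)
pose m := (M * n.+1 + n)%N.
pose c : R := eta ^+ 2 / 20.
have c0 : 0 < c by rewrite divr_gt0// exprn_gt0.
pose I0 := \int[mu]_xi (enorm xi `^ (2 * ga) * normc (g xi) *
    \prod_i (1 + xi 0 i ^+ 2)^-1 ^+ N.+1).
have iw := rinteg_fraclap_weight (ltW ga0) gaN mg ig.
have w0 (i : 'I_n) (xi : E) : 0 <= (1 + xi 0 i ^+ 2)^-1 ^+ N.+1.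
  by rewrite exprn_ge0// ltW// weightV_gt0.
have Pw0 (xi : E) : 0 <= \prod_i (1 + xi 0 i ^+ 2)^-1 ^+ N.+1 by apply: prodr_ge0.
have I00 : 0 <= I0.
  by apply: Rintegral_ge0 => xi _; rewrite !mulr_ge0 ?powR_ge0 ?normc_ge0.
exists (n%:R * C2 ^+ n.+1 * (m`!%:R * c^-1 ^+ m) * I0).
  by rewrite !mulr_ge0 ?exprn_ge0// invr_ge0 ltW.
move=> t X t0 t2 hX.
pose A : R := C2 * t^-1 ^+ M * expR (de ^+ 2 / 2 / t).
pose ep : R := C2 * t^-1 ^+ M * expR (- (eta ^+ 2 / (10 * t))).
have s0 : 0 <= t^-1 by rewrite invr_ge0 ltW.
have s1 : 1 <= 2 * t^-1.
  have : 2^-1 <= t^-1 by rewrite ler_pV2// ?inE ?unitfE ?gt_eqF//=.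
  lra.
have sM : 0 <= t^-1 ^+ M by rewrite exprn_ge0.
have A1 : 1 <= A.
  rewrite /A /C2.
  have -> : 2 ^+ M * C1 * t^-1 ^+ M * expR (de ^+ 2 / 2 / t) =
    ((2 * t^-1) ^+ M * C1) * expR (de ^+ 2 / 2 / t) by rewrite exprMn; ring.
  apply: mulr_ege1; first by apply: mulr_ege1 => //; exact: exprn_ege1.
  by rewrite -expR0 ler_expR !divr_ge0 ?sqr_ge0// ltW.
have ep0 : 0 <= ep by apply: mulr_ge0; [exact: mulr_ge0|exact: expR_ge0].
pose a i (x : R) := cint L (shifted_gauss t (X i) x).
pose b i (x : R) := cint L (fun y => (cutoff (z 0 i) eta y)%:C * shifted_gauss t (X i) x y).
have bounds (xi : E) : [/\ forall i, normc (a i (xi 0 i)) <= A * (1 + xi 0 i ^+ 2)^-1 ^+ N.+1,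
   forall i, normc (b i (xi 0 i)) <= A * (1 + xi 0 i ^+ 2)^-1 ^+ N.+1 &
   forall i, normc (a i (xi 0 i) - b i (xi 0 i)) <= ep * (1 + xi 0 i ^+ 2)^-1 ^+ N.+1].
  have B i := (hCf i).2 t (X i) (xi 0 i) t0 t2 (hX i).
  split => i; have [b1 b2 b3] := B i.
  - by apply: (le_trans b1); rewrite !ler_wpM2r ?expR_ge0.
  - by apply: (le_trans b2); rewrite !ler_wpM2r ?expR_ge0.
  - by apply: (le_trans b3); rewrite !ler_wpM2r ?expR_ge0.
pose K : R := n%:R * A ^+ n * ep.
have A0 : 0 <= A by lra.
have K0 : 0 <= K by apply: mulr_ge0 => //; rewrite mulr_ge0// exprn_ge0.
pose PA (xi : E) := \prod_i a i (xi 0 i).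
pose PB (xi : E) := \prod_i b i (xi 0 i).
have dAB xi : normc (PA xi - PB xi) <= K * \prod_i (1 + xi 0 i ^+ 2)^-1 ^+ N.+1.
  have [b1 b2 b3] := bounds xi.
  exact: (prodc_sub_le A1 ep0 (fun i => w0 i xi) b1 b2 b3).
pose kap : R := Num.sqrt (4 * pi * t).
have kap0 : 0 < kap by rewrite sqrtr_gt0 !mulr_gt0// pi_gt0.
have PAE xi : PA xi = (kap ^+ n)%:C * gauss_kernel X t xi.
  rewrite /PA /a; under eq_bigr do rewrite (shifted_gauss_integral _ _ t0).2.
  by rewrite big_split/= prodr_const card_ord -rmorphXn.
pose phi (x : E) : R[i] := \prod_i ((cutoff (z 0 i) eta (x 0 i))%:C *
   cexp (- ((x 0 i)%:C - X i) ^+ 2 / (4 * t)%:C)).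
have phiT : test_function Omega phi by exact: test_cut_gauss.
have iphi : cinteg mu phi.
  apply: (cint_prodrV (h := fun i y => (cutoff (z 0 i) eta y)%:C *
     cexp (- (y%:C - X i) ^+ 2 / (4 * t)%:C)) _).1 => i.
  have := cut_gauss_integral eta0 de_eta 0 t0 t2 (hX i).
  by congr cinteg; apply/funext => y; rewrite /shifted_gauss mulr0 mul0r add0r mulNr.
(* The pairing in [fraclap] takes the transform at - xi, which turns the Fourier kernel into the
   phase of [shifted_gauss]. *)
have PBE xi : fourier phi (- xi) = PB xi.
  transitivity (cint mu (fun x : E => \prod_i ((cutoff (z 0 i) eta (x 0 i))%:C *
      shifted_gauss t (X i) (xi 0 i) (x 0 i)))).
    congr cint; apply/funext => x; rewrite fourier_kernelE.
    have -> : 0 -i* dotrV x (- xi) = \sum_i ('i * (xi 0 i)%:C * (x 0 i)%:C) :> R[i].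
      transitivity ('i * (dotrV x xi)%:C : R[i]).
        have -> : dotrV x (- xi) = - dotrV x xi.
          by rewrite /dotrV -sumrN; apply: eq_bigr => i _; rewrite mxE mulrN.
        by apply: complex_eqP; rewrite !cReImE/=; ring.
      rewrite /dotrV rmorph_sum mulr_sumr; apply: eq_bigr => i _.
      by rewrite rmorphM/=; ring.
    rewrite cexp_sum /phi -big_split; apply: eq_bigr => i _ /=.
    by rewrite mulrCA -cexpD /shifted_gauss mulNr.
  apply: (cint_prodrV (h := fun i y => (cutoff (z 0 i) eta y)%:C *
      shifted_gauss t (X i) (xi 0 i) y) _).2 => i.
  by have := cut_gauss_integral eta0 de_eta (xi 0 i) t0 t2 (hX i).
have mPB : cmeas PB.
  have := cmeas_comp (h := fun xi : E => - xi) (cmeas_fourier iphi) _.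
  have -> : (fun x : E => fourier phi (- x)) = PB by apply/funext => xi; rewrite PBE.
  apply; apply: measurable_fun_rVP => i; under eq_fun do rewrite mxE.
  by apply: measurable_funN; exact: measurable_id_coord.
have mPA : cmeas PA.
  have -> : PA = fun xi => (kap ^+ n)%:C * gauss_kernel X t xi by apply/funext => xi.
  by apply: cmeasM; [exact: cmeas_cst|exact: cmeas_gauss_kernel].
pose T (xi : E) := (enorm xi `^ (2 * ga))%:C * g xi.
have mT : cmeas T.
  by apply: cmeasM => //; apply: cmeas_real; exact: measurable_enorm_powR.
have normT xi : normc (T xi) = enorm xi `^ (2 * ga) * normc (g xi).
  by rewrite normcM normc_real ger0_norm// powR_ge0.
have prodb (u : 'I_n -> R -> R[i]) (xi : E) :
    (forall i, normc (u i (xi 0 i)) <= A * (1 + xi 0 i ^+ 2)^-1 ^+ N.+1) ->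
    normc (\prod_i u i (xi 0 i)) <= A ^+ n * \prod_i (1 + xi 0 i ^+ 2)^-1 ^+ N.+1.
  move=> hu; rewrite normc_prod.
  have -> : A ^+ n * \prod_i (1 + xi 0 i ^+ 2)^-1 ^+ N.+1 =
     \prod_i (A * (1 + xi 0 i ^+ 2)^-1 ^+ N.+1).
    by rewrite big_split/= prodr_const card_ord.
  by apply: ler_prod => i _; rewrite normc_ge0 hu.
have iT (P : E -> R[i]) (k : R) : cmeas P ->
    (forall xi, normc (P xi) <= k * \prod_i (1 + xi 0 i ^+ 2)^-1 ^+ N.+1) ->
    cinteg mu (fun xi => T xi * P xi).
  move=> mP hP; apply: (cinteg_le (h := fun xi => k * (enorm xi `^ (2 * ga) * normc (g xi) *
    \prod_i (1 + xi 0 i ^+ 2)^-1 ^+ N.+1))).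
  - exact: cmeasM.
  - move=> xi; rewrite normcM normT.
    have -> : k * (enorm xi `^ (2 * ga) * normc (g xi) *
      \prod_i (1 + xi 0 i ^+ 2)^-1 ^+ N.+1) = (enorm xi `^ (2 * ga) * normc (g xi)) *
      (k * \prod_i (1 + xi 0 i ^+ 2)^-1 ^+ N.+1) by ring.
    by rewrite ler_wpM2l ?mulr_ge0 ?powR_ge0 ?normc_ge0.
  - exact: rintegZ.
have iTA : cinteg mu (fun xi => T xi * PA xi).
  by apply: (iT _ (A ^+ n)) => // xi; apply: prodb; have [] := bounds xi.
have iTB : cinteg mu (fun xi => T xi * PB xi).
  by apply: (iT _ (A ^+ n)) => // xi; apply: prodb; have [] := bounds xi.
(* Here the equation is used, tested against the cut Gaussian. *)
have TB0 : cint mu (fun xi => T xi * PB xi) = 0.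
  have := hf phi phiT; rewrite /fraclap => /eqP; rewrite mulf_eq0 => /orP[/eqP[/eqP]|/eqP h].
    by rewrite invr_eq0 expf_eq0 => /andP[_]; rewrite mulf_eq0 pnatr_eq0/= gt_eqF// pi_gt0.
  by rewrite -[RHS]h; congr cint; apply/funext => xi; rewrite PBE.
have iTG : cinteg mu (fun xi => T xi * gauss_kernel X t xi).
  have := cintegZ ((kap ^+ n)^-1)%:C iTA; congr cinteg; apply/funext => xi.
  have kn : kap ^+ n != 0 by rewrite gt_eqF// exprn_gt0.
  rewrite PAE mulrCA; congr (_ * _).
  by rewrite mulrA -[_%:C * _%:C]rmorphM mulVf// mul1r.
(* Since the cut Gaussian contributes 0, only the exponentially small difference [PA - PB] is left
   to be estimated. *)
have e1 : (kap ^+ n)%:C * cint mu (fun xi => T xi * gauss_kernel X t xi) =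
    cint mu (fun xi => T xi * (PA xi - PB xi)).
  have -> : (fun xi => T xi * (PA xi - PB xi)) = fun xi => T xi * PA xi - T xi * PB xi.
    by apply/funext => xi; rewrite mulrBr.
  rewrite (cintB iTA iTB) TB0 subr0 -(cintZ _ iTG); congr cint; apply/funext => xi.
  by rewrite PAE; ring.
have e2 : normc (cint mu (fun xi => T xi * (PA xi - PB xi))) <= K * I0.
  rewrite /I0 -(rintZl _ iw); apply: le_normc_cint.
  - by apply: cmeasM => //; exact: cmeasB.
  - move=> xi; rewrite normcM normT [leRHS]mulrCA ler_wpM2l ?mulr_ge0 ?powR_ge0 ?normc_ge0//.
  - exact: rintegZ.
have kt : t <= kap.
  rewrite -[leLHS]ger0_norm ?(ltW t0)// -sqrtr_sqr ler_wsqrtr// expr2 ler_wpM2r ?(ltW t0)//.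
  have := pi_ge2 R; lra.
have kV : (kap ^+ n)^-1 <= t^-1 ^+ n.
  rewrite -exprVn; apply: lerXn2r; rewrite ?nnegrE ?invr_ge0 ?(ltW kap0) ?(ltW t0)//.
  by rewrite lef_pV2 ?posrE.
have kn0 : 0 < kap ^+ n by rewrite exprn_gt0.
have -> : normc (cint mu (fun xi => T xi * gauss_kernel X t xi)) =
    (kap ^+ n)^-1 * normc (cint mu (fun xi => T xi * (PA xi - PB xi))).
  by rewrite -e1 normcM normc_real (gtr0_norm kn0) mulKf// gt_eqF.
apply: (@le_trans _ _ (t^-1 ^+ n * (K * I0))).
  by apply: ler_pM; rewrite ?invr_ge0 ?(ltW kn0) ?normc_ge0.
rewrite mulrA ler_wpM2r// /K.
have := inv_pow_exp_le m c0 t0; set s := t^-1 => hm.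
have eE : expR (de ^+ 2 / 2 / t) ^+ n * expR (- (eta ^+ 2 / (10 * t))) <= expR (- (c / t)).
  rewrite -expRM_natl -expRD ler_expR -/s.
  have -> : n%:R * (de ^+ 2 / 2 / t) - eta ^+ 2 / (10 * t) =
    (n%:R * de ^+ 2 / 2 - eta ^+ 2 / 10) * s by rewrite /s; field; lra.
  have -> : - (c / t) = (- c) * s by rewrite mulNr.
  by rewrite ler_wpM2r// /c; lra.
have -> : s ^+ n * (n%:R * A ^+ n * ep) = n%:R * C2 ^+ n.+1 *
   (s ^+ m * (expR (de ^+ 2 / 2 / t) ^+ n * expR (- (eta ^+ 2 / (10 * t))))).
  have -> : s ^+ m = s ^+ M * (s ^+ M) ^+ n * s ^+ n.
    by rewrite /m (mulnS M n) (exprD s (M + M * n) n) (exprD s M (M * n)) (exprM s M n).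
  rewrite (exprS C2 n) /A /ep -/s (exprMn n (C2 * s ^+ M)) (exprMn n C2).
  move: (s ^+ n) (s ^+ M) (expR _) (expR _) (C2 ^+ n) => u1 u2 u3 u4 u5.
  move: (u2 ^+ n) (u3 ^+ n) => u6 u7; ring.
rewrite ler_wpM2l ?mulr_ge0 ?exprn_ge0//.
by apply: le_trans hm; rewrite ler_wpM2l ?exprn_ge0.
Qed.

End heat_bound.

(** * Bound for the heat extension *)

Section gamma_integral.
Context {R : realType}.
Notation L := (@lebesgue_measure R).
Variable ga : R.
Hypothesis ga0 : 0 < ga.

(** Euler's integrand for Gamma(ga) in the variable tau = ln s. In this variable the dilation by a
    becomes the translation by [ln a], so that an affine substitution suffices. *)
Definition gamma_density (tau : R) : R := expR (ga * tau - expR tau).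

Definition gamma_int : R := \int[L]_tau gamma_density tau.

(* Its integral over tau is Gamma(ga) for every a > 0: substitute s = a exp(tau) in
   Euler's integral. *)
Definition heat_weight (a tau : R) : R := a `^ ga * expR (ga * tau - a * expR tau).

Lemma expR_abs_decay (d x : R) : 0 < d ->
  expR (- (d * `|x|)) <= (1 + 2 / d ^+ 2) * (1 + x ^+ 2)^-1.
Proof.
move=> d0; have x0 := normr_ge0 x.
have u0 : 0 <= d * `|x| by rewrite mulr_ge0// ltW.
have := exprn_le_expR 2 u0.
have : 1 <= expR (d * `|x|) by rewrite -expR0 ler_expR.
rewrite expRN exprMn real_normK ?num_real// => e1 e2.
have d2 : 0 < d ^+ 2 by rewrite exprn_gt0.
have e3 : x ^+ 2 <= 2 / d ^+ 2 * expR (d * `|x|).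
  by rewrite mulrAC ler_pdivlMr// mulrC; move: e2; rewrite -[2`!]/2%N.
have e0 := expR_gt0 (d * `|x|); have x20 := sqr_ge0 x.
rewrite -div1r ler_pdivrMr// mulrAC ler_pdivlMr; last lra.
by rewrite mul1r mulrDl mul1r; apply: lerD.
Qed.

Lemma gamma_density_decay : exists2 K : R, 0 < K &
  forall tau, gamma_density tau <= K * (1 + tau ^+ 2)^-1.
Proof.
pose c := ga + 1; have c0 : 0 < c by rewrite addr_gt0.
pose K1 := 1 + expR (c * ln c - c).
have K11 : 1 <= K1 by rewrite lerDl expR_ge0.
pose d := Num.min 1 ga.
have d0 : 0 < d by rewrite lt_min ltr01.
exists (K1 * (1 + 2 / d ^+ 2)).
  rewrite mulr_gt0//; first lra.
  have : 0 < 2 / d ^+ 2 by rewrite divr_gt0// exprn_gt0.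
  lra.
move=> tau; rewrite -mulrA; apply: le_trans (ler_wpM2l _ (expR_abs_decay tau d0)); last lra.
have [t0|t0] := leP 0 tau.
  (* The tangent line of exp at ln c has slope c = ga + 1, which absorbs ga tau and leaves the decay
     exp(- tau). *)
  have h : ga * tau - expR tau <= - tau + (c * ln c - c).
    have := expR_ge1Dx (tau - ln c); rewrite expRD expRN lnK ?posrE//.
    rewrite ler_pdivlMr//; move: (ln c) (expR tau) => l e; rewrite /c => h; lra.
  rewrite /gamma_density (ger0_norm t0).
  have h1 : gamma_density tau <= expR (c * ln c - c) * expR (- tau).
    by rewrite -expRD ler_expR (addrC _ (- tau)).
  apply: (le_trans h1); apply: ler_pM; rewrite ?expR_ge0//.
    by rewrite /K1; lra.
  by rewrite ler_expR lerN2 ler_piMl// ge_min lexx.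
rewrite ltr0_norm// /gamma_density.
apply: (@le_trans _ _ (1 * expR (- (d * - tau)))).
  rewrite mul1r ler_expR mulrN opprK.
  have := expR_ge0 tau; have : d <= ga by rewrite ge_min lexx orbT.
  nra.
by rewrite ler_wpM2r ?expR_ge0.
Qed.

Lemma continuous_gamma_density : continuous gamma_density.
Proof.
apply: (@derive_continuous _ _ (fun tau => gamma_density tau * (ga - expR tau))) => tau.
apply: is_derive_expR_comp; apply: is_derive_eq; rewrite /GRing.scale/=; ring.
Qed.

Lemma rinteg_gamma_density : rinteg L gamma_density.
Proof.
have [K K0 hK] := gamma_density_decay.
apply: (@rinteg_decay _ _ K).
  by apply: continuous_measurable_fun; exact: continuous_gamma_density.
by move=> tau; rewrite ger0_norm ?expR_ge0.
Qed.

Lemma gamma_int_gt0 : 0 < gamma_int.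
Proof.
have i1 : rinteg L (\1_(`[0, 1]%classic) : R -> R) by exact: integrable_indic_itv.
apply: (@lt_le_trans _ _ (expR (- expR 1) * \int[L]_x (\1_(`[0, 1]%classic) x : R))).
  rewrite mulr_gt0 ?expR_gt0// /Rintegral integral_indic//= setIT.
  by rewrite lebesgue_measure_itv/= lte_fin ltr01 sube0.
rewrite -(rintZl _ i1); apply: rint_le.
- exact: rintegZ.
- exact: rinteg_gamma_density.
move=> x; rewrite indicE; have [xI|xI] := boolP (x \in _); last by rewrite mulr0 expR_ge0.
move: xI; rewrite inE/= in_itv/= => /andP[x0 x1].
rewrite mulr1 ler_expR.
have := ler_expR x 1; rewrite x1 => h; have : 0 <= ga * x by rewrite mulr_ge0// ltW.
lra.
Qed.

Lemma heat_weight_ge0 a tau : 0 <= heat_weight a tau.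
Proof. by rewrite mulr_ge0 ?powR_ge0 ?expR_ge0. Qed.

Lemma heat_weightE a tau : 0 < a -> heat_weight a tau = gamma_density (1 * tau + ln a).
Proof.
move=> a0; rewrite /heat_weight /powR gt_eqF// -expRD /gamma_density; congr expR.
rewrite expRD lnK ?posrE// mul1r; ring.
Qed.

Lemma heat_weight_integral a : 0 < a ->
  rinteg L (heat_weight a) /\ \int[L]_tau heat_weight a tau = gamma_int.
Proof.
move=> a0; have [i1 i2] := Rintegral_affine (ln a) ltr01 continuous_gamma_density rinteg_gamma_density.
have -> : heat_weight a = fun tau => gamma_density (1 * tau + ln a).
  by apply/funext => tau; exact: heat_weightE.
split; first exact: i1.
exact: (etrans (esym (mul1r _)) (esym i2)).
Qed.

Lemma heat_weight0 tau : heat_weight 0 tau = 0.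
Proof. by rewrite /heat_weight powR0 ?mul0r// gt_eqF. Qed.

Definition neg_ind (tau : R) : R := \1_(`]-oo, 0[%classic) tau.

Lemma neg_indE tau : neg_ind tau = if tau < 0 then 1 else 0.
Proof.
rewrite /neg_ind indicE; case: ifPn => h.
  by rewrite mem_set//= in_itv.
by rewrite memNset//= in_itv/=; exact/negP.
Qed.

Lemma measurable_neg_ind : measurable_fun setT neg_ind.
Proof. exact: measurable_indic. Qed.

Lemma rinteg_neg_heat_weight a : 0 <= a -> rinteg L (fun tau => neg_ind tau * heat_weight a tau).
Proof.
rewrite le_eqVlt => /orP[/eqP <-|a0].
  under eq_fun do rewrite heat_weight0 mulr0.
  exact: integrable0.
have [i1 _] := heat_weight_integral a0.
apply: rinteg_le i1.
  by apply: measurable_funM; [exact: measurable_neg_ind|exact: (rinteg_meas (heat_weight_integral a0).1)].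
move=> tau; have w0 := heat_weight_ge0 a tau; rewrite neg_indE; case: ifPn => _.
  by rewrite mul1r ger0_norm.
by rewrite mul0r normr0.
Qed.

(** The restriction to tau < 0 keeps the additional heat time exp(tau) below 1, within the range of
    times where the bound from the equation is available. *)
Definition heat_part (a : R) : R := \int[L]_tau (neg_ind tau * heat_weight a tau).

Lemma heat_part_bound a : 0 <= a ->
  0 <= gamma_int - heat_part a <= gamma_int * (2 `^ ga * expR (- (a / 2))).
Proof.
have G0 := gamma_int_gt0.
rewrite le_eqVlt => /orP[/eqP <-|a0].
  have -> : heat_part 0 = 0.
    rewrite /heat_part; under eq_Rintegral do rewrite heat_weight0 mulr0.
    by rewrite Rintegral_cst//= mul0r.
  rewrite subr0 mul0r oppr0 expR0 mulr1 ltW//= ler_peMr ?(ltW G0)//.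
  by rewrite -[leLHS](powRr0 2) ler_powR// ?ltW//; lra.
have [i1 e1] := heat_weight_integral a0.
have i2 := rinteg_neg_heat_weight (ltW a0).
have a20 : 0 < a / 2 by rewrite divr_gt0.
have [i3 e3] := heat_weight_integral a20.
have E : gamma_int - heat_part a =
    \int[L]_tau (heat_weight a tau - neg_ind tau * heat_weight a tau).
  by rewrite -e1 /heat_part [RHS]RintegralB.
rewrite E; apply/andP; split.
  apply: Rintegral_ge0 => tau _; rewrite neg_indE; case: ifPn => _.
    by rewrite mul1r subrr.
  by rewrite mul0r subr0 heat_weight_ge0.
rewrite mulrC -{1}e3 -(rintZl _ i3); apply: rint_le.
- exact: rintegB.
- exact: rintegZ.
move=> tau; rewrite neg_indE; case: ifPn => [_|].
  by rewrite mul1r subrr !mulr_ge0 ?heat_weight_ge0 ?powR_ge0 ?expR_ge0.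
rewrite -leNgt mul0r subr0 => t0.
rewrite /heat_weight.
have -> : a `^ ga = 2 `^ ga * (a / 2) `^ ga.
  by rewrite -powRM; [congr (_ `^ _); field|lra|exact: ltW].
rewrite -!mulrA ler_wpM2l ?powR_ge0// [leRHS]mulrCA ler_wpM2l ?powR_ge0//.
rewrite -expRD ler_expR.
have : 1 <= expR tau by rewrite -expR0 ler_expR.
move: (expR tau) => e; nra.
Qed.

End gamma_integral.

Section heat_bound.
Context {R : realType} {n : nat}.
Notation L := (@lebesgue_measure R).
Notation E := 'rV[R]_n.
Notation mu := (lebesgue_rV R n).
Local Open Scope complex_scope.
Implicit Types (X : 'I_n -> R[i]) (xi z : E).

Lemma normc_gauss_kernel X t xi :
  normc (gauss_kernel X t xi) = \prod_i expR (- Im (X i) * xi 0 i - t * xi 0 i ^+ 2).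
Proof.
rewrite normc_prod; apply: eq_bigr => i _; rewrite normc_cexp; congr expR.
by case: (X i) => a b; rewrite !cReImE/=; ring.
Qed.

Lemma gauss_kernelD X t s xi :
  gauss_kernel X t xi * (expR (- (enorm xi ^+ 2 * s)))%:C = gauss_kernel X (t + s) xi.
Proof.
have -> : (expR (- (enorm xi ^+ 2 * s)))%:C = \prod_i cexp (- (s * xi 0 i ^+ 2))%:C.
  rewrite -cexp_real -cexp_sum sqr_enorm /dotrV mulr_suml -sumrN rmorph_sum.
  by congr cexp; apply: eq_bigr => i _; congr (_%:C); ring.
rewrite /gauss_kernel -big_split; apply: eq_bigr => i _ /=; rewrite -cexpD; congr cexp.
rewrite mulrDl rmorphD rmorphN/=; ring.
Qed.

Lemma normc_gauss_kernel_le X (t d : R) (N : nat) : 0 < t ->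
  (forall i, `|Im (X i)| <= d) -> exists2 C : R, 0 <= C & forall xi,
  normc (gauss_kernel X t xi) <= C * \prod_i (1 + xi 0 i ^+ 2)^-1 ^+ N.+1.
Proof.
move=> t0 hX; have [C C0 hC] := poly_gauss_le N d t0.
exists (C ^+ n); first by rewrite exprn_ge0// ltW.
move=> xi; rewrite normc_gauss_kernel.
have -> : C ^+ n * \prod_i (1 + xi 0 i ^+ 2)^-1 ^+ N.+1 =
  \prod_i (C * (1 + xi 0 i ^+ 2)^-1 ^+ N.+1) by rewrite big_split/= prodr_const card_ord.
apply: ler_prod => i _; rewrite expR_ge0/=.
have u0 : 0 < 1 + xi 0 i ^+ 2 by have := sqr_ge0 (xi 0 i); lra.
have {}hC := hC (xi 0 i); set u := 1 + xi 0 i ^+ 2 in u0 hC *.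
have -> : u^-1 ^+ N.+1 = u^-1 / u ^+ N by rewrite exprS exprVn.
rewrite (mulrA C) ler_pdivlMr ?exprn_gt0// mulrC.
apply: le_trans hC; rewrite ler_wpM2l ?exprn_ge0 ?(ltW u0)// ler_expR.
rewrite lerD2r (le_trans (ler_norm _))// normrM normrN ler_wpM2r//.
Qed.

(* With a = |xi|^2 and Gamma(ga) = I(a) + J(a), split according to the sign of tau, J(a)
   decays like exp(- a / 2) and I(a) exp(- t a) is an average of a^ga exp(- (t + s) a)
   over s in (0, 1), to which [fraclap_heat_bound] applies. *)
Lemma heat_bound (ga : R) (Omega : set E) (f : E -> R[i]) (z : E) (eta de : R) :
  0 < ga -> 0 < eta -> 0 <= de -> de <= eta / 10 -> n%:R * de ^+ 2 <= eta ^+ 2 / 10 ->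
  [set x : E | forall i, z 0 i - 2 * eta <= x 0 i <= z 0 i + 2 * eta] `<=` Omega ->
  memL2 (fourierL2 f) -> fraclap_eq0_in ga f Omega ->
  exists2 C : R, 0 <= C & forall t X, 0 < t -> t <= 1 ->
    (forall i, normc (X i - (z 0 i)%:C) <= de) ->
    normc (cint mu (fun xi => fourierL2 f xi * gauss_kernel X t xi)) <= C.
Proof.
move=> ga0 eta0 de0 de_eta nde QO L2g hf.
have [C C0 hC] := fraclap_heat_bound ga0 eta0 de0 de_eta nde QO L2g hf.
set g := fourierL2 f in hC L2g *.
have [mg ig] := memL2P L2g.
have G0 := gamma_int_gt0 ga0; set Ga := gamma_int ga in G0.
have gn0 : gamma_int ga != 0 by rewrite gt_eqF.
pose N := Num.bound ga.
have gaN : ga <= N%:R by rewrite ltW// archi_boundP// ltW.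
have half0 : 0 < 2^-1 :> R by lra.
(* The remainder exp(- |xi|^2 / 2) provides the integrability, so [C1] does not depend on t; the
   Gaussian at time t could not, as t may be arbitrarily small. *)
have [C1 C10 hC1] := poly_gauss_le 0 de half0.
have {}hC1 x : expR (de * `|x| - 2^-1 * x ^+ 2) <= C1 * (1 + x ^+ 2)^-1.
  by have := hC1 x; rewrite expr0 mul1r.
have iw := rinteg_L2_weight mg ig.
pose I1 := \int[mu]_xi (normc (g xi) * \prod_i (1 + xi 0 i ^+ 2)^-1).
have I10 : 0 <= I1.
  apply: Rintegral_ge0 => xi _; rewrite mulr_ge0 ?normc_ge0//.
  by apply: prodr_ge0 => i _; rewrite ltW// weightV_gt0.
pose B (tau : R) := neg_ind tau * expR (ga * tau).
have B0 tau : 0 <= B tau by rewrite mulr_ge0 ?expR_ge0// neg_indE; case: ifP.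
have mB : measurable_fun [set: measurableTypeR R] B.
  apply: measurable_funM; first exact: measurable_neg_ind.
  apply: (measurableT_comp (@measurable_expR R)).
  by apply: measurable_funM => //; exact: measurable_cst.
have iB : rinteg L B.
  have i1 := rintegZ (expR 1) (rinteg_gamma_density ga0).
  apply: (@rinteg_le _ (measurableTypeR R) R L _ _ mB _ i1) => tau.
  rewrite ger0_norm// /B neg_indE; case: ifPn => [t0|_].
    rewrite mul1r /gamma_density -expRD ler_expR.
    have : expR tau <= 1 by rewrite -expR0 ler_expR ltW.
    move: (expR tau) => e; lra.
  by rewrite mul0r mulr_ge0 ?expR_ge0.
pose IB := \int[L]_tau B tau.
have IB0 : 0 <= IB by apply: Rintegral_ge0 => tau _.
exists (2 `^ ga * C1 ^+ n * I1 + Ga^-1 * (C * IB)).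
  by rewrite addr_ge0// !mulr_ge0 ?powR_ge0 ?exprn_ge0 ?invr_ge0// ltW.
move=> t X t0 t1 hX.
have hIm i : `|Im (X i)| <= de.
  apply: le_trans (hX i); apply: le_trans (normIm_le _).
  by case: (X i) => a b /=; rewrite subr0.
have [C2 C20 hC2] := normc_gauss_kernel_le N t0 hIm.
pose W xi := (enorm xi ^+ 2) `^ ga.
have WE xi : W xi = enorm xi `^ (2 * ga).
  by rewrite powRrM (powR_mulrn 2 (enorm_ge0 xi)).
have mW : measurable_fun setT W.
  have -> : W = fun xi => enorm xi `^ (2 * ga) by apply/funext.
  exact: measurable_enorm_powR.
pose gk xi := g xi * gauss_kernel X t xi.
have igk : cinteg mu gk.
  by apply: cintegM_L2 => //; [exact: cmeas_gauss_kernel|exact: gauss_kernel_L2].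
have mgk := cinteg_meas igk.
pose D xi := W xi * normc (gk xi).
have D0 xi : 0 <= D xi by rewrite mulr_ge0 ?powR_ge0 ?normc_ge0.
have iT (s : R) : 0 < s -> rinteg mu (fun xi => W xi * normc (g xi * gauss_kernel X s xi)).
  move=> s0; have [C3 C30 hC3] := normc_gauss_kernel_le N s0 hIm.
  have i1 := rintegZ C3 (rinteg_fraclap_weight (ltW ga0) gaN mg ig).
  apply: rinteg_le i1.
    by apply: measurable_funM => //; apply: cmeas_normc; apply: cmeasM => //; exact: cmeas_gauss_kernel.
  move=> xi; rewrite ger0_norm; last by rewrite mulr_ge0 ?powR_ge0 ?normc_ge0.
  rewrite normcM WE [leRHS]mulrCA [leLHS]mulrA; apply: ler_wpM2l => //.
  by rewrite mulr_ge0 ?powR_ge0 ?normc_ge0.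
have iD : rinteg mu D by exact: iT.
pose k xi tau := neg_ind tau * heat_weight ga (enorm xi ^+ 2) tau.
(* Integrated over tau first, [F] gives the part I(|xi|^2) of the original integrand; integrated
   over xi first, it gives the heat extension of (-Delta)^ga f at the times t + exp(tau). *)
pose F (p : E * measurableTypeR R) := gk p.1 * (k p.1 p.2)%:C.
have kB xi tau : k xi tau = W xi * B tau * expR (- (enorm xi ^+ 2 * expR tau)).
  by rewrite /k /heat_weight /B /W expRD; ring.
have nF xi tau : normc (F (xi, tau)) <= D xi * B tau.
  rewrite /F normcM normc_real/= kB ger0_norm; last first.
    by rewrite !mulr_ge0 ?powR_ge0 ?expR_ge0.
  rewrite [leRHS](_ : _ = normc (gk xi) * (W xi * B tau * 1)); last by rewrite /D; ring.
  rewrite ler_wpM2l ?normc_ge0// ler_wpM2l ?mulr_ge0 ?powR_ge0//.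
  by rewrite -expR0 ler_expR oppr_le0 mulr_ge0 ?sqr_ge0 ?expR_ge0.
have mF : cmeas F.
  apply: cmeasM; first by apply: (cmeas_comp mgk); exact: measurable_fst.
  apply: cmeas_real; under eq_fun do rewrite kB.
  apply: measurable_funM; first apply: measurable_funM.
  - exact: (measurableT_comp mW measurable_fst).
  - exact: (measurableT_comp mB measurable_snd).
  apply: (measurableT_comp (@measurable_expR R)); apply: measurable_funN.
  apply: measurable_funM.
    apply: measurable_funX; exact: (measurableT_comp (@measurable_enorm R n) measurable_fst).
  exact: (measurableT_comp (@measurable_expR R) measurable_snd).
have iF : cinteg (mu \x L)%E F.
  apply: (@cinteg_le _ (E * measurableTypeR R)%type R (mu \x L)%E F (fun p => D p.1 * B p.2) mF).
    by case=> xi tau; exact: nF.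
  exact: rinteg_tensor.
have i2 xi : cinteg L (fun tau => F (xi, tau)).
  apply: (@cinteg_le _ (measurableTypeR R) R L _ (fun tau => D xi * B tau)) => //.
    by apply: (cmeas_comp mF); exact: measurable_pair1.
  exact: rintegZ.
have i1 tau : cinteg mu (fun xi => F (xi, tau)).
  apply: (@cinteg_le _ _ R mu _ (fun xi => D xi * B tau)) => //.
    by apply: (cmeas_comp mF); exact: measurable_pair2.
  by have := rintegZ (B tau) iD; apply: eq_integrable => // xi _ /=; rewrite mulrC.
have [j1 j2 e] := cfubini iF i2 i1.
have inner1 xi : cint L (fun tau => F (xi, tau)) = gk xi * (heat_part ga (enorm xi ^+ 2))%:C.
  have ik := rinteg_neg_heat_weight ga0 (sqr_ge0 (enorm xi)).
  have ick : cinteg L (fun tau => (k xi tau)%:C) by split => //=; exact: integrable0.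
  rewrite /F/= (cintZ _ ick); congr (_ * _); apply: complex_eqP; rewrite /cint//=.
  by rewrite Rintegral_cst//= mul0r.
(* For tau < 0 the factor exp(- |xi|^2 exp(tau)) merges with the Gaussian into one at time t +
   exp(tau) <= 2, where [hC] applies. *)
have inner2 tau : normc (cint mu (fun xi => F (xi, tau))) <= C * B tau.
  have [tau0|tau0] := leP 0 tau.
    have b0 : neg_ind tau = 0 by rewrite neg_indE ltNge tau0.
    have -> : (fun xi => F (xi, tau)) = fun=> 0.
      by apply/funext => xi; rewrite /F/= /k b0 mul0r mulr0.
    by rewrite cint0 normc0 mulr_ge0.
  pose T xi := (enorm xi `^ (2 * ga))%:C * g xi * gauss_kernel X (t + expR tau) xi.
  have ts0 : 0 < t + expR tau by rewrite addr_gt0// expR_gt0.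
  have cT : cinteg mu T.
    apply: cintegP; first apply: cmeasM; first apply: cmeasM => //.
    - by apply: cmeas_real; exact: measurable_enorm_powR.
    - exact: cmeas_gauss_kernel.
    have := iT _ ts0; apply: eq_integrable => // xi _ /=.
    have -> : T xi = (enorm xi `^ (2 * ga))%:C * (g xi * gauss_kernel X (t + expR tau) xi).
      by rewrite /T mulrA.
    by rewrite [in RHS]normcM WE normc_real ger0_norm ?powR_ge0.
  have -> : (fun xi => F (xi, tau)) = fun xi => (B tau)%:C * T xi.
    apply/funext => xi; rewrite /F/= kB /T -gauss_kernelD WE /gk !rmorphM/=.
    move: (_%:C) (_%:C) (_%:C) (gauss_kernel _ _ _) => *; ring.
  rewrite (cintZ _ cT) normcM normc_real ger0_norm// mulrC ler_wpM2r//; apply: hC => //.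
  have : expR tau <= 1 by rewrite -expR0 ler_expR ltW.
  by move: (expR tau) => ? ?; lra.
(* The remainder J(|xi|^2) / Gamma(ga), which lies between 0 and 2^ga exp(- |xi|^2 / 2). *)
pose m xi : R := 1 - Ga^-1 * heat_part ga (enorm xi ^+ 2).
have j1' : cinteg mu (fun xi => gk xi * (heat_part ga (enorm xi ^+ 2))%:C).
  by move: j1; congr cinteg; apply/funext => xi; exact: inner1.
have mE : (fun xi => gk xi * (m xi)%:C) =
    fun xi => gk xi - (Ga^-1)%:C * (gk xi * (heat_part ga (enorm xi ^+ 2))%:C).
  by apply/funext => xi; rewrite /m rmorphB rmorphM/=; ring.
have im : cinteg mu (fun xi => gk xi * (m xi)%:C).
  by rewrite mE; apply: cintegB => //; exact: cintegZ.
have -> : cint mu gk = cint mu (fun xi => gk xi * (m xi)%:C) +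
    (Ga^-1)%:C * cint L (fun tau => cint mu (fun xi => F (xi, tau))).
  rewrite -e mE (cintB igk (cintegZ _ j1')) (cintZ _ j1').
  have -> : (fun xi => cint L (fun tau => F (xi, tau))) =
     fun xi => gk xi * (heat_part ga (enorm xi ^+ 2))%:C by apply/funext.
  by rewrite subrK.
apply: (le_trans (le_normcD _ _)); apply: lerD.
  rewrite -(rintZl _ iw); apply: le_normc_cint.
  - exact: (cinteg_meas im).
  - move=> xi; rewrite !normcM normc_real.
    have /andP[m0 m1] := heat_part_bound ga0 (sqr_ge0 (enorm xi)).
    have Gam : Ga * m xi = Ga - heat_part ga (enorm xi ^+ 2).
      by rewrite /m mulrBr mulr1 mulrA divff// mul1r.
    have {}m0 : 0 <= m xi by rewrite -(pmulr_rge0 _ G0) Gam.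
    have {}m1 : m xi <= 2 `^ ga * expR (- (enorm xi ^+ 2 / 2)).
      by rewrite -(ler_pM2l G0) Gam.
    rewrite ger0_norm//.
    have gm : normc (gauss_kernel X t xi) * expR (- (enorm xi ^+ 2 / 2)) <=
        C1 ^+ n * \prod_i (1 + xi 0 i ^+ 2)^-1.
      have -> : expR (- (enorm xi ^+ 2 / 2)) = \prod_i expR (- (2^-1 * xi 0 i ^+ 2)).
        by rewrite -expR_sum sqr_enorm /dotrV mulr_suml -sumrN; congr expR; apply: eq_bigr => i _; ring.
      have -> : C1 ^+ n * \prod_i (1 + xi 0 i ^+ 2)^-1 = \prod_i (C1 * (1 + xi 0 i ^+ 2)^-1).
        by rewrite big_split/= prodr_const card_ord.
      rewrite normc_gauss_kernel -big_split/=; apply: ler_prod => i _.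
      rewrite mulr_ge0 ?expR_ge0//=; apply: le_trans (hC1 (xi 0 i)).
      rewrite -expRD ler_expR.
      have : - Im (X i) * xi 0 i <= de * `|xi 0 i|.
        by rewrite (le_trans (ler_norm _))// normrM normrN ler_wpM2r.
      have : 0 <= t * xi 0 i ^+ 2 by rewrite mulr_ge0 ?sqr_ge0// ltW.
      lra.
    apply: (@le_trans _ _ (normc (g xi) * (2 `^ ga * (normc (gauss_kernel X t xi) *
       expR (- (enorm xi ^+ 2 / 2)))))).
      rewrite -mulrA ler_wpM2l ?normc_ge0// mulrCA ler_wpM2l ?normc_ge0//.
    rewrite [leRHS](_ : _ = normc (g xi) * (2 `^ ga * (C1 ^+ n * \prod_i (1 + xi 0 i ^+ 2)^-1))).
      by rewrite ler_wpM2l ?normc_ge0// ler_wpM2l ?powR_ge0.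
    by ring.
  - exact: rintegZ.
rewrite normcM normc_real ger0_norm ?invr_ge0 ?(ltW G0)// ler_wpM2l ?invr_ge0 ?(ltW G0)//.
rewrite -(rintZl _ iB); apply: le_normc_cint => //.
- exact: (cinteg_meas j2).
- exact: rintegZ.
Qed.

End heat_bound.

(** * Taylor remainder and Cauchy estimates *)

Section taylor.
Context {R : realType}.
Local Open Scope complex_scope.
Implicit Types (u z : R[i]) (m : nat).

Definition exp_taylor m u : R[i] := \sum_(k < m) (k`!%:R^-1)%:C * u ^+ k.

Lemma cderiveD (f g : R -> R[i]) (x : R) (a b : R[i]) : cderive f x a -> cderive g x b ->
  cderive (fun y => f y + g y) x (a + b).
Proof.
move=> [f1 f2] [g1 g2]; split; under eq_fun do rewrite cReImE; rewrite cReImE;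
  exact: is_derive_D.
Qed.

Lemma cderiveZr (h : R -> R) (x a : R) (c : R[i]) : is_derive x 1 h a ->
  cderive (fun y => (h y)%:C * c) x (a%:C * c).
Proof.
move=> dh; have dc : cderive (fun=> c) x 0 by split => /=; exact: is_derive_cst.
by apply: (cderive_eq (cderiveM (cderive_real dh) dc)); rewrite mulr0 addr0.
Qed.

Lemma cderive_exp_taylor m u (x : R) :
  cderive (fun s => exp_taylor m.+1 (s%:C * u)) x (u * exp_taylor m (x%:C * u)).
Proof.
elim: m => [|m IH].
  rewrite /exp_taylor big_ord0 mulr0; under eq_fun do rewrite big_ord1 expr0.
  by split => /=; exact: is_derive_cst.
rewrite [X in _ * X]/exp_taylor big_ord_recr/= mulrDr.
have -> : (fun s : R => exp_taylor m.+2 (s%:C * u)) = fun s : R => exp_taylor m.+1 (s%:C * u) +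
    (s ^+ m.+1)%:C * ((m.+1`!%:R^-1)%:C * u ^+ m.+1).
  apply/funext => s; rewrite {1}/exp_taylor big_ord_recr/=; congr (_ + _).
  by rewrite exprMn rmorphXn/= mulrCA mulrA.
apply: cderiveD => //.
apply: (cderive_eq (cderiveZr _ (is_derive_pow m.+1 (is_derive_id x 1)))).
rewrite mulr1/= exprMn rmorphM rmorphXn/= factS natrM invfM rmorphM/= exprS.
have -> : (m.+1%:R)%:C = (m.+1%:R : R[i]) by rewrite rmorph_nat.
have -> : (m.+1%:R^-1)%:C = (m.+1%:R^-1 : R[i]) by rewrite fmorphV rmorph_nat.
have m0 : m.+1%:R != 0 :> R[i] by rewrite pnatr_eq0.
move: (m.+1%:R) m0 (_%:C) (x%:C ^+ m) (u ^+ m) => p m0 a b c.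
by field.
Qed.

(** Along the ray s u, the derivative of the remainder of order m + 1 is u times the remainder of
    order m. After a rotation, the mean value theorem integrates the bound of order m from s = 0,
    where the remainder vanishes. *)
Lemma cexp_taylor_scaled m u (s : R) : 0 <= s -> s <= 1 ->
  normc (cexp (s%:C * u) - exp_taylor m (s%:C * u)) <=
  normc u ^+ m / m`!%:R * expR (normc u) * s ^+ m.
Proof.
elim: m s => [|m IH] s s0 s1.
  rewrite /exp_taylor big_ord0 subr0 !expr0 mulr1 fact0 divr1 mul1r normc_cexp ler_expR.
  rewrite cReImE/= mul0r subr0 (le_trans (ler_norm _))// normrM ger0_norm//.
  by rewrite -[leRHS]mul1r; apply: ler_pM => //; exact: normRe_le.
apply: normc_le_rotate => c nc.
pose K := normc u ^+ m / m`!%:R * expR (normc u).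
pose D (y : R) := cexp (y%:C * u) - exp_taylor m.+1 (y%:C * u).
have dD (y : R) : cderive D y (u * (cexp (y%:C * u) - exp_taylor m (y%:C * u))).
  have d1 : cderive (fun y => cexp (y%:C * u)) y (u * cexp (y%:C * u)).
    apply: (cderive_eq (cderive_cexp (cderiveZr u (is_derive_id y 1)))).
    by rewrite mul1r.
  have [e1 e2] := cderive_exp_taylor m u y.
  have d2 : cderive (fun y : R => - exp_taylor m.+1 (y%:C * u)) y
      (- (u * exp_taylor m (y%:C * u))).
    by split; under eq_fun do rewrite cReImE; rewrite cReImE; exact: is_deriveN.
  by apply: (cderive_eq (cderiveD d1 d2)); rewrite mulrBr.
pose h (y : R) := normc u * K / m.+1%:R * y ^+ m.+1 - Re (c * D y).
pose h' (y : R) := normc u * K * y ^+ m -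
  Re (c * (u * (cexp (y%:C * u) - exp_taylor m (y%:C * u)))).
have dh (y : R) : is_derive y 1 h (h' y).
  have dc : cderive (fun=> c) y 0 by split => /=; exact: is_derive_cst.
  have [d1 _] := cderiveM dc (dD y).
  have d2 := is_derive_M (is_derive_cst (normc u * K / m.+1%:R) y 1)
    (is_derive_pow m.+1 (is_derive_id y 1)).
  apply: (is_derive_cst_eq (is_derive_D d2 (is_deriveN d1))).
  rewrite (mul0r (D y)) add0r /h' /cst; congr (_ - _).
  move: (y ^+ m.+1) => p; rewrite [m.+1.-1]/=; move: (y ^+ m) => q.
  have m0 : m.+1%:R != 0 :> R by rewrite pnatr_eq0.
  by move: (normc u) (m.+1%:R) m0 => b r r0; field.
have h0 : h 0 = 0.
  rewrite /h /D mul0r cexp0 /exp_taylor big_ord_recl/= big1 => [|i _].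
    by rewrite expr0 fact0 invr1 mulr1 addr0 subrr !mulr0 expr0n/= mulr0 subrr.
  by rewrite /= expr0n/= mulr0.
have [y] := MVT_segment s0 (fun y _ => dh y)
  (@continuous_subspaceT _ _ _ _ (derive_continuous dh)).
rewrite in_itv/= => /andP[y0 ys]; rewrite h0 !subr0 => hs.
have h'0 : 0 <= h' y.
  rewrite /h' subr_ge0 (le_trans (ler_norm _))// (le_trans (normRe_le _))//.
  rewrite !normcM nc mul1r -mulrA ler_wpM2l ?normc_ge0//.
  by apply: IH => //; exact: le_trans s1.
have : 0 <= h s by rewrite hs mulr_ge0.
rewrite /h subr_ge0 => /le_trans; apply.
rewrite /K factS natrM exprS invfM le_eqVlt; apply/orP; left; apply/eqP.
rewrite (exprS (normc u)); move: (m.+1%:R^-1) (m`!%:R^-1) (expR _) (s * _) => *; ring.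
Qed.

(** From (2 |u|)^m <= m! exp(2 |u|). The error is geometric in m at the price of exp(3 |u|), which a
    Gaussian weight can absorb. *)
Lemma cexp_taylor m u :
  normc (cexp u - exp_taylor m u) <= 2^-1 ^+ m * expR (3 * normc u).
Proof.
have := cexp_taylor_scaled m u ler01 (lexx 1).
rewrite expr1n mulr1 mul1r => /le_trans; apply.
have f0 : 0 < m`!%:R :> R by rewrite ltr0n fact_gt0.
have n0 := normc_ge0 u.
have := exprn_le_expR m (mulr_ge0 (ler0n R 2) n0); rewrite exprMn => h.
have -> : 3 * normc u = 2 * normc u + normc u by ring.
rewrite expRD [leRHS]mulrA ler_wpM2r ?expR_ge0// ler_pdivrMr//.
rewrite -mulrA exprVn ler_pdivlMl ?exprn_gt0//.
by rewrite [expR _ * _]mulrC.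
Qed.

End taylor.

Section cauchy.
Context {R : realType}.
Local Open Scope complex_scope.
Implicit Types (a : nat -> R[i]) (m k : nat).

Definition unity (N : nat) : R[i] := cexp (0 +i* (2 * pi / N%:R)).

Lemma unityX N k : unity N ^+ k = cexp (0 +i* (2 * pi * k%:R / N%:R)).
Proof.
elim: k => [|k IH]; first by rewrite expr0 mulr0 mul0r -[0 +i* 0]/(0 : R[i]) cexp0.
rewrite exprS IH /unity -cexpD; congr cexp; apply: complex_eqP; rewrite !cReImE/= ?addr0//.
by rewrite -addn1 natrD; ring.
Qed.

Lemma normc_unity N : normc (unity N) = 1.
Proof. by rewrite normc_cexp expR0. Qed.

Lemma unity_neq0 N : unity N != 0.
Proof. by rewrite -normc_eq0 normc_unity oner_eq0. Qed.

Lemma unityXN N : (0 < N)%N -> unity N ^+ N = 1.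
Proof.
move=> N0; rewrite unityX mulfK ?pnatr_eq0 -?lt0n// cexp_im.
have -> : 2 * pi = pi *+ 2 :> R by ring.
by rewrite cos2pi sin2pi.
Qed.

Lemma unityX_neq1 N k : (0 < k)%N -> (k < N)%N -> unity N ^+ k != 1.
Proof.
move=> k0 kN; have N0 : (0 < N)%N by exact: ltn_trans kN.
rewrite unityX cexp_im; apply/eqP => -[+ _]; set x : R := pi * k%:R / N%:R.
have -> : 2 * pi * k%:R / N%:R = x *+ 2 by rewrite /x; ring.
rewrite cos_mulr2n => h.
have p0 : 0 < pi :> R by exact: pi_gt0.
have : 0 < sin x.
  apply: sin_gt0_pi; rewrite /x divr_gt0 ?mulr_gt0 ?ltr0n//=.
  by rewrite ltr_pdivrMr ?ltr0n// ltr_pM2l// ltr_nat.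
have := cos2Dsin2 x; move: h; move: (cos x) (sin x) => c s; nra.
Qed.

(* Averaging over the m-th roots of unity extracts a coefficient. *)
Lemma cauchy_coef_le m a (rho B : R) j : 0 < rho -> (j < m)%N ->
  (forall s, normc s = rho -> normc (\sum_(k < m) a k * s ^+ k) <= B) ->
  normc (a j) * rho ^+ j <= B.
Proof.
move=> rho0 jm hB; have m0 : (0 < m)%N by exact: leq_ltn_trans jm.
set z := unity m; have z0 : z != 0 by exact: unity_neq0.
have E : \sum_(l < m) (z ^+ j) ^- l * (\sum_(k < m) a k * (rho%:C * z ^+ l) ^+ k) =
    m%:R * (a j * (rho ^+ j)%:C).
  under eq_bigr do rewrite mulr_sumr.
  rewrite exchange_big/= (bigD1 (Ordinal jm))//= [X in _ + X]big1 ?addr0 => [|k kj].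
    under eq_bigr => l _.
      have -> : (z ^+ j) ^- l * (a j * (rho%:C * z ^+ l) ^+ j) = a j * rho%:C ^+ j.
        rewrite exprMn -!exprM (mulnC l); have := expf_neq0 (j * l) z0.
        by move: (z ^+ (j * l)) => y y0; field.
      over.
    by rewrite sumr_const card_ord mulr_natl rmorphXn.
  have -> : \sum_(l < m) (z ^+ j) ^- l * (a k * (rho%:C * z ^+ l) ^+ k) =
      a k * rho%:C ^+ k * \sum_(l < m) (z ^+ k / z ^+ j) ^+ l.
    rewrite mulr_sumr; apply: eq_bigr => l _.
    rewrite exprMn expr_div_n -[(z ^+ l) ^+ k]exprM mulnC exprM; ring.
  set y := z ^+ k / z ^+ j.
  suff y1 : y != 1.
    have : (y - 1) * \sum_(l < m) y ^+ l = 0.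
      rewrite -subrX1 /y expr_div_n -!exprM ![(_ * m)%N]mulnC !exprM unityXN//.
      by rewrite !expr1n divr1 subrr.
    by move/eqP; rewrite mulf_eq0 subr_eq0 (negbTE y1)/= => /eqP ->; rewrite mulr0.
  rewrite /y; have kj' : nat_of_ord k != j by apply: contra_neq kj => kj; exact: val_inj.
  have [kj1|kj1|kj1] := ltngtP k j.
  - have jE : z ^+ j = z ^+ k * z ^+ (j - k) by rewrite -exprD subnKC// ltnW.
    apply: contra_neq (@unityX_neq1 m (j - k)%N _ _) => [h||].
    + by apply: (mulfI (expf_neq0 k z0)); rewrite -jE mulr1 -[LHS]mul1r -h divfK ?expf_neq0.
    + by rewrite subn_gt0.
    + by rewrite (leq_ltn_trans (leq_subr _ _)).
  - have kE : z ^+ k = z ^+ j * z ^+ (k - j) by rewrite -exprD subnKC// ltnW.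
    rewrite kE mulrAC divff ?expf_neq0// mul1r; apply: unityX_neq1.
    + by rewrite subn_gt0.
    + by rewrite (leq_ltn_trans (leq_subr _ _)).
  - by rewrite kj1 eqxx in kj'.
have m00 : 0 < m%:R :> R by rewrite ltr0n.
rewrite -(ler_pM2l m00).
have -> : m%:R * (normc (a j) * rho ^+ j) = normc (m%:R * (a j * (rho ^+ j)%:C) : R[i]).
  have -> : (m%:R : R[i]) = (m%:R)%:C by rewrite rmorph_nat.
  by rewrite !normcM !normc_real ger0_norm// ger0_norm// exprn_ge0// ltW.
rewrite -E (le_trans (le_normc_sum _ _ _))//.
have -> : m%:R * B = \sum_(l < m) B by rewrite sumr_const card_ord mulr_natl.
apply: ler_sum => l _; rewrite normcM normcV !normcX normc_unity !expr1n invr1 mul1r.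
by apply: hB; rewrite normcM normcX normc_unity expr1n mulr1 normc_real gtr0_norm.
Qed.

(* Cauchy's estimate on the circle of radius rho for the first K coefficients, and on
   the unit circle for the others. *)
Lemma power_series_half_le (p : R[i] -> R[i]) a (M S rho : R) (K : nat) :
  (forall e : R, 0 < e -> exists m0, forall m, (m0 <= m)%N -> forall s, normc s <= 1 ->
    normc (p s - \sum_(k < m) a k * s ^+ k) <= e) ->
  0 < rho -> rho <= 1 ->
  (forall s, normc s = 1 -> normc (p s) <= M) ->
  (forall s, normc s = rho -> normc (p s) <= S) ->
  normc (p (2^-1)%:C) <= K%:R * (rho^-1 ^+ K * S) + 2 * M * 2^-1 ^+ K.
Proof.
move=> ap rho0 rho1 hM hS.
have coef r B : 0 < r -> r <= 1 -> (forall s, normc s = r -> normc (p s) <= B) ->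
    forall j, normc (a j) * r ^+ j <= B.
  move=> r0 r1 hB j; apply/ler_addgt0Pr => e e0; have [m0 hm0] := ap e e0.
  apply: (@cauchy_coef_le (maxn m0 j.+1) a r _ j r0); first by rewrite leq_max leqnn orbT.
  move=> s sr; have := hm0 (maxn m0 j.+1) (leq_maxl _ _) s.
  rewrite sr => /(_ r1) h.
  set q := \sum_(_ < _) _ in h *; have -> : q = p s - (p s - q) by rewrite opprB addrC subrK.
  by rewrite (le_trans (le_normcD _ _))// normcN lerD// hB.
have c1 j : normc (a j) <= M by have := coef 1 M ltr01 (lexx 1) hM j; rewrite expr1n mulr1.
have M0 : 0 <= M := le_trans (normc_ge0 _) (c1 0%N).
have c2 j : normc (a j) <= rho^-1 ^+ j * S.
  have := coef rho S rho0 rho1 hS j; rewrite mulrC => h.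
  by rewrite exprVn ler_pdivlMl ?exprn_gt0.
have S0 : 0 <= S by have := c2 0%N; rewrite expr0 mul1r; exact: le_trans (normc_ge0 _).
have v1 : 1 <= rho^-1 by rewrite invf_ge1.
have half : normc (2^-1)%:C = 2^-1 :> R by rewrite normc_real ger0_norm.
apply/ler_addgt0Pr => e e0; have [m0 hm0] := ap e e0.
pose m := maxn m0 K.
have h12 : normc (2^-1)%:C <= 1 :> R by rewrite half; lra.
have := hm0 m (leq_maxl _ _) _ h12; set q := \sum_(_ < _) _ => h.
have -> : p (2^-1)%:C = q + (p (2^-1)%:C - q) by rewrite addrC subrK.
rewrite (le_trans (le_normcD _ _))// lerD//.
have Km : (K <= m)%N by exact: leq_maxr.
rewrite (le_trans (le_normc_sum _ _ _))//.
under eq_bigr do rewrite normcM normcX half.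
rewrite -(big_mkord predT (fun k => normc (a k) * 2^-1 ^+ k)) (big_cat_nat (n := K))//=.
apply: lerD.
  rewrite big_mkord; have -> : K%:R * (rho^-1 ^+ K * S) = \sum_(i < K) (rho^-1 ^+ K * S).
    by rewrite sumr_const card_ord mulr_natl.
  apply: ler_sum => i _; apply: (@le_trans _ _ (normc (a i))).
    by rewrite ler_piMr ?normc_ge0// exprn_ile1//; lra.
  by apply: (le_trans (c2 i)); rewrite ler_wpM2r// ler_weXn2l// ltnW.
(* The geometric tail is written as a telescoping sum: M 2^(-k) = 2 M 2^(-k) - 2 M 2^(-k-1). *)
apply: (@le_trans _ _ (\sum_(K <= k < m) (- (2 * M * 2^-1 ^+ k.+1) - - (2 * M * 2^-1 ^+ k)))).
  apply: ler_sum => k _; rewrite exprS.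
  have -> : - (2 * M * (2^-1 * 2^-1 ^+ k)) - - (2 * M * 2^-1 ^+ k) = M * 2^-1 ^+ k by field.
  by rewrite ler_wpM2r// exprn_ge0//; lra.
rewrite telescope_sumr// opprK addrC gerBl mulr_ge0 ?mulr_ge0// exprn_ge0//; lra.
Qed.

End cauchy.

(** * Decay of the heat extension at a point of infinite order vanishing *)

Section heat_decay.
Context {R : realType} {n : nat}.
Notation L := (@lebesgue_measure R).
Notation E := 'rV[R]_n.
Notation mu := (lebesgue_rV R n).
Local Open Scope complex_scope.
Implicit Types (X : 'I_n -> R[i]) (xi z : E).

Definition ball_mass (f : E -> R[i]) z (r : R) : R :=
  \int[mu]_x (\1_(eball z r) x * normc (f x)).

Definition flat_at (f : E -> R[i]) z := forall k : nat, exists C r0 : R,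
  [/\ 0 <= C, 0 < r0 & forall r, 0 < r -> r < r0 -> ball_mass f z r <= C * r ^+ k].

Lemma rinteg_ball_mass (f : E -> R[i]) z (r : R) : cmeas f ->
  rinteg mu (fun x => normc (f x) ^+ 2) ->
  rinteg mu (fun x => \1_(eball z r) x * normc (f x)).
Proof.
move=> mf if2; have ie := rinteg_eball z r.
apply: rintegM_L2 => //; [exact: rinteg_meas ie|exact: cmeas_normc|].
have := ie; apply: eq_integrable => // x _ /=.
by rewrite indicE; case: (_ \in _); rewrite ?expr1n ?expr0n.
Qed.

Lemma flat_atP (f : E -> R[i]) z : vanishes_infinite_order f z -> flat_at f z.
Proof.
move=> v k; have := v k; rewrite eqOP => -[C0 [C0r hC]].
pose C := Num.max 0 (C0 + 1).
have /hC : C0 < C by rewrite lt_max; apply/orP; right; rewrite ltrDl.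
move=> /nbhs_ballP[r0/= r00 h]; exists C, r0; split => //.
  by rewrite le_max lexx.
move=> r r_gt0 rr0; have := h r; rewrite /ball/= sub0r normrN gtr0_norm// => /(_ rr0 r_gt0).
rewrite (ger0_norm (exprn_ge0 _ (ltW r_gt0))); apply: le_trans.
suff -> : ball_mass f z r = \int[mu]_(x in eball z r) normc (f x) by exact: ler_norm.
rewrite [RHS]Rintegral_mkcond; apply: eq_Rintegral => x _.
by rewrite patchE indicE; case: (_ \in _); rewrite ?mul1r ?mul0r.
Qed.

(** With t = r^4 <= 1, the imaginary parts satisfy Im^2 <= t and cost a bounded factor. Outside the
    ball the exponent, about - |y - z|^2 / (8 t), is split in two: one half is at least 1 / (16 r^2)
    in absolute value, the other gives a Gaussian in y that does not depend on r. *)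
Lemma normc_heat_kernel_le X z (r : R) (y : E) : 0 < r -> r < 1 ->
  (forall i, normc (X i - (z 0 i)%:C) <= r ^+ 4) ->
  normc (heat_kernel X (r ^+ 4) y) <= expR n%:R * \1_(eball z r) y +
   expR (2 * n%:R) * (expR (- (16^-1 / r ^+ 2)) * \prod_i expR (- (16^-1 * (y 0 i - z 0 i) ^+ 2))).
Proof.
move=> r0 r1 hX; set t := r ^+ 4; have t0 : 0 < t by rewrite exprn_gt0.
have t1 : t <= 1 by rewrite exprn_ile1// ltW.
have hIm i : Im (X i) ^+ 2 <= t.
  have : `|Im (X i)| <= t.
    apply: le_trans (hX i); apply: le_trans (normIm_le _).
    by case: (X i) => a b /=; rewrite subr0.
  rewrite -(real_normK (num_real (Im (X i)))); have := normr_ge0 (Im (X i)); nra.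
have hRe i : `|Re (X i) - z 0 i| <= t.
  apply: le_trans (hX i); apply: le_trans (normRe_le _).
  by case: (X i) => a b.
rewrite normc_heat_kernel//; have [yb|yb] := pselect (eball z r y).
  rewrite indicE mem_set// mulr1 ler_wpDr//.
    by rewrite !mulr_ge0 ?expR_ge0//; apply: prodr_ge0 => i _; rewrite expR_ge0.
  have -> : expR n%:R = \prod_(i < n) expR (1 : R).
    by rewrite prodr_const card_ord -expRM_natl mulr1.
  apply: ler_prod => i _; rewrite expR_ge0/= ler_expR ler_pdivrMr ?mulr_gt0//.
  by have := hIm i; have := sqr_ge0 (Re (X i) - y 0 i); lra.
rewrite indicE memNset// mulr0 add0r.
have hd i : - ((Re (X i) - y 0 i) ^+ 2 - Im (X i) ^+ 2) / (4 * t) <=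
    2 + - (16^-1 / t * (y 0 i - z 0 i) ^+ 2) + - (16^-1 * (y 0 i - z 0 i) ^+ 2).
  have h1 := hIm i; have h2 := hRe i.
  move: h1 h2; move: (Re (X i)) (Im (X i)) (y 0 i) (z 0 i) => a b v w h1 h2.
  have h3 : (a - w) ^+ 2 <= t.
    by move: h2; rewrite -(real_normK (num_real (a - w))); have := normr_ge0 (a - w); nra.
  have h4 : (v - w) ^+ 2 <= 2 * (a - v) ^+ 2 + 2 * t.
    by have := sqr_ge0 (a - v + (a - w)); lra.
  rewrite ler_pdivrMr ?mulr_gt0//.
  have -> : (2 + - (16^-1 / t * (v - w) ^+ 2) + - (16^-1 * (v - w) ^+ 2)) * (4 * t) =
    8 * t - (v - w) ^+ 2 / 4 - t * (v - w) ^+ 2 / 4 by field; lra.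
  have : t * (v - w) ^+ 2 <= (v - w) ^+ 2 by rewrite ler_piMl ?sqr_ge0.
  lra.
apply: (@le_trans _ _ (\prod_i (expR 2 * expR (- (16^-1 / t * (y 0 i - z 0 i) ^+ 2)) *
    expR (- (16^-1 * (y 0 i - z 0 i) ^+ 2))))).
  by apply: ler_prod => i _; rewrite expR_ge0/= -!expRD ler_expR.
rewrite !big_split/= prodr_const card_ord -expRM_natr -mulrA ler_wpM2l ?expR_ge0//.
rewrite ler_wpM2r//; first by apply: prodr_ge0 => i _; rewrite expR_ge0.
rewrite -expR_sum ler_expR sumrN lerN2 -mulr_sumr.
have -> : \sum_(i < n) (y 0 i - z 0 i) ^+ 2 = enorm (y - z) ^+ 2.
  by rewrite sqr_enorm; apply: eq_bigr => i _; rewrite !mxE expr2.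
have -> : 16^-1 / r ^+ 2 = 16^-1 / t * r ^+ 2 by rewrite /t; field; rewrite gt_eqF.
rewrite ler_wpM2l ?divr_ge0// ?(ltW t0)//.
by rewrite lerXn2r ?nnegrE ?enorm_ge0 ?(ltW r0)// leNgt; apply/negP.
Qed.

(* The Gaussian at time r^4 has width r^2, so it is negligible outside the ball of
   radius r as r tends to 0. *)
Lemma heat_decay (f g : E -> R[i]) z : is_fourierL2 f g -> flat_at f z ->
  forall k : nat, exists C r0 : R, [/\ 0 <= C, 0 < r0 & forall r X, 0 < r -> r < r0 ->
    (forall i, normc (X i - (z 0 i)%:C) <= r ^+ 4) ->
    normc (cint mu (fun xi => g xi * gauss_kernel X (r ^+ 4) xi)) <= C * r ^+ (4 * k)].
Proof.
move=> fg fz k; have [/memL2P[mf if2] _ _] := fg.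
(* The additional order 2 n pays for the factor sqrt(pi / t)^n <= 2^n r^(-2 n); the exponent [m]
   below, with 2 m = 4 k + 2 n, is chosen for the same reason. *)
have [C [r0 [C0 r00 hC]]] := fz (4 * k + 2 * n)%N.
pose G (y : E) : R := \prod_i expR (- (16^-1 * (y 0 i - z 0 i) ^+ 2)).
have G0 y : 0 <= G y by apply: prodr_ge0 => i _; rewrite expR_ge0.
pose G1 (w y : R) : R := expR (- (16^-1 * (y - w) ^+ 2)).
have mG1 w : measurable_fun setT (G1 w).
  apply: (measurableT_comp (@measurable_expR R)); apply: measurable_funN.
  apply: measurable_funM => //; apply: measurable_funX.
  by apply: measurable_funB => //; exact: measurable_cst.
have iG1 w : rinteg L (fun y => G1 w y ^+ 2).
  have e8 : 0 < 8^-1 :> R by rewrite invr_gt0.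
  have [D D0 hD] := poly_gauss_le 0 (`|w| / 4) e8.
  apply: (@rinteg_decay _ _ D) => [|y]; first exact: measurable_funX.
  rewrite ger0_norm ?sqr_ge0//; apply: le_trans (hD y).
  rewrite expr0 mul1r /G1 -expRM_natl ler_expR.
  have : w * y <= `|w| * `|y| by rewrite -normrM ler_norm.
  by have := sqr_ge0 w; lra.
have mG : measurable_fun setT G.
  by rewrite /G; apply: measurable_prodr => i; exact: (measurable_coord i (mG1 (z 0 i))).
have iG2 : rinteg mu (fun y => G y ^+ 2).
  have := @rinteg_prodrV R n (fun i y => G1 (z 0 i) y ^+ 2) (fun i => iG1 _).
  by apply: eq_integrable => // y _ /=; rewrite prodrXl.
have iFG := rintegM_L2 (cmeas_normc mf) mG if2 iG2.
pose I := \int[mu]_y (normc (f y) * G y).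
have I0 : 0 <= I by apply: Rintegral_ge0 => y _; rewrite mulr_ge0 ?normc_ge0.
pose m := (2 * k + n)%N.
exists (2 ^+ n * (expR n%:R * C + expR (2 * n%:R) * (m`!%:R * 16^-1^-1 ^+ m) * I)).
exists (Num.min 1 r0); split.
- by rewrite mulr_ge0 ?exprn_ge0// addr_ge0 ?mulr_ge0 ?expR_ge0// exprn_ge0.
- by rewrite lt_min ltr01.
move=> r X r_gt0; rewrite lt_min => /andP[r1 rr0] hX.
set t := r ^+ 4; have t0 : 0 < t by rewrite exprn_gt0.
rewrite (heat_extension X fg t0) normcM normc_real ger0_norm ?exprn_ge0 ?sqrtr_ge0//.
have c1 : Num.sqrt (pi / t) ^+ n <= 2 ^+ n * r^-1 ^+ (2 * n).
  have ri0 : 0 <= r^-1 ^+ 2 by rewrite sqr_ge0.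
  rewrite exprM -exprMn lerXn2r ?nnegrE ?sqrtr_ge0 ?(mulr_ge0 _ ri0)//.
  have -> : 2 * r^-1 ^+ 2 = Num.sqrt ((2 * r^-1 ^+ 2) ^+ 2).
    by rewrite sqrtr_sqr ger0_norm// mulr_ge0.
  rewrite ler_wsqrtr// exprMn -exprM exprVn.
  by rewrite ler_wpM2r ?invr_ge0 ?(ltW t0)//; have /andP[_] := pihalf_02 R; lra.
have ib := rinteg_ball_mass z r mf if2.
have nb : normc (cint mu (fun y => f y * heat_kernel X t y)) <=
   expR n%:R * ball_mass f z r + expR (2 * n%:R) * expR (- (16^-1 / r ^+ 2)) * I.
  have j1 := rintegZ (expR n%:R) ib.
  have j2 := rintegZ (expR (2 * n%:R) * expR (- (16^-1 / r ^+ 2))) iFG.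
  rewrite /ball_mass /I -(rintZl _ ib) -(rintZl _ iFG) -(rintD j1 j2).
  apply: le_normc_cint.
  - apply: cmeasM => //; apply: cmeas_prod => i; apply: cmeas_cexp.
    under eq_fun do rewrite expr2.
    apply: cmeasM; last exact: cmeas_cst.
    by apply: cmeasN; apply: cmeasM; (apply: cmeasB; [exact: cmeas_cst|];
      apply: cmeas_real; exact: measurable_id_coord).
  - move=> y; rewrite normcM.
    apply: le_trans (ler_wpM2l (normc_ge0 _) (normc_heat_kernel_le y r_gt0 r1 hX)) _.
    by rewrite le_eqVlt; apply/orP; left; apply/eqP; rewrite /G; ring.
  - exact: rintegD.
have e1 : expR (- (16^-1 / r ^+ 2)) <= m`!%:R * 16^-1^-1 ^+ m * (r ^+ 2) ^+ m.
  have h16 : 0 < 16^-1 :> R by rewrite invr_gt0.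
  have r20 : 0 < r ^+ 2 by rewrite exprn_gt0.
  have := inv_pow_exp_le m h16 r20.
  by rewrite (exprVn (r ^+ 2)) ler_pdivrMl ?exprn_gt0// [leRHS]mulrC.
apply: le_trans (ler_pM _ _ c1 nb) _; rewrite ?exprn_ge0 ?sqrtr_ge0 ?normc_ge0//.
have rE : r^-1 ^+ (2 * n) * (r ^+ 2) ^+ m = r ^+ (4 * k).
  rewrite -exprM /m mulnDr exprD mulnA mulrC -mulrA exprVn mulfV ?mulr1//.
  by rewrite expf_neq0// gt_eqF.
have rE' : r^-1 ^+ (2 * n) * r ^+ (4 * k + 2 * n) = r ^+ (4 * k).
  rewrite exprD mulrC -mulrA exprVn mulfV ?mulr1//.
  by rewrite expf_neq0// gt_eqF.
rewrite -[leLHS]mulrA -[leRHS]mulrA ler_wpM2l ?exprn_ge0//.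
have v0 : 0 <= r^-1 ^+ (2 * n) by rewrite exprn_ge0// invr_ge0 ltW.
rewrite mulrDr [leRHS]mulrDl; apply: lerD.
  apply: (@le_trans _ _ (r^-1 ^+ (2 * n) * (expR n%:R * (C * r ^+ (4 * k + 2 * n))))).
    by rewrite ler_wpM2l// ler_wpM2l ?expR_ge0// hC.
  by rewrite le_eqVlt -rE'; apply/orP; left; apply/eqP; ring.
apply: (@le_trans _ _ (r^-1 ^+ (2 * n) * (expR (2 * n%:R) * (m`!%:R * 16^-1^-1 ^+ m * (r ^+ 2) ^+ m) * I))).
  by rewrite ler_wpM2l// ler_wpM2r// ler_wpM2l ?expR_ge0.
by rewrite le_eqVlt -rE; apply/orP; left; apply/eqP; ring.
Qed.

(** The uniform bound M controls the Taylor coefficients of high order and [heat_decay] the first K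
    ones. K depends on e only, so it is fixed before r tends to 0. *)
Lemma heat_vanish (f g : E -> R[i]) z (de M : R) (w : 'I_n -> R) :
  is_fourierL2 f g -> flat_at f z -> de <= 1 -> (forall i, `|w i| <= de) ->
  (forall t X, 0 < t -> t <= 1 -> (forall i, normc (X i - (z 0 i)%:C) <= de) ->
    normc (cint mu (fun xi => g xi * gauss_kernel X t xi)) <= M) ->
  forall e : R, 0 < e -> exists2 r0 : R, 0 < r0 & forall r, 0 < r -> r < r0 ->
  normc (cint mu (fun xi => g xi *
    gauss_kernel (fun i => (z 0 i + 2^-1 * w i)%:C) (r ^+ 4) xi)) <= e.
Proof.
move=> fg fz de1 hw hM e e0; have [_ /memL2P[mg ig2] _] := fg.
have M0 : 0 <= M.
  have hX (i : 'I_n) : normc ((z 0 i)%:C - (z 0 i)%:C) <= de.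
    by rewrite subrr normc0 (le_trans (normr_ge0 _) (hw i)).
  exact: le_trans (normc_ge0 _) (hM 1 (fun i => (z 0 i)%:C) ltr01 (lexx 1) hX).
(* As x < K implies x < 2^K, this makes the tail [2 * M * 2^-1 ^+ K] at most e / 2. *)
pose K := Num.bound (4 * M / e).
have MK : 2 * M * 2^-1 ^+ K <= e / 2.
  have MK : 4 * M / e < 2 ^+ K.
    apply: lt_trans (archi_boundP _) _; first by rewrite divr_ge0 ?mulr_ge0// ltW.
    by rewrite -natrX ltr_nat ltn_expl.
  rewrite exprVn ler_pdivrMr ?exprn_gt0//.
  by move: MK; rewrite ltr_pdivrMr// mulrC; lra.
(* The order K + 1 leaves a spare factor t = r^4 after the division by t^K in Cauchy's estimate on
   the circle of radius t. *)
have [C [r1 [C0 r10 hC]]] := heat_decay fg fz K.+1.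
have KC0 : 0 <= K%:R * C :> R by rewrite mulr_ge0.
exists (Num.min 1 (Num.min r1 (e / 2 / (K%:R * C + 1)))).
  by rewrite !lt_min ltr01 r10 !divr_gt0//; lra.
move=> r r_gt0; rewrite !lt_min => /and3P[rlt1 rr1 rKC].
set t := r ^+ 4; have t0 : 0 < t by rewrite exprn_gt0.
have t1 : t <= 1 by rewrite exprn_ile1// ltW.
(* Restricting to the complex line z + s w leaves a power series in the single variable s, bounded
   by M for |s| = 1 and small for |s| = t. *)
pose X (s : R[i]) i := (z 0 i)%:C + s * (w i)%:C.
pose p s := cint mu (fun xi => g xi * gauss_kernel (X s) t xi).
pose dw (xi : E) := \sum_i w i * xi 0 i.
pose gk xi := g xi * gauss_kernel (X 0) t xi.
have igk : cinteg mu gk.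
  by apply: cintegM_L2 => //; [exact: cmeas_gauss_kernel|exact: gauss_kernel_L2].
have mgk := cinteg_meas igk.
have XE s xi : g xi * gauss_kernel (X s) t xi = gk xi * cexp ('i * s * (dw xi)%:C).
  rewrite /gk -mulrA; congr (_ * _); rewrite /dw rmorph_sum mulr_sumr cexp_sum -big_split.
  apply: eq_bigr => i _ /=; rewrite -cexpD; congr cexp; rewrite /X mul0r addr0 rmorphM/=; ring.
have nu s xi : normc s <= 1 -> normc ('i * s * (dw xi)%:C) <= \sum_i `|w i| * `|xi 0 i|.
  move=> s1; rewrite !normcM normc_i mul1r normc_real.
  apply: (@le_trans _ _ (1 * `|dw xi|)); first exact: ler_wpM2r.
  rewrite mul1r (le_trans (ler_norm_sum _ _ _))//; apply: ler_sum => i _.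
  by rewrite normrM.
(* A majorant of the coefficients and, up to 2^(-m), of the remainder; the factor 3 is that of
   [cexp_taylor]. It is integrable because the Gaussian absorbs the exponential. *)
pose A xi := normc (gk xi) * expR (3 * \sum_i `|w i| * `|xi 0 i|).
have A0 xi : 0 <= A xi by rewrite mulr_ge0 ?normc_ge0 ?expR_ge0.
have mdw : measurable_fun setT dw.
  have -> : dw = fun xi => dotrV (\row_i w i) xi.
    by apply/funext => xi; apply: eq_bigr => i _; rewrite mxE.
  by apply: measurable_dotrV; [exact: measurable_cst|exact: measurable_id].
have mS : measurable_fun setT (fun xi : E => \sum_i `|w i| * `|xi 0 i|).
  have -> : (fun xi : E => \sum_i `|w i| * `|xi 0 i|) =
      fun xi => dotrV (\row_i `|w i|) (\row_i `|xi 0 i|).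
    by apply/funext => xi; apply: eq_bigr => i _; rewrite !mxE.
  apply: measurable_dotrV; first exact: measurable_cst.
  apply: measurable_fun_rVP => i; under eq_fun do rewrite mxE.
  exact: (measurableT_comp (@normr_measurable R setT) (measurable_id_coord i)).
have iA : rinteg mu A.
  have [D D0 hD] := poly_gauss_le 0 3 t0.
  have := rintegZ (D ^+ n) (rinteg_L2_weight mg ig2); apply: rinteg_le.
    apply: measurable_funM; first exact: cmeas_normc.
    apply: (measurableT_comp (@measurable_expR R)).
    by apply: measurable_funM => //; exact: measurable_cst.
  move=> xi; rewrite ger0_norm// /A normcM -mulrA [leRHS]mulrCA.
  apply: ler_wpM2l; first exact: normc_ge0.
  have -> : D ^+ n * \prod_i (1 + xi 0 i ^+ 2)^-1 = \prod_i (D * (1 + xi 0 i ^+ 2)^-1).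
    by rewrite big_split/= prodr_const card_ord.
  rewrite normc_gauss_kernel mulr_sumr expR_sum -big_split/=; apply: ler_prod => i _.
  rewrite mulr_ge0 ?expR_ge0//=; apply: le_trans (hD (xi 0 i)).
  (* This is the imaginary part of [X 0 i], as it unfolds. *)
  have -> : 0 + (0 * 0 + 0 * w i) = 0 :> R by ring.
  rewrite expr0 mul1r -expRD ler_expR oppr0 mul0r.
  have : `|w i| * `|xi 0 i| <= `|xi 0 i| by rewrite ler_piMl// (le_trans (hw i)).
  lra.
pose a k := cint mu (fun xi => gk xi * ((k`!%:R^-1)%:C * ('i * (dw xi)%:C) ^+ k)).
have ia k : cinteg mu (fun xi => gk xi * ((k`!%:R^-1)%:C * ('i * (dw xi)%:C) ^+ k)).
  apply: (cinteg_le (h := A)) => //.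
    apply: cmeasM => //; apply: cmeasM; first exact: cmeas_cst.
    have mi : cmeas (fun xi => 'i * (dw xi)%:C).
      by apply: cmeasM; [exact: cmeas_cst|exact: cmeas_real].
    elim: k => [|k IH]; first by under eq_fun do rewrite expr0; exact: cmeas_cst.
    by under eq_fun do rewrite exprS; exact: cmeasM.
  move=> xi; rewrite normcM; apply: ler_wpM2l; first exact: normc_ge0.
  have := nu 1 xi; rewrite normc1 lexx mulr1 => /(_ isT).
  set u := 'i * _; set S := \sum_(_ < _) _ => h.
  have f0 : 0 < k`!%:R :> R by rewrite ltr0n fact_gt0.
  rewrite normcM normc_real normcX ger0_norm ?invr_ge0// ler_pdivrMl//.
  apply: (le_trans (exprn_le_expR k (normc_ge0 u))); rewrite ler_wpM2l ?(ltW f0)// ler_expR.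
  by have := le_trans (normc_ge0 u) h; lra.
have ip s : cinteg mu (fun xi => g xi * gauss_kernel (X s) t xi).
  by apply: cintegM_L2 => //; [exact: cmeas_gauss_kernel|exact: gauss_kernel_L2].
have ap (ep : R) : 0 < ep -> exists m0, forall m, (m0 <= m)%N -> forall s, normc s <= 1 ->
    normc (p s - \sum_(k < m) a k * s ^+ k) <= ep.
  move=> ep0; pose B := \int[mu]_xi A xi.
  have B0 : 0 <= B by apply: Rintegral_ge0 => xi _.
  exists (Num.bound (B / ep)) => m mB s s1.
  have isk (k : 'I_m) : cinteg mu (fun xi => s ^+ k * (gk xi * ((k`!%:R^-1)%:C * ('i * (dw xi)%:C) ^+ k))).
    exact: cintegZ.
  have [i1 e1] := cint_sum (index_enum 'I_m) isk.
  have -> : \sum_(k < m) a k * s ^+ k = cint mu (fun xi =>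
      \sum_(k < m) s ^+ k * (gk xi * ((k`!%:R^-1)%:C * ('i * (dw xi)%:C) ^+ k))).
    by rewrite e1; apply: eq_bigr => k _; rewrite (cintZ _ (ia k)) mulrC.
  rewrite -(cintB (ip s) i1).
  apply: (@le_trans _ _ (\int[mu]_xi (2^-1 ^+ m * A xi))).
    apply: le_normc_cint.
    - exact: (cinteg_meas (cintegB (ip s) i1)).
    - move=> xi; rewrite XE.
      have -> : \sum_(k < m) s ^+ k * (gk xi * ((k`!%:R^-1)%:C * ('i * (dw xi)%:C) ^+ k)) =
          gk xi * exp_taylor m ('i * s * (dw xi)%:C).
        rewrite mulr_sumr; apply: eq_bigr => k _; rewrite !exprMn; ring.
      rewrite -mulrBr normcM /A mulrCA; apply: ler_wpM2l; first exact: normc_ge0.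
      apply: (le_trans (cexp_taylor _ _)); rewrite ler_wpM2l ?exprn_ge0// ler_expR ler_pM2l//.
      exact: nu.
    - exact: rintegZ.
  rewrite (rintZl _ iA) exprVn ler_pdivrMl ?exprn_gt0// -ler_pdivrMr// ltW//.
  apply: lt_trans (archi_boundP _) _; first by rewrite divr_ge0// ltW.
  by rewrite -natrX ltr_nat (leq_ltn_trans mB)// ltn_expl.
have hX1 s : normc s <= 1 -> forall i, normc (X s i - (z 0 i)%:C) <= de.
  move=> s1 i; rewrite /X addrAC subrr add0r normcM normc_real.
  by apply: le_trans (hw i); rewrite ler_piMl.
have hp1 s : normc s = 1 -> normc (p s) <= M.
  by move=> s1; apply: hM => //; apply: hX1; rewrite s1.
have hp2 s : normc s = t -> normc (p s) <= C * r ^+ (4 * K.+1).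
  move=> st; apply: hC => // i; rewrite /X addrAC subrr add0r normcM normc_real st.
  by rewrite ler_piMr ?(ltW t0)// (le_trans (hw i)).
have -> : (fun i => (z 0 i + 2^-1 * w i)%:C) = X (2^-1)%:C.
  by apply/funext => i; rewrite /X rmorphD rmorphM.
have -> : cint mu (fun xi => g xi * gauss_kernel (X (2^-1)%:C) t xi) = p (2^-1)%:C by [].
apply: (le_trans (power_series_half_le K ap t0 t1 hp1 hp2)).
have -> : K%:R * (t^-1 ^+ K * (C * r ^+ (4 * K.+1))) = K%:R * C * r ^+ 4.
  have -> : r ^+ (4 * K.+1) = t * t ^+ K by rewrite exprM -/t exprS.
  have : t ^+ K != 0 by rewrite expf_neq0// gt_eqF.
  by rewrite exprVn -/t; move: (t ^+ K) => y y0; field.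
have : K%:R * C * r ^+ 4 <= e / 2.
  apply: (@le_trans _ _ ((K%:R * C + 1) * r)); last first.
    by move: rKC; rewrite ltr_pdivlMr 1?mulrC; [exact: ltW|lra].
  have : r ^+ 4 <= r by rewrite exprS ler_piMr ?(ltW r_gt0)// exprn_ile1// ltW.
  move: (K%:R * C) KC0 (r ^+ 4) => y y0 q qr; nra.
lra.
Qed.

End heat_decay.

(** * Recovering f from its heat extension *)

Section smear.
Context {R : realType}.
Notation L := (@lebesgue_measure R).

(** Half-open, to match the generators [ocitv] of the Borel sets of the line. *)
Definition box_ind (a b x : R) : R := \1_(`]a, b]%classic) x.

Lemma box_indE a b x : box_ind a b x = if (a < x <= b) then 1 else 0.
Proof.
rewrite /box_ind indicE; case: ifPn => h; first by rewrite mem_set//= in_itv.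
by rewrite memNset//= in_itv/=; exact/negP.
Qed.

Lemma box_ind_ge0 a b x : 0 <= box_ind a b x.
Proof. by rewrite box_indE; case: ifP. Qed.

Lemma box_ind_le1 a b x : box_ind a b x <= 1.
Proof. by rewrite box_indE; case: ifP. Qed.

Lemma measurable_box_ind a b : measurable_fun [set: measurableTypeR R] (box_ind a b).
Proof. exact: measurable_indic. Qed.

Lemma rinteg_box_ind a b : rinteg L (box_ind a b).
Proof. exact: integrable_indic_itv. Qed.

(** One real factor of [heat_kernel]: at time t = r^4 the width q = 2 r^2 satisfies q^2 = 4 t. *)
Definition gauss1 (q y x : R) : R := expR (- (x - y) ^+ 2 / q ^+ 2).

Definition second_moment : R := \int[L]_s (s ^+ 2 * expR (- s ^+ 2)).

Lemma second_moment_ge0 : 0 <= second_moment.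
Proof. by apply: Rintegral_ge0 => s _; rewrite mulr_ge0 ?sqr_ge0 ?expR_ge0. Qed.

Let cont_poly_gauss (m : nat) : continuous (fun s : R => (s ^+ 2) ^+ m * expR (- s ^+ 2)).
Proof.
move=> s; apply: cvgM.
  apply: (@continuous_comp _ _ _ (fun s : R => s ^+ 2) (fun s => s ^+ m)); exact: exprn_continuous.
apply: (@continuous_comp _ _ _ (fun s : R => - s ^+ 2) expR); last exact: continuous_expR.
by apply: cvgN; exact: exprn_continuous.
Qed.

Let rinteg_poly_gauss (m : nat) : rinteg L (fun s : R => (s ^+ 2) ^+ m * expR (- s ^+ 2)).
Proof.
have [C C0 hC] := poly_gauss_le m 0 (@ltr01 R).
apply: (@rinteg_decay _ _ C); first by apply: continuous_measurable_fun; exact: cont_poly_gauss.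
move=> s; have s0 := sqr_ge0 s.
have g0 : 0 <= (s ^+ 2) ^+ m * expR (- s ^+ 2) by rewrite mulr_ge0 ?expR_ge0// exprn_ge0.
rewrite (ger0_norm g0); refine (le_trans _ (hC s)).
rewrite mul0r mul1r sub0r ler_wpM2r ?expR_ge0// lerXn2r ?nnegrE ?addr_ge0 ?sqr_ge0//.
by rewrite lerDr.
Qed.

Lemma gauss1_moments q y : 0 < q ->
  [/\ rinteg L (gauss1 q y), \int[L]_x gauss1 q y x = q * Num.sqrt pi,
   rinteg L (fun x => (x - y) ^+ 2 * gauss1 q y x) &
   \int[L]_x ((x - y) ^+ 2 * gauss1 q y x) = q ^+ 3 * second_moment].
Proof.
move=> q0; have qi0 : 0 < q^-1 by rewrite invr_gt0.
have E (x : R) : - (q^-1 * x + - (y / q)) ^+ 2 = - (x - y) ^+ 2 / q ^+ 2 by field; lra.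
have [i0 e0] := Rintegral_affine (- (y / q)) qi0 (cont_poly_gauss (m := 0)) (rinteg_poly_gauss 0).
have [i1 e1] := Rintegral_affine (- (y / q)) qi0 (cont_poly_gauss (m := 1)) (rinteg_poly_gauss 1).
have h0 x : ((q^-1 * x + - (y / q)) ^+ 2) ^+ 0 * expR (- (q^-1 * x + - (y / q)) ^+ 2) = gauss1 q y x.
  by rewrite expr0 mul1r E.
have h1 x : q ^+ 2 * (((q^-1 * x + - (y / q)) ^+ 2) ^+ 1 * expR (- (q^-1 * x + - (y / q)) ^+ 2)) =
    (x - y) ^+ 2 * gauss1 q y x.
  rewrite expr1 E /gauss1 mulrA; congr (_ * _).
  by rewrite -exprMn mulrDr mulrN mulrA divff ?gt_eqF// mul1r mulrCA divff ?gt_eqF// mulr1.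
split.
- by move: i0; apply: eq_integrable => // x _ /=; rewrite h0.
- have := gauss_cos_integral (0 : R) 0.
  rewrite expr0n/= mul0r oppr0 expR0 cos0 !mulr1 => <-.
  have -> : \int[L]_x (expR (- x ^+ 2) * cos (0 * x + 0)) = \int[L]_x ((x ^+ 2) ^+ 0 * expR (- x ^+ 2)).
    by apply: eq_Rintegral => x _; rewrite expr0 mul1r mul0r addr0 cos0 mulr1.
  rewrite e0 mulrA mulfV ?mul1r ?gt_eqF//.
  by apply: eq_Rintegral => x _; rewrite h0.
- have := rintegZ (q ^+ 2) i1; apply: eq_integrable => // x _ /=.
  by rewrite h1.
- have -> : second_moment = \int[L]_x ((x ^+ 2) ^+ 1 * expR (- x ^+ 2)).
    by apply: eq_Rintegral => x _; rewrite expr1.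
  rewrite e1 exprS mulrA [q * _ * q^-1]mulrAC mulfV ?mul1r ?gt_eqF//.
  rewrite -(rintZl (q ^+ 2) i1); apply: eq_Rintegral => x _; exact/esym/h1.
Qed.

(** The convolution of the indicator with a Gaussian of mass 1. Integrating a heat extension over a
    box moves the smoothing from f to the indicator, where its limit is easy to control. *)
Definition smear (a b q y : R) : R :=
  (q * Num.sqrt pi)^-1 * \int[L]_x (box_ind a b x * gauss1 q y x).

Lemma rinteg_smear a b q y : 0 < q -> rinteg L (fun x => box_ind a b x * gauss1 q y x).
Proof.
move=> q0; have [i0 _ _ _] := gauss1_moments y q0; apply: (rinteg_le _ _ i0).
  by apply: measurable_funM; [exact: measurable_box_ind|exact: (rinteg_meas i0)].
move=> x; have g0 : 0 <= gauss1 q y x by exact: expR_ge0.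
by rewrite box_indE; case: ifP; rewrite ?mul1r ?mul0r ?normr0// ger0_norm.
Qed.

Lemma smear_norm_gt0 q : 0 < q -> 0 < q * Num.sqrt pi :> R.
Proof. by move=> q0; rewrite mulr_gt0// sqrtr_gt0 pi_gt0. Qed.

Lemma smear_ge0 a b q y : 0 < q -> 0 <= smear a b q y.
Proof.
move=> q0; rewrite mulr_ge0 ?invr_ge0 ?(ltW (smear_norm_gt0 q0))//.
by apply: Rintegral_ge0 => x _; rewrite mulr_ge0 ?box_ind_ge0 ?expR_ge0.
Qed.

(** From y^2 <= 2 x^2 + 2 (x - y)^2 and the second moment of the Gaussian. The bound is uniform in
    q, for use in dominated convergence. *)
Lemma smear_le a b B q y : (forall x, a < x <= b -> `|x| <= B) -> 0 < q -> q <= 2 ->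
  smear a b q y <= (1 + 2 * B ^+ 2 + 8 * second_moment / Num.sqrt pi) * (1 + y ^+ 2)^-1.
Proof.
move=> hB q0 q2; have [i0 e0 i1 e1] := gauss1_moments y q0.
have sp0 : 0 < Num.sqrt pi :> R by rewrite sqrtr_gt0 pi_gt0.
have u0 : 0 < 1 + y ^+ 2 by have := sqr_ge0 y; lra.
have m0 := second_moment_ge0.
rewrite ler_pdivlMr// -[leLHS]mulrA ler_pdivrMl ?smear_norm_gt0//.
rewrite -(rintZr _ (rinteg_smear a b y q0)).
have j0 := rintegZ (1 + 2 * B ^+ 2) i0; have j1 := rintegZ 2 i1.
apply: (@le_trans _ _ (\int[L]_x ((1 + 2 * B ^+ 2) * gauss1 q y x + 2 * ((x - y) ^+ 2 * gauss1 q y x)))).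
  apply: rint_le.
  - have := rintegZ (1 + y ^+ 2) (rinteg_smear a b y q0).
    by apply: eq_integrable => // x _ /=; rewrite mulrC.
  - exact: rintegD.
  move=> x; have g0 : 0 <= gauss1 q y x by exact: expR_ge0.
  rewrite mulrA -mulrDl mulrAC ler_wpM2r// box_indE; case: ifPn => [/hB xB|_].
    rewrite mul1r; have : x ^+ 2 <= B ^+ 2.
      by rewrite -(real_normK (num_real x)) lerXn2r ?nnegrE// (le_trans _ xB).
    have := sqr_ge0 (2 * x - y); lra.
  rewrite mul0r; have := sqr_ge0 (x - y); have := sqr_ge0 B; lra.
rewrite (rintD j0 j1) (rintZl _ i0) (rintZl _ i1) e0 e1.
have -> : q * Num.sqrt pi * (1 + 2 * B ^+ 2 + 8 * second_moment / Num.sqrt pi) =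
  (1 + 2 * B ^+ 2) * (q * Num.sqrt pi) + 2 * (q * 4 * second_moment) by field; lra.
rewrite lerD2l ler_wpM2l// ler_wpM2r// exprS ler_wpM2l ?(ltW q0)//.
have -> : 4 = 2 ^+ 2 :> R by ring.
by rewrite lerXn2r ?nnegrE// ltW.
Qed.

(** Chebyshev's inequality: where the indicator at x differs from its value at y, an endpoint lies
    between the two points, so |x - y| >= d. *)
Lemma smear_near a b q y d : 0 < q -> 0 < d -> d <= `|y - a| -> d <= `|y - b| ->
  `|smear a b q y - box_ind a b y| <= q ^+ 2 * (second_moment / (Num.sqrt pi * d ^+ 2)).
Proof.
move=> q0 d0 da db; have [i0 e0 i1 e1] := gauss1_moments y q0.
have sp0 : 0 < Num.sqrt pi :> R by rewrite sqrtr_gt0 pi_gt0.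
have N0 := smear_norm_gt0 q0.
have j0 := rintegZ (box_ind a b y) i0; have is_ := rinteg_smear a b y q0.
have d20 : 0 < d ^+ 2 by rewrite exprn_gt0.
have -> : smear a b q y - box_ind a b y = (q * Num.sqrt pi)^-1 *
    \int[L]_x (box_ind a b x * gauss1 q y x - box_ind a b y * gauss1 q y x).
  rewrite [X in _ * X]RintegralB// mulrBr (rintZl _ i0) e0 [box_ind a b y * _]mulrC.
  by rewrite mulKf// gt_eqF.
rewrite normrM gtr0_norm ?invr_gt0// ler_pdivrMl//.
have ib := rintegB is_ j0.
apply: (le_trans (le_normr_Rintegral _ ib)) => //.
apply: (@le_trans _ _ (\int[L]_x ((d ^+ 2)^-1 * ((x - y) ^+ 2 * gauss1 q y x)))).
  apply: rint_le; [exact: rinteg_norm|exact: rintegZ|] => x.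
  have g0 : 0 <= gauss1 q y x by exact: expR_ge0.
  rewrite -mulrBl normrM (ger0_norm g0) mulrA ler_wpM2r//.
  have [->|ne] := eqVneq (box_ind a b x) (box_ind a b y).
    by rewrite subrr normr0 mulr_ge0 ?sqr_ge0// invr_ge0 ltW.
  have dx : d <= `|x - y|.
    move: ne da db; rewrite !box_indE !ler_normr opprB.
    have [|] := boolP (a < x <= b); have [|] := boolP (a < y <= b) => //.
    - rewrite eqxx//.
    - rewrite negb_and -!leNgt -!ltNge => h1 /andP[h2 h3] _; case/orP: h1 => h1 /orP da /orP db.
        by apply/orP; case: da => da; [lra|left; lra].
      by apply/orP; case: db => db; [right; lra|lra].
    - move=> /andP[h2 h3]; rewrite negb_and -!leNgt -!ltNge => h1 _; case/orP: h1 => h1 /orP da /orP db.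
        by apply/orP; case: da => da; [right; lra|lra].
      by apply/orP; case: db => db; [lra|left; lra].
    - by rewrite eqxx.
  rewrite ler_pdivlMl//.
  have n1 : `|box_ind a b x - box_ind a b y| <= 1.
    by rewrite !box_indE; case: ifP; case: ifP; rewrite ?subrr ?normr0 ?subr0 ?sub0r ?normrN ?normr1.
  apply: (@le_trans _ _ (d ^+ 2 * 1)); first by rewrite ler_wpM2l// ltW.
  by rewrite mulr1 -(real_normK (num_real (x - y))) lerXn2r ?nnegrE// ltW.
rewrite (rintZl _ i1) e1 le_eqVlt; apply/orP; left; apply/eqP; field.
by rewrite !gt_eqF.
Qed.

Lemma smear_cvg a b y (q : nat -> R) : (forall k, 0 < q k) -> q k @[k --> \oo] --> (0 : R) ->
  y != a -> y != b -> smear a b (q k) y @[k --> \oo] --> box_ind a b y.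
Proof.
move=> q0 cq ya yb; pose d := Num.min `|y - a| `|y - b|.
have d0 : 0 < d by rewrite lt_min !normr_gt0 !subr_eq0 ya.
apply/subr_cvg0/norm_cvg0P.
pose c := second_moment / (Num.sqrt pi * d ^+ 2).
apply: (@squeeze_cvgr _ _ _ _ (fun=> 0) (fun k => q k ^+ 2 * c)).
- near=> k; rewrite normr_ge0/=; apply: smear_near => //.
    by rewrite ge_min lexx.
  by rewrite ge_min lexx orbT.
- exact: cvg_cst.
- have -> : 0 = 0 ^+ 2 * c by rewrite expr0n mul0r.
  by apply: cvgMl; rewrite expr2; under eq_fun do rewrite expr2; exact: cvgM.
Unshelve. all: by end_near. Qed.

End smear.

Section box_integrals.
Context {R : realType} {n : nat}.
Notation L := (@lebesgue_measure R).
Notation E := 'rV[R]_n.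
Notation mu := (lebesgue_rV R n).
Local Open Scope complex_scope.

Lemma mulVKC (c : R) (w : R[i]) : c != 0 -> (c^-1)%:C * (c%:C * w) = w.
Proof. by move=> c0; rewrite mulrA -rmorphM mulVf// mul1r. Qed.

Lemma smear_normalization (r : R) : 0 < r ->
  2 * r ^+ 2 * Num.sqrt pi * Num.sqrt (pi / r ^+ 4) = 2 * pi.
Proof.
move=> r0; have r20 : 0 < r ^+ 2 by rewrite exprn_gt0.
have -> : Num.sqrt (pi / r ^+ 4) = Num.sqrt pi / r ^+ 2.
  rewrite sqrtrM ?pi_ge0//; congr (_ * _).
  have -> : (r ^+ 4)^-1 = (r ^+ 2)^-1 ^+ 2 by rewrite exprVn -exprM.
  by rewrite sqrtr_sqr gtr0_norm// invr_gt0.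
have -> : 2 * pi = 2 * Num.sqrt pi ^+ 2 :> R by rewrite sqr_sqrtr ?pi_ge0.
move: (Num.sqrt pi) => p; field; lra.
Qed.

Lemma cint_real d (T : measurableType d) (m : {measure set T -> \bar R}) (h : T -> R) :
  rinteg m h -> cinteg m (fun x => (h x)%:C) /\
  cint m (fun x => (h x)%:C) = (\int[m]_x h x)%:C.
Proof.
move=> ih; split; first by split => //=; exact: integrable0.
by apply: complex_eqP; rewrite /cint//= Rintegral_cst//= mul0r.
Qed.

Lemma rint_prodrV (h : 'I_n -> R -> R) : (forall i, rinteg L (h i)) ->
  rinteg mu (fun y => \prod_i h i (y 0 i)) /\
  \int[mu]_y (\prod_i h i (y 0 i)) = \prod_i \int[L]_x h i x.
Proof.
move=> ih; have ip := rinteg_prodrV ih; split => //.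
have [_] := cint_prodrV (h := fun i x => (h i x)%:C) (fun i => (cint_real (ih i)).1).
have -> : (fun y : E => \prod_i (h i (y 0 i))%:C) = fun y => (\prod_i h i (y 0 i))%:C.
  by apply/funext => y; rewrite rmorph_prod.
rewrite (cint_real ip).2; under eq_bigr do rewrite (cint_real (ih _)).2.
by rewrite -rmorph_prod => /(congr1 (@complex.Re R)).
Qed.

Lemma heat_kernel_real (x : E) (r : R) (y : E) : 0 < r ->
  heat_kernel (fun i => (x 0 i)%:C) (r ^+ 4) y =
  (\prod_i gauss1 (2 * r ^+ 2) (y 0 i) (x 0 i))%:C.
Proof.
move=> r0; rewrite /heat_kernel rmorph_prod; apply: eq_bigr => i _.
rewrite /= -cexp_real; congr cexp; rewrite -rmorphB -rmorphXn/= -rmorphN -fmorphV -rmorphM/=.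
by congr (_%:C); congr (_ / _); ring.
Qed.

Lemma gauss1_box_le (a b B q y x : R) : 0 < q -> (forall x, a < x <= b -> `|x| <= B) ->
  box_ind a b x * gauss1 q y x <= (1 + 2 * B ^+ 2 + 2 * q ^+ 2) * (1 + y ^+ 2)^-1 * box_ind a b x.
Proof.
move=> q0 hB; rewrite mulrC; rewrite box_indE; case: ifPn => [xab|_]; last by rewrite !mulr0.
rewrite !mulr1; have u0 : 0 < 1 + y ^+ 2 by have := sqr_ge0 y; lra.
rewrite ler_pdivlMr//; have q20 : 0 < q ^+ 2 by rewrite exprn_gt0.
set v := (x - y) ^+ 2 / q ^+ 2; have v0 : 0 <= v by rewrite divr_ge0 ?sqr_ge0// ltW.
have -> : gauss1 q y x = (expR v)^-1 by rewrite /gauss1 mulNr expRN.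
rewrite ler_pdivrMl ?expR_gt0// mulrC.
have B0 := sqr_ge0 B.
have h1 : 1 + y ^+ 2 <= (1 + 2 * B ^+ 2 + 2 * q ^+ 2) * (1 + v).
  have xB : x ^+ 2 <= B ^+ 2.
    by have := hB x xab => xB; rewrite -(real_normK (num_real x)) lerXn2r ?nnegrE// (le_trans _ xB).
  have vE : (x - y) ^+ 2 = q ^+ 2 * v by rewrite /v mulrC divfK// gt_eqF.
  have := sqr_ge0 (2 * x - y); nra.
by apply: (le_trans h1); apply: ler_wpM2l; [lra|exact: expR_ge1Dx].
Qed.

Lemma cvg_prod_ord (u : 'I_n -> nat -> R) (l : 'I_n -> R) :
  (forall i, u i k @[k --> \oo] --> l i) ->
  \prod_i u i k @[k --> \oo] --> \prod_i l i.
Proof.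
by move=> cu; apply: cvg_big; [exact: mul_continuous|move=> i _; exact: cu].
Qed.

(** A coordinate hyperplane is a box with one degenerate side, and in its measure the factor 0
    annihilates the infinite ones. *)
Lemma ae_coord_neq (a : 'I_n -> R) : {ae mu, forall y : E, forall i, y 0 i != a i}.
Proof.
apply: filter_forall => i.
pose A := [set y : E | forall j, (if j == i then [set a i] else setT) (y 0 j)].
have mA : measurable A.
  have -> : A = setT `&` @rVcoord R n i @^-1` [set a i].
    rewrite setTI; apply/seteqP; split => y /=.
      by move=> /(_ i); rewrite eqxx.
    by move=> ya j; case: eqP => [->|].
  by apply: measurable_rVcoord => //; exact: measurable_set1.
exists A; split => //.
  have -> : mu A = (\prod_(j < n) lebesgue_measure (if j == i then [set a i] else setT))%E.
    apply: (@lebesgue_rV_box R n (fun j => if j == i then [set a i] else setT)) => j.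
    by case: ifP => // _; exact: measurable_set1.
  by rewrite (bigD1 i)//= eqxx lebesgue_measure_set1 mul0e.
move=> y /= /negP; rewrite negbK => /eqP ya j; case: ifPn => [/eqP ->|_] //=.
Qed.

(** By Fubini, averaging the heat extension over the box equals pairing f with the smeared
    indicator; the product of the two normalizations is (2 pi)^(-n). As r tends to 0 the first side
    tends to 0, being bounded by M and pointwise convergent, and the second tends to the integral of
    f over the box. *)
Lemma heat_box (f g : E -> R[i]) (z : E) (h M : R) (a b : 'I_n -> R) :
  is_fourierL2 f g -> 0 <= M ->
  (forall t (x : E), 0 < t -> t <= 1 -> (forall i, `|x 0 i - z 0 i| <= h) ->
    normc (cint mu (fun xi => g xi * gauss_kernel (fun i => (x 0 i)%:C) t xi)) <= M) ->
  (forall x : E, (forall i, `|x 0 i - z 0 i| <= h) -> forall e : R, 0 < e ->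
    exists2 r0 : R, 0 < r0 & forall r, 0 < r -> r < r0 ->
    normc (cint mu (fun xi => g xi * gauss_kernel (fun i => (x 0 i)%:C) (r ^+ 4) xi)) <= e) ->
  (forall i x, a i < x <= b i -> `|x - z 0 i| <= h) ->
  cint mu (fun y => f y * (\prod_i box_ind (a i) (b i) (y 0 i))%:C) = 0.
Proof.
move=> fg M0 hM hv hab; have [/memL2P[mf if2] _ _] := fg.
pose B i := `|z 0 i| + h.
have hB i x : a i < x <= b i -> `|x| <= B i.
  by move/hab => hx; rewrite /B (_ : x = z 0 i + (x - z 0 i)) ?(le_trans (ler_normD _ _)) ?lerD2l//; ring.
pose P (x : E) := \prod_i box_ind (a i) (b i) (x 0 i).
have P0 x : 0 <= P x by apply: prodr_ge0 => i _; exact: box_ind_ge0.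
have iP : rinteg mu P by apply: (rinteg_prodrV (h := fun i => box_ind (a i) (b i))) => i; exact: rinteg_box_ind.
have mP := rinteg_meas iP.
have Pin x : P x != 0 -> forall i, `|x 0 i - z 0 i| <= h.
  move=> Px i; apply: hab; apply: contraNT Px => xi; rewrite /P (bigD1 i)//=.
  by rewrite box_indE (negbTE xi) mul0r.
pose F r (x : E) := cint mu (fun xi => g xi * gauss_kernel (fun i => (x 0 i)%:C) (r ^+ 4) xi).
pose S r (y : E) := \prod_i smear (a i) (b i) (2 * r ^+ 2) (y 0 i).
pose G r x := ((2 * pi) ^- n)%:C * ((P x)%:C * F r x).
have step r : 0 < r -> r < 1 -> [/\ cinteg mu (fun y => f y * (S r y)%:C),
    cinteg mu (G r) & cint mu (fun y => f y * (S r y)%:C) = cint mu (G r)].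
  move=> r0 r1; set q := 2 * r ^+ 2; have q0 : 0 < q by rewrite mulr_gt0// exprn_gt0.
  have t0 : 0 < r ^+ 4 by rewrite exprn_gt0.
  pose D i := 1 + 2 * B i ^+ 2 + 2 * q ^+ 2.
  have D0 i : 0 <= D i by have := sqr_ge0 (B i); have := sqr_ge0 q; rewrite /D; lra.
  pose K (p : E * E) := f p.2 * (\prod_i (box_ind (a i) (b i) (p.1 0 i) * gauss1 q (p.2 0 i) (p.1 0 i)))%:C.
  pose w (y : E) := \prod_i D i * (normc (f y) * \prod_i (1 + y 0 i ^+ 2)^-1).
  have iw : rinteg mu w by apply: rintegZ; exact: rinteg_L2_weight.
  have Kw x y : normc (K (x, y)) <= P x * w y.
    rewrite normcM normc_real/= ger0_norm; last first.
      by apply: prodr_ge0 => i _; rewrite mulr_ge0 ?box_ind_ge0 ?expR_ge0.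
    have -> : P x * w y = normc (f y) * \prod_i (D i * (1 + y 0 i ^+ 2)^-1 * box_ind (a i) (b i) (x 0 i)).
      rewrite !big_split/= /w /P; ring.
    apply: ler_wpM2l; first exact: normc_ge0.
    apply: ler_prod => i _; rewrite mulr_ge0 ?box_ind_ge0 ?expR_ge0//=.
    exact: (gauss1_box_le _ _ q0 (hB i)).
  have mK : cmeas K.
    apply: cmeasM; first by apply: (cmeas_comp mf); exact: measurable_snd.
    apply: cmeas_real; apply: measurable_prodr => i.
    have m1 : measurable_fun setT (fun p : E * E => p.1 0 i).
      exact: (measurableT_comp (measurable_id_coord i) measurable_fst).
    have m2 : measurable_fun setT (fun p : E * E => p.2 0 i).
      exact: (measurableT_comp (measurable_id_coord i) measurable_snd).
    apply: measurable_funM; first exact: (measurableT_comp (measurable_box_ind (a i) (b i)) m1).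
    apply: (measurableT_comp (@measurable_expR R)); apply: measurable_funM; last exact: measurable_cst.
    by apply: measurable_funN; apply: measurable_funX; exact: measurable_funB.
  have iK : cinteg (mu \x mu)%E K.
    apply: (@cinteg_le _ (E * E)%type R (mu \x mu)%E K (fun p => P p.1 * w p.2) mK).
      by case=> x y; exact: Kw.
    exact: rinteg_tensor.
  have i2 x : cinteg mu (fun y => K (x, y)).
    apply: (@cinteg_le _ E R mu _ (fun y => P x * w y)) => //.
      by apply: (cmeas_comp mK); exact: measurable_pair1.
    exact: rintegZ.
  have i1 y : cinteg mu (fun x => K (x, y)).
    apply: (@cinteg_le _ E R mu _ (fun x => P x * w y)) => //.
      by apply: (cmeas_comp mK); exact: measurable_pair2.
    by have := rintegZ (w y) iP; apply: eq_integrable => // x _ /=; rewrite mulrC.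
  have [j1 j2 e] := cfubini iK i2 i1.
  pose N := q * Num.sqrt pi.
  have N0 : 0 < N by exact: smear_norm_gt0.
  have innerx y : cint mu (fun x => K (x, y)) = (N ^+ n)%:C * (f y * (S r y)%:C).
    have ih i : rinteg L (fun x => box_ind (a i) (b i) x * gauss1 q (y 0 i) x) by exact: rinteg_smear.
    have [k1 k2] := rint_prodrV ih.
    rewrite /K/= (cintZ _ (cint_real k1).1) (cint_real k1).2 k2 mulrCA -rmorphM; congr (_ * _%:C).
    have -> : N ^+ n = \prod_(i < n) N by rewrite prodr_const card_ord.
    rewrite /S -big_split; apply: eq_bigr => i _ /=.
    by apply: esym; apply: mulVKf; rewrite gt_eqF.
  pose c := Num.sqrt (pi / r ^+ 4) ^+ n.
  have c0 : 0 < c by exact: sqrt_pit_gt0.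
  have innery x : cint mu (fun y => K (x, y)) = (P x)%:C * ((c^-1)%:C * F r x).
    have KEy y : K (x, y) = (P x)%:C * (f y * (\prod_i gauss1 q (y 0 i) (x 0 i))%:C).
      by rewrite /K/= big_split/= rmorphM/= mulrCA.
    have KE : (fun y => K (x, y)) = fun y => (P x)%:C * (f y * (\prod_i gauss1 q (y 0 i) (x 0 i))%:C).
      by apply/funext => y.
    have [Px|Px] := eqVneq (P x) 0.
      rewrite KE Px mul0r -[RHS](@cint0 _ _ _ mu); congr cint.
      by apply/funext => y; rewrite mul0r.
    have ifh : cinteg mu (fun y => f y * (\prod_i gauss1 q (y 0 i) (x 0 i))%:C).
      have := cintegZ ((P x)^-1)%:C (i2 x); congr cinteg.
      by apply/funext => y; rewrite KEy; exact: mulVKC.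
    rewrite KE.
    rewrite (cintZ _ ifh); congr (_ * _).
    rewrite /F (heat_extension _ fg t0) (mulVKC _ (lt0r_neq0 c0)).
    by congr cint; apply/funext => y; rewrite heat_kernel_real.
  have Nc : (N ^+ n)^-1 * c^-1 = (2 * pi) ^- n.
    rewrite -invfM -exprMn; congr ((_ ^+ n)^-1).
    exact: smear_normalization.
  have GE x : G r x = ((N ^+ n)^-1)%:C * cint mu (fun y => K (x, y)).
    by rewrite innery /G -Nc rmorphM/=; ring.
  have SE y : f y * (S r y)%:C = ((N ^+ n)^-1)%:C * cint mu (fun x => K (x, y)).
    rewrite innerx; apply: esym; apply: mulVKC; apply: lt0r_neq0; exact: exprn_gt0.
  split.
  - have := cintegZ ((N ^+ n)^-1)%:C j2; congr cinteg; apply/funext => y; exact/esym/SE.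
  - have := cintegZ ((N ^+ n)^-1)%:C j1; congr cinteg; apply/funext => x; exact/esym/GE.
  - transitivity (((N ^+ n)^-1)%:C * cint mu (fun y => cint mu (fun x => K (x, y)))).
      rewrite -(cintZ _ j2); congr cint; apply/funext => y; exact: SE.
    rewrite -e -(cintZ _ j1); congr cint; apply/funext => x; exact/esym/GE.
pose rk (k : nat) : R := 2^-1 * harmonic k.
have hk1 k : harmonic k <= 1 :> R by rewrite /harmonic invf_le1 ?ler1n.
have hk0 k : 0 < harmonic k :> R by rewrite /harmonic invr_gt0.
have rk0 k : 0 < rk k by rewrite mulr_gt0.
have rk1 k : rk k < 1 by have := hk1 k; rewrite /rk; lra.
have rkcvg : rk k @[k --> \oo] --> (0 : R).
  by rewrite -(mulr0 2^-1); apply: cvgMr; exact: cvg_harmonic.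
have sf k := step _ (rk0 k) (rk1 k).
have ifP : cinteg mu (fun y => f y * (P y)%:C).
  have cP : cmeas (fun y : E => (P y)%:C) by exact: (cmeas_real mP).
  apply: (cintegM_L2 mf cP if2); apply: (rinteg_le _ _ iP).
    by apply: measurable_funX; exact: cmeas_normc.
  move=> y; rewrite normc_real (ger0_norm (P0 y)) ger0_norm ?sqr_ge0//.
  rewrite expr2 ler_piMr//; apply: prodr_ile1 => i.
  by rewrite box_ind_ge0 box_ind_le1.
have p0 : 0 < (2 * pi) ^- n :> R by rewrite invr_gt0 exprn_gt0// mulr_gt0// pi_gt0.
have GnE r x : normc (G r x) = (2 * pi) ^- n * P x * normc (F r x).
  by rewrite /G !normcM !normc_real !ger0_norm ?P0 ?(ltW p0)// mulrA.
have lim1 : \int[mu]_x normc (G (rk k) x) @[k --> \oo] --> (0 : R).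
  have -> : 0 = \int[mu]_x (fun=> 0 : R) x by rewrite Rintegral_cst//= mul0r.
  apply: (Rdominated_cvg (g := fun x => (2 * pi) ^- n * M * P x)).
  - by move=> k; apply: cmeas_normc; have [_ iG _] := sf k; exact: cinteg_meas iG.
  - exact: measurable_cst.
  - apply: aeW => x; have [Px|Px] := eqVneq (P x) 0.
      rewrite /G Px; under eq_fun do rewrite mul0r mulr0 normc0; exact: cvg_cst.
    apply/cvgr0Pnorm_le => e e0.
    have c0 : 0 < (2 * pi) ^- n * P x :> R.
      by rewrite mulr_gt0 ?p0 ?lt_neqAle ?P0 ?andbT 1?eq_sym.
    have ec0 : 0 < e / ((2 * pi) ^- n * P x) by rewrite divr_gt0.
    have [r0 r00 hr0] := hv x (Pin x Px) _ ec0.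
    near=> k; rewrite ger0_norm ?normc_ge0//.
    have kr0 : rk k < r0.
      rewrite -[rk k]gtr0_norm//; near: k; exact: cvgr0_norm_lt rkcvg _ r00.
    have := hr0 (rk k) (rk0 k) kr0; rewrite -/(F _ x) => h1.
    rewrite GnE -ler_pdivlMl//; first by rewrite mulrC.
  - exact: rintegZ.
  move=> k x; rewrite ger0_norm ?normc_ge0// GnE.
  have [Px|Px] := eqVneq (P x) 0; first by rewrite Px !mulr0 mul0r.
  rewrite [leRHS]mulrAC ler_wpM2l//; first by rewrite mulr_ge0// ltW.
  by apply: hM; [rewrite exprn_gt0|rewrite exprn_ile1// ltW|exact: Pin].
have lim2 : \int[mu]_y normc (f y * (S (rk k) y)%:C - f y * (P y)%:C) @[k --> \oo] --> (0 : R).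
  pose C i : R := 1 + 2 * B i ^+ 2 + 8 * second_moment / Num.sqrt pi.
  have sp0 : 0 < Num.sqrt pi :> R by rewrite sqrtr_gt0 pi_gt0.
  have C1 i : 1 + 2 * B i ^+ 2 <= C i.
    by rewrite /C lerDl divr_ge0 ?(ltW sp0)// mulr_ge0// second_moment_ge0.
  pose W (y : E) := \prod_i (C i * (1 + y 0 i ^+ 2)^-1).
  have PW y : P y <= W y.
    apply: ler_prod => i _; rewrite box_ind_ge0/= box_indE; case: ifPn => [yab|_].
      have u0 : 0 < 1 + y 0 i ^+ 2 by have := sqr_ge0 (y 0 i); lra.
      rewrite ler_pdivlMr// mul1r; apply: le_trans (C1 i).
      have : y 0 i ^+ 2 <= B i ^+ 2.
        by have := hB i _ yab => yB; rewrite -(real_normK (num_real (y 0 i))) lerXn2r ?nnegrE// (le_trans _ yB).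
      by have := sqr_ge0 (y 0 i); lra.
    by rewrite mulr_ge0 ?(ltW (weightV_gt0 _))//; apply: le_trans (C1 i); have := sqr_ge0 (B i); lra.
  have q0 k : 0 < 2 * rk k ^+ 2 by rewrite mulr_gt0// exprn_gt0.
  have q2 k : 2 * rk k ^+ 2 <= 2.
    by rewrite ler_piMr// exprn_ile1// ?(ltW (rk0 k)) ?(ltW (rk1 k)).
  have S0 k y : 0 <= S (rk k) y by apply: prodr_ge0 => i _; exact: smear_ge0.
  have SW k y : S (rk k) y <= W y.
    apply: ler_prod => i _; rewrite smear_ge0//=.
    exact: (smear_le (y 0 i) (hB i) (q0 k) (q2 k)).
  have SPE k y : normc (f y * (S (rk k) y)%:C - f y * (P y)%:C) = normc (f y) * `|S (rk k) y - P y|.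
    by rewrite -mulrBr -rmorphB normcM normc_real.
  have -> : 0 = \int[mu]_x (fun=> 0 : R) x by rewrite Rintegral_cst//= mul0r.
  apply: (Rdominated_cvg (g := fun y => \prod_i C i * (normc (f y) * \prod_i (1 + y 0 i ^+ 2)^-1))).
  - by move=> k; apply: cmeas_normc; have [iS _ _] := sf k; exact: cinteg_meas (cintegB iS ifP).
  - exact: measurable_cst.
  (* The smeared indicator may fail to converge to the indicator only on the hyperplanes that carry
     the faces of the box, which are null sets. *)
  - have := ae_coord_neq a; have := ae_coord_neq b; apply: filterS2 => y yb ya.
    under eq_fun do rewrite SPE.
    rewrite -(mulr0 (normc (f y))); apply: cvgMr; apply/norm_cvg0P/subr_cvg0.
    apply: cvg_prod_ord => i; apply: (@smear_cvg _ _ _ _ (fun k => 2 * rk k ^+ 2)) => //.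
    rewrite -(mulr0 2); apply: cvgMr; rewrite -(mulr0 0).
    by under eq_fun do rewrite expr2; exact: cvgM.
  - by apply: rintegZ; exact: rinteg_L2_weight.
  move=> k y; rewrite ger0_norm ?normc_ge0// SPE [leRHS]mulrCA -big_split/=.
  apply: ler_wpM2l; first exact: normc_ge0.
  have := S0 k y; have := SW k y; have := PW y; have := P0 y; rewrite -/(W y).
  rewrite ler_norml; move: (S _ _) (W y) (P y) => s w p *; apply/andP; split; lra.
apply/eqP; rewrite -normc_eq0 eq_le normc_ge0 andbT; apply/ler_addgt0Pr => e e0.
have e20 : 0 < e / 2 by rewrite divr_gt0.
rewrite add0r; near \oo => k.
have [k1 k2 k3] := sf k.
have h1 : normc (cint mu (fun y => f y * (S (rk k) y)%:C)) <= e / 2.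
  rewrite k3 (le_trans (normc_cint k2))// (le_trans (ler_norm _))//.
  by near: k; exact: cvgr0_norm_le lim1 _ e20.
have h2 : normc (cint mu (fun y => f y * (S (rk k) y)%:C) - cint mu (fun y => f y * (P y)%:C)) <= e / 2.
  rewrite -(cintB k1 ifP) (le_trans (normc_cint (cintegB k1 ifP)))// (le_trans (ler_norm _))//.
  by near: k; exact: cvgr0_norm_le lim2 _ e20.
set I := cint mu _; rewrite -/I in h2; set J := cint mu _ in h1 h2.
have -> : I = J - (J - I) by rewrite opprB addrC subrK.
by rewrite (le_trans (le_normcD _ _))// normcN; lra.
Unshelve. all: end_near. Qed.

End box_integrals.

Section box_uniqueness.
Context {R : realType} {n : nat}.
Notation L := (@lebesgue_measure R).
Notation E := 'rV[R]_n.
Notation mu := (lebesgue_rV R n).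

Definition box (a b : 'I_n -> R) : set E := [set y | forall i, a i < y 0 i <= b i].

Lemma indic_box (a b : 'I_n -> R) (y : E) :
  \1_(box a b) y = \prod_i box_ind (a i) (b i) (y 0 i) :> R.
Proof.
rewrite indicE; have [yab|yab] := pselect (box a b y).
  by rewrite mem_set// big1// => i _; rewrite box_indE yab.
rewrite memNset//; have /existsNP[i yi] := yab.
by rewrite (bigD1 i)//= box_indE; move: yi => /negP/negbTE ->; rewrite mul0r.
Qed.

Lemma boxI (a b a' b' : 'I_n -> R) :
  box a b `&` box a' b' = box (fun i => Num.max (a i) (a' i)) (fun i => Num.min (b i) (b' i)).
Proof.
apply/seteqP; split => [y [h1 h2] i|y h].
  by rewrite gt_max le_min; have /andP[-> ->] := h1 i; have /andP[-> ->] := h2 i.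
by split => i; have := h i; rewrite gt_max le_min =>
  /andP[/andP[h1 h2] /andP[h3 h4]]; rewrite ?h1 ?h2 ?h3 ?h4.
Qed.

Definition boxes : set (set E) := [set A | exists a b, A = box a b].

Lemma boxes_setI_closed : setI_closed boxes.
Proof. by move=> _ _ [a [b ->]] [a' [b' ->]]; rewrite boxI; eexists; eexists. Qed.

Lemma measurable_box a b : measurable (box a b).
Proof.
have -> : box a b = \bigcap_(i in [set: 'I_n]) (@rVcoord R n i @^-1` `]a i, b i]%classic).
  apply/seteqP; split => [y h i _|y h i]; first by rewrite /= in_itv/=; exact: h.
  by have := h i Logic.I; rewrite /= in_itv.
apply: fin_bigcap_measurable => // i _.
by rewrite -[X in measurable X]setTI; exact: measurable_rVcoord.
Qed.

Lemma measurable_sigma_boxes (A : set E) : measurable A -> <<s boxes >> A.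
Proof.
have sB : sigma_algebra setT <<s boxes >> by exact: smallest_sigma_algebra.
suff : g_sigma_preimage (@rVcoord R n) `<=` <<s boxes >> by apply.
apply: smallest_sub => // B; rewrite -bigcup_seq => -[i _] [C mC <-] /=; rewrite setTI.
have : <<s (@ocitv R) >> `<=` [set C | <<s boxes >> (@rVcoord R n i @^-1` C)].
  apply: smallest_sub.
    split => /=.
    - by rewrite preimage_set0; exact: sigma_algebra0.
    - by move=> D mD; rewrite setTD preimage_setC -setTD; exact: sigma_algebraCD.
    - by move=> F mF; rewrite preimage_bigcup; exact: sigma_algebra_bigcup.
  move=> _ [[a b] _ <-] /=.
  (* A slab in coordinate i is exhausted by boxes that are bounded in the other coordinates. *)
  pose F k := box (fun j => if j == i then a else - k%:R) (fun j => if j == i then b else k%:R).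
  have -> : @rVcoord R n i @^-1` `]a, b]%classic = \bigcup_k F k.
    apply/seteqP; split => [y|y [k _] /(_ i)]; last by rewrite eqxx /= in_itv.
    rewrite /= in_itv/= => yi; exists (Num.bound (\sum_j `|y 0 j|)) => // j.
    case: eqP => [->//|_].
    have h : `|y 0 j| < (Num.bound (\sum_j `|y 0 j|))%:R.
      apply: le_lt_trans (archi_boundP _); last exact: sumr_ge0.
      by rewrite (bigD1 j)//= lerDl sumr_ge0.
    by move: h; rewrite ltr_norml => /andP[-> /ltW ->].
  by apply: sigma_algebra_bigcup => k; apply: sub_sigma_algebra; eexists; eexists.
by apply.
Qed.

(** The sets over which u integrates to 0 form a Dynkin system; integrability of u gives the
    monotone limits. Boxes are closed under intersection and generate the measurable sets, so all of
    these qualify. *)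
Lemma ae0_of_boxes (u : E -> R) : rinteg mu u -> \int[mu]_y u y = 0 ->
  (forall a b, \int[mu]_y (u y * \1_(box a b) y) = 0) -> {ae mu, forall y, u y = 0}.
Proof.
move=> iu u0 ub; have mu_ := rinteg_meas iu.
have iA (A : set E) : measurable A -> rinteg mu (fun y => u y * \1_A y).
  move=> mA; apply: (rinteg_le _ _ (rinteg_norm iu)).
    by apply: measurable_funM => //; exact: measurable_indic.
  move=> y; rewrite normrM ler_piMr// indicE.
  by case: (_ \in _); rewrite ?normr1 ?normr0.
have H (A : set E) : measurable A -> \int[mu]_y (u y * \1_A y) = 0.
  move=> /measurable_sigma_boxes sA.
  suff : <<s boxes >> `<=` [set A | measurable A /\ \int[mu]_y (u y * \1_A y) = 0].
    by move=> /(_ A sA)[].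
  apply: lambda_system_subset => //; first exact: boxes_setI_closed.
    split => //.
    - by split => //; rewrite -[RHS]u0; apply: eq_Rintegral => y _; rewrite indicT mulr1.
    - move=> B C CB [mB IB] [mC IC]; split; first exact: measurableD.
      rewrite -[RHS](subr0 0) -{1}IB -IC -RintegralB//; [|exact: iA|exact: iA].
      apply: eq_Rintegral => y _; rewrite -mulrBr; congr (_ * _).
      rewrite !indicE in_setD; have [yB|yB] := boolP (y \in B).
        by case: (y \in C); rewrite ?subrr ?subr0.
      have yC : y \notin C by apply: contraNN yB; rewrite !inE; exact: CB.
      by rewrite (negbTE yC) subrr.
    - move=> F ndF HF; have mF k := (HF k).1; have mU : measurable (\bigcup_k F k).
        by apply: bigcup_measurable => k _; exact: mF.
      split => //.
      have : \int[mu]_y (u y * \1_(F k) y) @[k --> \oo] --> \int[mu]_y (u y * \1_(\bigcup_k F k) y).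
        apply: (Rdominated_cvg (g := fun y => `|u y|)).
        + by move=> k; exact: (rinteg_meas (iA _ (mF k))).
        + exact: (rinteg_meas (iA _ mU)).
        + apply: aeW => y; apply: cvgMr.
          have [[k _ Fk]|yU] := pselect ((\bigcup_k F k) y).
            have -> : \1_(\bigcup_k F k) y = 1 :> R by rewrite indicE mem_set//; exists k.
            apply: cvg_near_cst; near=> m; rewrite indicE mem_set//.
            by apply: (subsetPset (F k) (F m) _ _) Fk; apply: ndF; near: m; exact: nbhs_infty_ge.
          have -> : \1_(\bigcup_k F k) y = 0 :> R by rewrite indicE memNset.
          apply: cvg_near_cst; apply: nearW => m.
          by rewrite indicE memNset// => Fm; apply: yU; exists m.
        + exact: rinteg_norm.
        + move=> k y; rewrite normrM ler_piMr// indicE.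
          by case: (_ \in _); rewrite ?normr1 ?normr0.
      under eq_fun do rewrite (HF _).2.
      by move/cvg_lim => <-//; rewrite lim_cst.
  by move=> _ [a [b ->]]; split; [exact: measurable_box|exact: ub].
(* On this set the indicator detects the sign: |u| = 2 u 1_A - u, so |u| integrates to 0. *)
pose A := [set y | 0 <= u y].
have mA : measurable A.
  have -> : A = setT `&` (fun y => 0 <= u y) @^-1` [set true].
    by rewrite setTI; apply/seteqP; split => y /=.
  by apply: measurable_fun_le => //; exact: measurable_cst.
have N0 : \int[mu]_y `|u y| = 0.
  have -> : \int[mu]_y `|u y| = \int[mu]_y (2 * (u y * \1_A y) - u y).
    apply: eq_Rintegral => y _; rewrite indicE; have [yA|yA] := boolP (y \in A).
      by move: yA; rewrite inE => /ger0_norm ->; rewrite mulr1; ring.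
    by move: yA; rewrite notin_setE /A/= => /negP; rewrite -ltNge => /ltr0_norm ->; rewrite mulr0; ring.
  by rewrite RintegralB//; [rewrite u0 (rintZl _ (iA _ mA)) H// mulr0 subr0|exact: rintegZ (iA _ mA)].
have : (\int[mu]_y `|(u y)%:E|)%E = 0%E.
  by rewrite (rinteg_EFin (rinteg_norm iu)) N0.
have muE : measurable_fun setT (EFin \o u) by exact/measurable_EFinP.
move/(ae_eq_integral_abs mu measurableT muE); apply: filterS => y /(_ Logic.I).
by move=> /(congr1 fine).
Unshelve. all: by end_near. Qed.

End box_uniqueness.

Section local_vanishing.
Context {R : realType} {n : nat}.
Notation E := 'rV[R]_n.
Notation mu := (lebesgue_rV R n).
Local Open Scope complex_scope.

(** Multiplying f by the indicator of the fixed box turns the hypothesis on its sub-boxes into one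
    on all boxes, as an intersection of boxes is a box. *)
Lemma box_cint_ae0 (f : E -> R[i]) (a0 b0 : 'I_n -> R) : cmeas f ->
  rinteg mu (fun x => normc (f x) ^+ 2) ->
  (forall a b, (forall i x, a i < x <= b i -> a0 i < x <= b0 i) ->
    cint mu (fun y => f y * (\prod_i box_ind (a i) (b i) (y 0 i))%:C) = 0) ->
  {ae mu, forall y, box a0 b0 y -> f y = 0}.
Proof.
move=> mf if2 h0.
pose I (y : E) : R := \1_(box a0 b0) y.
have iI2 : rinteg mu (fun y => I y ^+ 2).
  have := @rinteg_prodrV R n _ (fun i => rinteg_box_ind (a0 i) (b0 i)).
  apply: eq_integrable => // y _ /=; rewrite -indic_box /I indicE.
  by case: (_ \in _); rewrite ?expr1n ?expr0n.
have mI : measurable_fun setT I by apply: measurable_indic; exact: measurable_box.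
have aux (v : E -> R) : measurable_fun setT v -> (forall y, `|v y| <= normc (f y)) ->
    (forall a b, (forall i x, a i < x <= b i -> a0 i < x <= b0 i) ->
      \int[mu]_y (v y * \prod_i box_ind (a i) (b i) (y 0 i)) = 0) ->
    {ae mu, forall y, v y * I y = 0}.
  move=> mv vf hv.
  have iv2 : rinteg mu (fun y => v y ^+ 2).
    apply: (rinteg_le _ _ if2); first exact: measurable_funX.
    by move=> y; rewrite normrX lerXn2r ?nnegrE ?normc_ge0.
  apply: ae0_of_boxes.
  - exact: rintegM_L2.
  - rewrite -[RHS](hv a0 b0)//; apply: eq_Rintegral => y _.
    by rewrite /I indic_box.
  - move=> a b; rewrite -[RHS](hv (fun i => Num.max (a0 i) (a i)) (fun i => Num.min (b0 i) (b i))).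
      apply: eq_Rintegral => y _; rewrite -mulrA; congr (_ * _).
      rewrite -indic_box -boxI /I !indicE in_setI.
      by case: (_ \in box a0 _); case: (_ \in box a _); rewrite ?mulr1 ?mulr0 ?mul0r.
    by move=> i x; rewrite gt_max le_min => /andP[/andP[-> _] /andP[-> _]].
have [m1 m2] := mf.
have r1 : {ae mu, forall y, Re (f y) * I y = 0}.
  apply: aux => // [y|a b hab]; first exact: normRe_le.
  have := congr1 (@complex.Re R) (h0 a b hab) => /= <-; apply: eq_Rintegral => y _.
  by rewrite cReM/= mulr0 subr0.
have r2 : {ae mu, forall y, Im (f y) * I y = 0}.
  apply: aux => // [y|a b hab]; first exact: normIm_le.
  have := congr1 (@complex.Im R) (h0 a b hab) => /= <-; apply: eq_Rintegral => y _.
  by rewrite cImM/= mulr0 add0r.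
apply: filterS2 r1 r2 => y h1 h2 yb.
have Iy : I y = 1 by rewrite /I indicE mem_set.
by apply: complex_eqP; move: h1 h2; rewrite Iy !mulr1.
Qed.

(* It does not depend on the center, which makes the set of points near which f vanishes
   relatively closed. *)
Definition vanishing_radius (eta : R) : R := Num.min 1 (eta / (10 * n.+1%:R)) / 2.

Lemma vanishing_radius_gt0 eta : 0 < eta -> 0 < vanishing_radius eta.
Proof. by move=> e0; rewrite divr_gt0// lt_min ltr01 divr_gt0// mulr_gt0. Qed.

Lemma flat_locally_ae0 (ga : R) (Omega : set E) (f : E -> R[i]) (z : E) (eta : R) :
  0 < ga -> sobolevH ga f -> fraclap_eq0_in ga f Omega -> 0 < eta ->
  [set x : E | forall i, z 0 i - 2 * eta <= x 0 i <= z 0 i + 2 * eta] `<=` Omega ->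
  flat_at f z ->
  {ae mu, forall x : E, (forall i, `|x 0 i - z 0 i| < vanishing_radius eta) -> f x = 0}.
Proof.
move=> ga0 [fg _] hf eta0 QO fz.
have [/memL2P[mf if2] L2g _] := fg.
(* The second entry gives both [de <= eta / 10] and the condition on n de^2; the first is required
   by [heat_vanish]. *)
pose de : R := Num.min 1 (eta / (10 * n.+1%:R)).
have de0 : 0 < de by rewrite lt_min ltr01 divr_gt0// mulr_gt0.
have de1 : de <= 1 by rewrite ge_min lexx.
have den : n.+1%:R * de <= eta / 10.
  have : de <= eta / (10 * n.+1%:R) by rewrite ge_min lexx orbT.
  rewrite ler_pdivlMr ?mulr_gt0// => h; rewrite ler_pdivlMr//.
  by apply: le_trans h; rewrite le_eqVlt; apply/orP; left; apply/eqP; ring.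
have n1 : n.+1%:R = n%:R + 1 :> R by rewrite -addn1 natrD.
have n0 : 0 <= n%:R :> R by [].
have de_eta : de <= eta / 10 by move: den; rewrite n1; nra.
have nde : n%:R * de ^+ 2 <= eta ^+ 2 / 10.
  have : n%:R * de <= eta / 10 by move: den; rewrite n1; lra.
  rewrite !expr2; move: (n%:R) n0 => m m0 h; nra.
have [C C0 hC] := heat_bound ga0 eta0 (ltW de0) de_eta nde QO L2g hf.
have hE : vanishing_radius eta = de / 2 by [].
pose a0 (i : 'I_n) := z 0 i - de / 2; pose b0 (i : 'I_n) := z 0 i + de / 2.
have : {ae mu, forall y, box a0 b0 y -> f y = 0}.
  apply: box_cint_ae0 => // a b hab; apply: (heat_box fg C0 (z := z) (h := de / 2)).
  - move=> t x t0 t1 hx; apply: hC => // i; rewrite -rmorphB normc_real.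
    by apply: (le_trans (hx i)); lra.
  (* The power series is evaluated at s = 1/2, hence the factor 2 here and the radius de / 2. *)
  - move=> x hx e e0; pose w i := 2 * (x 0 i - z 0 i).
    have hw i : `|w i| <= de by rewrite normrM ger0_norm//; have := hx i; lra.
    have [r0 r00 hr0] := heat_vanish fg fz de1 hw hC e0.
    exists r0 => // r r_gt0 rr0; have := hr0 r r_gt0 rr0.
    have -> : (fun i => (z 0 i + 2^-1 * w i)%:C) = (fun i => (x 0 i)%:C).
      by apply/funext => i; congr (_%:C); rewrite /w; field.
    by [].
  - move=> i x /hab; rewrite /a0 /b0 => /andP[h1 h2]; rewrite ler_norml; apply/andP; split; lra.
apply: filterS => y hy yz; apply: hy => i; have := yz i; rewrite hE ltr_norml /a0 /b0 => /andP[h1 h2].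
by apply/andP; split; lra.
Qed.

End local_vanishing.

(** * Unique continuation *)

Section unique_continuation.
Context {R : realType} {n : nat}.
Notation E := 'rV[R]_n.
Notation mu := (lebesgue_rV R n).
Implicit Types (f : E -> R[i]).

Definition cube (x : E) (r : R) : set E := [set y : E | forall i, `|y 0 i - x 0 i| < r].

Definition ae0_in f (A : set E) : Prop := {ae mu, forall y, A y -> f y = 0}.

Lemma ae0_inS f A B : A `<=` B -> ae0_in f B -> ae0_in f A.
Proof. by move=> AB; rewrite /ae0_in; apply: filterS => y h /AB. Qed.

Lemma cubeS (x y : E) (r s d : R) : (forall i, `|x 0 i - y 0 i| <= d) -> d + r <= s ->
  cube x r `<=` cube y s.
Proof.
move=> xy rs w wx i; have := wx i; have := xy i.
have -> : w 0 i - y 0 i = (w 0 i - x 0 i) + (x 0 i - y 0 i) by ring.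
move=> h1 h2; apply: le_lt_trans (ler_normD _ _) _; lra.
Qed.

Lemma eball_cube (x : E) (r : R) : eball x r `<=` cube x r.
Proof.
move=> y yr i; have := coord_le_enorm (y - x) i; rewrite !mxE => h.
exact: le_lt_trans h yr.
Qed.

Lemma nbhs_cube (x : E) (r : R) : 0 < r -> nbhs x (cube x r).
Proof.
move=> r0; apply/nbhs_ballP; exists r => //= y xy i.
by have := xy.2 0 i; rewrite /ball/= distrC.
Qed.

(** Restores the hypothesis of flatness, so that the local argument can start again from any point
    near which f vanishes. *)
Lemma ae0_in_flat f (x : E) (r : R) : cmeas f -> 0 < r -> ae0_in f (cube x r) -> flat_at f x.
Proof.
move=> mf r0 fx k; exists 0, r; split => // s s0 sr; rewrite mul0r.
rewrite le_eqVlt; apply/orP; left; apply/eqP.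
have mg : measurable_fun setT (fun y => \1_(eball x s) y * normc (f y)).
  by apply: measurable_funM; [apply: measurable_indic; exact: measurable_eball|exact: cmeas_normc].
rewrite /ball_mass /Rintegral (ae_eq_integral (cst 0%E)) ?integral0//.
- exact/measurable_EFinP.
- move: fx; rewrite /ae0_in; apply: filterS => y hy _ /=; rewrite indicE; have [yb|yb] := boolP (y \in _).
    have yc : cube x r y.
      by move=> l; apply: lt_trans sr; apply: eball_cube; move: yb; rewrite inE.
    by rewrite hy// normc0 mulr0.
  by rewrite mul0r.
Qed.

(** A Lindelof argument: the cubes with rational centers and half-sides 1 / (k + 1) are countable,
    so the exceptional sets of those in which f vanishes form one null set together. *)
Lemma ae0_in_cover f (A : set E) :
  (forall x, A x -> exists2 r : R, 0 < r & ae0_in f (cube x r)) -> ae0_in f A.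
Proof.
move=> hA.
pose c (p : 'rV[rat]_n * nat) : set E := cube (map_mx ratr p.1) (p.2.+1%:R^-1).
pose Q (m : nat) (y : E) : Prop :=
  forall p, unpickle m = Some p -> ae0_in f (c p) -> c p y -> f y = 0.
have : {ae mu, forall y, forall m, Q m y}.
  apply: ae_foralln => m; rewrite /Q; case: (unpickle m) => [p|]; last by apply: aeW => y p.
  have [h|h] := pselect (ae0_in f (c p)).
    by move: (h); rewrite /ae0_in; apply: filterS => y hy _ [<-] _; exact: hy.
  by apply: aeW => y _ [<-].
rewrite /ae0_in; apply: filterS => y hy Ay; have [r r0 hr] := hA y Ay.
(* With 2 / (k + 1) < r, a rational cube of half-side 1 / (k + 1) that contains y lies in the cube
   of half-side r about y. *)
pose k := Num.bound (2 / r).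
have k1 : 2 * k.+1%:R^-1 < r.
  have : 2 / r < k.+1%:R.
    apply: lt_trans (archi_boundP _) _; last by rewrite ltr_nat.
    by rewrite divr_ge0// ltW.
  by rewrite ltr_pdivrMr// ltr_pdivrMr// mulrC.
have k0 : 0 < k.+1%:R^-1 :> R by rewrite invr_gt0.
have hq i : exists q : rat, `|y 0 i - ratr q| < k.+1%:R^-1.
  have [|q] := @rat_in_itvoo R (y 0 i - k.+1%:R^-1) (y 0 i + k.+1%:R^-1).
    by rewrite ltrD2l gtrN.
  by rewrite in_itv/= => hq; exists q; rewrite ltr_distlC.
have [q hq'] := choice hq.
have yc : c (\row_i q i, k) y by move=> i /=; rewrite !mxE; exact: hq'.
apply: (hy (pickle (\row_i q i, k)) (\row_i q i, k)) => //; first by rewrite pickleK.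
have half (e : R) : 2 * e < r -> e + e <= r by lra.
have kk := half _ k1.
apply: ae0_inS hr; apply: cubeS kk => i /=.
by rewrite !mxE distrC ltW.
Qed.

Lemma unique_continuation (ga : R) (Omega : set E) f (x0 : E) :
  0 < ga -> open Omega -> connected Omega -> sobolevH ga f -> fraclap_eq0_in ga f Omega ->
  Omega x0 -> flat_at f x0 -> ae0_in f Omega.
Proof.
move=> ga0 oO cO sf hf Ox0 fx0.
have [/memL2P[mf _] _ _] := sf.1.
pose Z : set E := [set x | exists2 r : R, 0 < r & ae0_in f (cube x r)].
(* The radius h is found before the flat point z: so a point of Omega that is a limit of points of Z
   has one of them within h, and belongs to Z itself. *)
have near p : Omega p -> exists2 h : R, 0 < h & forall z, cube p h z -> flat_at f z -> Z p.
  move=> Op; have [e /= e0 he] : exists2 e : R, 0 < e & cube p e `<=` Omega.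
    have /nbhs_ballP[e /= e0 he] : nbhs p Omega by exact: open_nbhs_nbhs.
    by exists e => // y yp; apply: he; split => // i j; rewrite /ball/= !ord1 distrC; exact: yp.
  (* Every z at distance at most h / 2 <= eta from p has its cube of half-side 2 eta inside the one
     of half-side e = 4 eta about p. *)
  pose eta := e / 4; have eta0 : 0 < eta by rewrite divr_gt0.
  have v0 := vanishing_radius_gt0 (n := n) eta0; set h := vanishing_radius eta in v0.
  have heta : h <= eta.
    rewrite /h /vanishing_radius ler_pdivrMr//.
    have : Num.min 1 (eta / (10 * n.+1%:R)) <= eta / (10 * n.+1%:R) by rewrite ge_min lexx orbT.
    move/le_trans; apply; rewrite ler_pdivrMr ?mulr_gt0//.
    have : 1 <= n.+1%:R :> R by rewrite ler1n.
    move: (n.+1%:R) => m; nra.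
  exists (h / 2) => [|z zp fz]; first by rewrite divr_gt0.
  have QO : [set x : E | forall i, z 0 i - 2 * eta <= x 0 i <= z 0 i + 2 * eta] `<=` Omega.
    move=> x xz; apply: he => i; have := xz i; have := zp i.
    rewrite !ltr_norml /eta => /andP[a1 a2] /andP[a3 a4]; rewrite /eta in heta *.
    by apply/andP; split; lra.
  have := flat_locally_ae0 ga0 sf hf eta0 QO fz; rewrite -/h => fz0.
  exists (h / 2); first by rewrite divr_gt0.
  apply: (@ae0_inS _ _ (cube z h)) => //.
  apply: (cubeS (d := h / 2)); last lra.
  by move=> i; rewrite distrC ltW.
have Zflat z : Z z -> flat_at f z by move=> [r r0 zr]; exact: ae0_in_flat zr.
have cube_self (p : E) (h : R) : 0 < h -> cube p h p by move=> h0 i; rewrite subrr normr0.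
suff ZO : Omega `&` Z = Omega.
  by apply: ae0_in_cover => x; rewrite -{1}ZO => -[].
apply: cO.
- exists x0; split => //; have [h h0 hx] := near x0 Ox0; apply: (hx x0) => //.
  exact: cube_self.
- exists Z => //; rewrite openE => x [r r0 xr].
  have r20 : 0 < r / 2 by rewrite divr_gt0.
  apply: filterS (nbhs_cube x r20) => y yx.
  exists (r / 2) => //; apply: ae0_inS xr; apply: (cubeS (d := r / 2)); last lra.
  by move=> i; rewrite ltW.
- exists (closure Z); first exact: closed_closure.
  apply/seteqP; split => x [Ox Zx]; split => //; first exact: subset_closure.
  have [h h0 hx] := near x Ox.
  have [z [Zz zx]] := Zx _ (nbhs_cube x h0).
  exact: hx z zx (Zflat z Zz).
Qed.

End unique_continuation.

Theorem corollary5p5 (R : realType) (n : nat) (gamma : R)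
    (Omega : set 'rV[R]_n) (f : 'rV[R]_n -> R[i]) (x0 : 'rV[R]_n) :
  (0 < n)%N ->
  0 < gamma ->
  gamma \isn't a Num.int ->
  smooth_domain Omega ->
  sobolevH gamma f ->
  fraclap_eq0_in gamma f Omega ->
  Omega x0 ->
  vanishes_infinite_order f x0 ->
  {ae lebesgue_rV R n, forall x, Omega x -> f x = 0}.
Proof.
move=> _ gamma0 _ [oOmega cOmega _] fH f0 Omega_x0 /flat_atP flat_x0.
exact: (unique_continuation gamma0 oOmega cOmega fH f0 Omega_x0 flat_x0).
Qed.
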